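(* In the scaled framework described in the context, assume (A1)–(A11), (H1)–(H3), that $F(u) < 0$ and $G(u) = 0$ for all $u \in W\setminus\{0\}$, and that (for every $c\in\mathbb{R}$) $h(u)\neq 0$ for all $u\in\mathcal{N}_c$. Let $I^+ = (0,\infty)$. Then: (i) For each $c \in I^+$, $\lambda_{c,k} \nearrow \infty$ ($k\ge1$) is a sequence of critical values of $\lambda_c$. Moreover, $\Phi_{\lambda_{c,k}}$ has a nontrivial critical point $u_{c,k}$ with $\Phi_{\lambda_{c,k}}(u_{c,k}) = c$. (ii) For each $k \ge 1$, the mapping $I^+ \to \mathbb{R}$, $c \mapsto \lambda_{c,k}$ is continuous, decreasing, and satisfies $\lim_{c \to 0^+} \lambda_{c,k} = \infty$ and $\lim_{c \to \infty} \lambda_{c,k} = \lambda_k$. (iii) For $\lambda \le \lambda_1$, $\Phi_\lambda$ has no nontrivial critical point. For each $\lambda > \lambda_k$, $\Phi_\lambda$ has at least $k$ pairs of nontrivial critical points. For all $\lambda \in \mathbb{R}$, $\Phi_\lambda$ has no nontrivial critical point with critical value in $\mathbb{R}\setminus I^+$.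
   Context: Scaled framework. $W$ is a reflexive (real) Banach space with dual $W^*$; $\rightharpoonup$ is weak convergence. $W$ carries a scaling: a continuous map $W\times[0,\infty)\to W$, $(u,t)\mapsto u_t$, with (A1) $(u_{t_1})_{t_2}=u_{t_1t_2}$ for all $u\in W$, $t_1,t_2\ge0$; (A2) $(\tau u)_t=\tau u_t$ for all $u\in W$, $\tau\in\mathbb{R}$, $t\ge0$; (A3) $u_0=0$, $u_1=u$; (A4) $u_t$ is bounded on bounded sets in $W\times[0,\infty)$; (A5) for some (fixed) $s>0$, $\|u_t\|=O(t^s)$ as $t\to\infty$ uniformly in $u$ on bounded sets. A potential operator is $p\in C(W,W^* )$ that is the Fréchet derivative of some $P\in C^1(W,\mathbb{R})$ (its potential, normalized by $P(0)=0$). A scaled operator is an odd potential operator $A_s$ that maps bounded sets into bounded sets and satisfies $A_s(u_t)v_t=t^sA_s(u)v$ for all $u,v\in W$, $t\ge0$. Given are scaled operators $A_s,B_s$ with potentials $I_s(u)=\int_0^1A_s(\tau u)u\,d\tau$, $J_s(u)=\int_0^1B_s(\tau u)u\,d\tau$, and odd potential operators $f,g\in C(W,W^* )$ with potentials $F(u)=\int_0^1f(\tau u)u\,d\tau$, $G(u)=\int_0^1g(\tau u)u\,d\tau$, satisfying: (A6) $A_s(u)u>0$ for $u\ne0$; (A7) every sequence with $u_j\rightharpoonup u$ and $A_s(u_j)(u_j-u)\to0$ has a subsequence converging strongly to $u$; (A8) $B_s(u)u>0$ for $u\neq0$; (A9) $u_j\rightharpoonup u$ implies $B_s(u_j)\to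 B_s(u)$ in $W^*$; (A10) $I_s(u)\to\infty$ as $\|u\|\to\infty$; (A11) every solution of $A_s(u)=\lambda B_s(u)$ ($\lambda\in\mathbb{R}$) satisfies $I_s(u)=\lambda J_s(u)$; (H1) for some $r>s>q>0$, $f(u_t)v_t=t^qf(u)v$ and $g(u_t)v_t=t^rg(u)v$ for all $u,v\in W$, $t\ge0$; (H2) $u_j\rightharpoonup u$ implies $f(u_j)\to f(u)$ and $g(u_j)\to g(u)$ in $W^*$ (in particular $f,g$ map bounded sets into bounded sets); (H3) for all $\alpha,\beta,\gamma,\delta\in\mathbb{R}$, every solution of $\alpha A_s(u)=\beta B_s(u)+\gamma f(u)+\delta g(u)$ satisfies $s\alpha I_s(u)=s\beta J_s(u)+q\gamma F(u)+r\delta G(u)$. Notation. $\Phi_\lambda(u)=I_s(u)-\lambda J_s(u)-F(u)-G(u)$ on $W$ (an even functional; a pair of critical points is $\pm u$). For $c\in\mathbb{R}$, $\lambda_c(u)=\dfrac{I_s(u)-F(u)-G(u)-c}{J_s(u)}$ on $W\setminus\{0\}$ (note $J_s>0$ there). $\mathcal{M}_s=\{u\in W:I_s(u)=1\}$. The scaled Nehari set is $\mathcal{N}_c=\{u_t:u\in\mathcal{M}_s,\ t>0,\ \varphi_{c,u}'(t)=0\}$ with $\varphi_{c,u}(t)=\lambda_c(u_t)$; equivalently $\mathcal{N}_c=\{u\in W\setminus\{0\}:(s-q)F(u)-(r-s)G(u)+cs=0\}$. $h(u)=(s-q)f(u)-(r-s)g(u)$. $\Lambda_c=\lambda_c|_{\mathcal{N}_c}$.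 $i(M)$ is the Fadell–Rabinowitz $\mathbb{Z}_2$-cohomological index of a symmetric ($M=-M$) set $M\subset W\setminus\{0\}$: $i(\emptyset)=0$, and for $M\neq\emptyset$, with $\overline M=M/\{u\sim-u\}$, classifying map $\theta:\overline M\to\mathbb{RP}^\infty$ of $M\to\overline M$, and $\omega$ the generator of $H^1(\mathbb{RP}^\infty;\mathbb{Z}_2)$, $i(M)=\sup\{m\ge1:\theta^*(\omega^{m-1})\neq0\}$ (Alexander–Spanier cohomology, $\mathbb{Z}_2$ coefficients). For $k\ge1$, $$\lambda_k=\inf\Big\{\sup_{u\in M}\tfrac{1}{J_s(u)}: M\subset\mathcal{M}_s\text{ symmetric},\ i(M)\ge k\Big\},\qquad \lambda_{c,k}=\inf\Big\{\sup_{u\in M}\Lambda_c(u): M\subset\mathcal{N}_c\text{ symmetric},\ i(M)\ge k\Big\}.$$ $a_k\nearrow a$ means $(a_k)$ is nondecreasing with limit $a$ (possibly $\infty$). ''Decreasing'' means strictly decreasing.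
   Formalization: Parts (i) and (ii) are stated for infinite-dimensional W; in finite dimension no symmetric set has index k > dim W, so λ_{c,k} = inf ∅ = ∞ is not a critical value and (i), (ii) fail. Part (iii) is stated for every W. *)

(* Defs.v *)
From HB Require Import structures.
From mathcomp Require Import all_boot all_order all_algebra.
From mathcomp Require Import generic_quotient mxpoly.
From mathcomp Require Import all_classical all_reals all_analysis.

Set Implicit Arguments.
Unset Strict Implicit.
Unset Printing Implicit Defensive.

Import Order.TTheory GRing.Theory Num.Theory.
Import numFieldTopology.Exports numFieldNormedType.Exports.

Local Open Scope classical_set_scope.
Local Open Scope ring_scope.

(* Alexander-Spanier cohomology with Z_2 coefficients.
   A [q]-cochain is an arbitrary function on (q+1)-tuples of points; the
   Alexander-Spanier complex is the quotient of the cochains by the locally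
   zero ones.  Classes are handled through their representatives, and the usual
   signs in the coboundary are omitted because the coefficients are 'F_2. *)

Section AlexanderSpanier.
Variable X : topologicalType.

Definition cochain (q : nat) : Type := ('I_q.+1 -> X) -> 'F_2.

Definition delta (q : nat) (phi : cochain q) : cochain q.+1 :=
  fun v => \sum_(i < q.+2) phi (v \o lift i).

Definition locally_zero (q : nat) (phi : cochain q) : Prop :=
  forall x : X, exists2 U : set X, nbhs x U &
    forall v : 'I_q.+1 -> X, (forall i, U (v i)) -> phi v = 0.

(* [phi] is a cocycle of the quotient complex. *)
Definition as_cocycle (q : nat) (phi : cochain q) : Prop :=
  locally_zero (delta phi).

(* [phi] is a coboundary of the quotient complex; for a cocycle [phi] this says
   that its class is zero in H^q.  There are no coboundaries but 0 in degree 0. *)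
Definition as_coboundary (q : nat) : cochain q -> Prop :=
  match q with
  | 0 => fun phi => locally_zero phi
  | q'.+1 => fun phi => exists psi : cochain q',
      locally_zero (fun v => phi v - delta psi v)
  end.

Definition cup (p q : nat) (phi : cochain p) (psi : cochain q) :
    cochain (p + q) :=
  fun v => phi (fun i => v (inord i)) * psi (fun j => v (inord (p + j))).

Fixpoint cup_pow (w : cochain 1) (m : nat) : cochain m :=
  match m with
  | 0 => fun=> 1
  | m'.+1 => cup w (@cup_pow w m')
  end.

Definition generates_H1 (w : cochain 1) : Prop :=
  as_cocycle w /\
  forall v : cochain 1, as_cocycle v ->
    exists a : 'F_2, as_coboundary (fun x => v x - a * w x).

End AlexanderSpanier.

Arguments cup_pow {X} w m.

Definition pullback (X Y : topologicalType) (theta : X -> Y) (q : nat)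
    (phi : cochain Y q) : cochain X q :=
  fun v => phi (theta \o v).

Section AntipodalQuotient.
Local Open Scope quotient_scope.
Variables (K : numDomainType) (V : preTopologicalLmodType K) (M : set V).

Definition antipodal (x y : M) : bool :=
  (val x == val y) || (val x == - val y).

Lemma antipodal_refl : reflexive antipodal.
Proof. by move=> x; rewrite /antipodal eqxx. Qed.

Lemma antipodal_sym : symmetric antipodal.
Proof.
move=> x y; rewrite /antipodal [val y == val x]eq_sym; congr (_ || _).
by rewrite -eqr_oppLR eq_sym.
Qed.

Lemma antipodal_trans : transitive antipodal.
Proof.
move=> y x z; rewrite /antipodal.
by move=> /orP[|] /eqP-> /orP[|] /eqP->; rewrite ?opprK eqxx ?orbT.
Qed.

Definition antipodal_equiv :=
  EquivRel antipodal antipodal_refl antipodal_sym antipodal_trans.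

Definition mod_antipodal : Type := {eq_quot antipodal_equiv}.

HB.instance Definition _ := Quotient.copy mod_antipodal {eq_quot antipodal_equiv}.
HB.instance Definition _ :=
  Topological.copy mod_antipodal (quotient_topology {eq_quot antipodal_equiv}).

Definition proj_antipodal (x : M) : mod_antipodal :=
  \pi_{eq_quot antipodal_equiv} x.

End AntipodalQuotient.

(* Finitely supported real sequences are represented by their generating
   polynomials; the topology is the colimit topology of the inclusions
   R^n -> R^oo (here [rVpoly]), so that the quotient of the unit sphere is the
   usual CW-complex RP^oo. *)

Section RPinf.
Variable R : realType.

Definition Rinf : Type := {poly R}.
HB.instance Definition _ := GRing.Lmodule.on Rinf.

Definition Rinf_open (U : set Rinf) : Prop :=
  forall n : nat, open [set v : 'rV[R]_n | U (rVpoly v)].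

Lemma Rinf_openT : Rinf_open setT.
Proof. by move=> n; exact: openT. Qed.

Lemma Rinf_openI : setI_closed Rinf_open.
Proof. by move=> A B oA oB n; exact: openI (oA n) (oB n). Qed.

Lemma Rinf_open_bigU (I : Type) (f : I -> set Rinf) :
  (forall i, Rinf_open (f i)) -> Rinf_open (\bigcup_i f i).
Proof.
move=> of_ n.
by apply: (@bigcup_open _ _ _ (fun i => [set v | f i (rVpoly v)])) => i _;
  exact: of_.
Qed.

HB.instance Definition _ :=
  isOpenTopological.Build Rinf Rinf_openT Rinf_openI Rinf_open_bigU.

Definition Sinf : set Rinf :=
  [set p | \sum_(i < size (p : {poly R})) (p : {poly R})`_i ^+ 2 = 1].

Definition RPinf : topologicalType := mod_antipodal Sinf.

End RPinf.

Arguments Sinf R : clear implicits.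

Section Index.
Variables (R : realType) (V : preTopologicalLmodType R).

Definition symmetric_set (M : set V) : Prop := forall u, M u -> M (- u).

(* [theta] classifies the double cover M -> M / {u ~ -u}: it is covered by a
   Z_2-equivariant map of M into the universal cover S^oo of RP^oo. *)
Definition classifying (M : set V) (theta : mod_antipodal M -> RPinf R) : Prop :=
  continuous theta /\
  exists f : M -> Sinf R,
    [/\ continuous f,
        forall x y : M, val y = - val x -> val (f y) = - val (f x) &
        forall x : M, theta (proj_antipodal x) = proj_antipodal (f x)].

(* Classifying maps are unique up to homotopy and H^1(RP^oo; Z_2) has a single
   generator, so the choice of [theta] and [w] does not matter. *)
Definition fr_index (M : set V) : \bar R :=
  if `[< M = set0 >] then 0%E else
  ereal_sup [set m%:R%:E | m in [set m : nat | (1 <= m)%N /\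
    exists (theta : mod_antipodal M -> RPinf R) (w : cochain (RPinf R) 1),
      [/\ classifying theta, generates_H1 w &
          ~ as_coboundary (pullback theta (cup_pow w m.-1))]]].

Definition minimax (N : set V) (E : V -> R) (k : nat) : \bar R :=
  ereal_inf [set ereal_sup [set (E u)%:E | u in M] |
    M in [set M : set V |
      [/\ M `<=` N, symmetric_set M & (k%:R%:E <= fr_index M)%E]]].

End Index.

Section Banach.
Variables (R : realType) (W : normedModType R).

Definition infinite_dimensional : Prop :=
  forall (n : nat) (e : 'I_n -> W),
    exists u : W, forall a : 'I_n -> R, u <> \sum_(i < n) a i *: e i.

(* Elements of W^* are represented by their underlying functions. *)
Definition dual : set (W -> R) :=
  [set phi | linear (phi : W -> R^o) /\ continuous phi].

Definition dual_norm (phi : W -> R) : R :=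
  sup [set `|phi v| | v in [set v : W | `|v| <= 1]].

Definition reflexive_space : Prop :=
  forall xi : (W -> R) -> R,
    (forall (a : R) (phi psi : W -> R), dual phi -> dual psi ->
      xi (fun v => a * phi v + psi v) = a * xi phi + xi psi) ->
    (exists C : R, forall phi, dual phi -> `|xi phi| <= C * dual_norm phi) ->
    exists u : W, forall phi, dual phi -> xi phi = phi u.

Definition weakly_cvg (u : nat -> W) (l : W) : Prop :=
  forall phi, dual phi -> phi (u j) @[j --> \oo] --> phi l.

Definition dual_cvg (phi : nat -> W -> R) (psi : W -> R) : Prop :=
  dual_norm (phi j \- psi) @[j --> \oo] --> (0 : R).

Definition potential_operator (p : W -> W -> R) : Prop :=
  [/\ forall u, dual (p u),
      forall u, dual_norm (p v \- p u) @[v --> u] --> (0 : R) &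
      exists P : W -> R^o, forall u, is_diff u P (p u)].

Definition odd_operator (p : W -> W -> R) : Prop :=
  forall u v, p (- u) v = - p u v.

Definition bounded_operator (p : W -> W -> R) : Prop :=
  forall M : R, exists C : R, forall u, `|u| <= M -> dual_norm (p u) <= C.

Definition weak_to_strong (p : W -> W -> R) : Prop :=
  forall (u : nat -> W) (l : W), weakly_cvg u l -> dual_cvg (p \o u) (p l).

(* The potential of [p] vanishing at 0. *)
Definition potential (p : W -> W -> R) (u : W) : R :=
  \int[@lebesgue_measure R]_(tau in `[0, 1]) p (tau *: u) u.

Definition critical_point (E : W -> R) (u : W) : Prop :=
  is_diff u (E : W -> R^o) (fun=> 0).

End Banach.

Section Scaled.
Variables (R : realType) (W : normedModType R).
(* [sc u t] is u_t; its values for t < 0 are irrelevant. *)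
Variable sc : W -> R -> W.

Record is_scaling (s : R) : Prop := {
  scaling_continuous :
    {within [set x : W * R | 0 <= x.2], continuous (fun x => sc x.1 x.2)} ;
  scaling_mul : forall u t1 t2, 0 <= t1 -> 0 <= t2 ->
    sc (sc u t1) t2 = sc u (t1 * t2) ;
  scaling_homogeneous : forall u (tau t : R), 0 <= t ->
    sc (tau *: u) t = tau *: sc u t ;
  scaling_0 : forall u, sc u 0 = 0 ;
  scaling_1 : forall u, sc u 1 = u ;
  scaling_bounded : forall M : R, exists C : R, forall u t,
    `|u| <= M -> 0 <= t <= M -> `|sc u t| <= C ;
  scaling_growth : forall M : R, exists C T : R, forall u t,
    `|u| <= M -> T <= t -> `|sc u t| <= C * t `^ s }.

Definition scales_with (a : R) (p : W -> W -> R) : Prop :=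
  forall u v t, 0 <= t -> p (sc u t) (sc v t) = t `^ a * p u v.

Definition scaled_operator (s : R) (p : W -> W -> R) : Prop :=
  [/\ potential_operator p, odd_operator p, bounded_operator p &
      scales_with s p].

Variables A B f g : W -> W -> R.

Definition Phi (lambda : R) (u : W) : R :=
  potential A u - lambda * potential B u - potential f u - potential g u.

(* Relevant for u != 0 only. *)
Definition lambda_fun (c : R) (u : W) : R :=
  (potential A u - potential f u - potential g u - c) / potential B u.

Definition unit_level : set W := [set u | potential A u = 1].

Definition nehari (c : R) : set W :=
  [set w | exists (u : W) (t : R),
    [/\ unit_level u, 0 < t,
        is_derive (t : R^o) 1 (fun x => lambda_fun c (sc u x) : R^o) 0 &
        w = sc u t]].

Definition lambda_ (k : nat) : \bar R :=
  minimax unit_level (fun u => (potential B u)^-1) k.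

Definition lambda_c (c : R) (k : nat) : \bar R :=
  minimax (nehari c) (lambda_fun c) k.

End Scaled.

(* Main.v *)
Require Import Defs.
From HB Require Import structures.
From mathcomp Require Import all_boot all_order all_algebra.
From mathcomp Require Import all_classical all_reals all_analysis.
From mathcomp Require Import generic_quotient zify ring lra.
From mathcomp Require wochoice.

Set Implicit Arguments.
Unset Strict Implicit.
Unset Printing Implicit Defensive.

Import Order.TTheory GRing.Theory Num.Theory.
Import numFieldTopology.Exports numFieldNormedType.Exports.

Local Open Scope classical_set_scope.
Local Open Scope ring_scope.

(* Along a ray t |-> u_t the functional lambda_c has a single critical point, its
   maximum, and the maximal value E_kappa(u) = (I(u) + kappa |F(u)|^(s/q)) / J(u)
   is invariant under scaling; here kappa is a decreasing function of c.  So
   lambda_{c,k} is the k-th minimax level of E_kappa on M_s, and lambda_k is the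
   one of E_0.  Since |F| is bounded on M_s, and bounded away from 0 on the
   sublevels of E_kappa there, these levels are continuous and strictly
   increasing in kappa and tend to infinity with kappa.
   - Compactness of B maps the sublevels of E_kappa on M_s oddly into some
     R^m \ 0, so they have finite index; odd cross polytopes, whose index is
     computed by barycentric subdivision, have arbitrarily large index.
   - E_kappa satisfies the Palais-Smale condition; without critical points at a
     level, an odd deformation lowers it.  No vector field has to be integrated:
     the deformation is an infinite composition of small odd displacements.
   - If two consecutive levels agree, splitting off a neighbourhood of the
     critical set shows that this set is infinite.  Otherwise the values kappa_j
     at which the j-th level equals lambda are distinct, and so are the
     corresponding critical values c_j. *)

(** * Alexander-Spanier cochains *)

(** Origin of E_kappa: for I(u) = 1 the value of lambda_c at u_t is (1 + |F(u)| t^(q-s) - c t^(-s))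
    / J(u), maximal where |F(u_t)| = mu := cs/(s-q). There |F| - c = cq/(s-q), and this constant is
    written kappa |F|^(s/q) with kappa = (cq/(s-q)) mu^(-s/q). The exponent s/q is the one for which
    |F|^(s/q) scales like I and J, and kappa is a constant times c^(1-s/q), a decreasing bijection
    of the positive reals because s > q. So a problem on a set that moves with c becomes a monotone
    family on the fixed set M_s. Two obstacles shape the rest. The index is defined by classifying
    maps, which have to be produced and compared; instead the class of the double cover of M/{u ~
    -u} is described by a sheet function on M, which determines it up to coboundaries. And dE_kappa
    is only continuous, so gradient flows need not exist; the deformation therefore works in W near
    M_s, and scale invariance brings points back to M_s at the same level. *)

Lemma F2_addxx (x : 'F_2) : x + x = 0.
Proof. by rewrite addrr_pchar2 // pchar_Fp. Qed.

Lemma F2_opp (x : 'F_2) : - x = x.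
Proof. by rewrite oppr_pchar2 // pchar_Fp. Qed.

(** [ring] does not know that 2 = 0; the caller supplies the term [t] whose two copies have to
    cancel. *)
Lemma F2_eqD (t x y : 'F_2) : x = y + (t + t) -> x = y.
Proof. by rewrite F2_addxx addr0. Qed.

Lemma F2_cases (x : 'F_2) : x = 0 \/ x = 1.
Proof.
by case: x => [[|[|//]]] i; [left|right]; apply/val_inj.
Qed.

Section Algebra.
Variable X : Type.

(** Seen as functions of two points, 1-cochains satisfy cocycle identities that [ring] can
    handle. *)
Definition ev2 (w : ('I_2 -> X) -> 'F_2) (x y : X) : 'F_2 :=
  w (fun i => if i == ord0 then x else y).

Definition ev2d (w : ('I_2 -> X) -> 'F_2) (x y z : X) : 'F_2 :=
  ev2 w y z + ev2 w x z + ev2 w x y.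

Lemma ev2E (w : ('I_2 -> X) -> 'F_2) v : w v = ev2 w (v ord0) (v (lift ord0 ord0)).
Proof.
rewrite /ev2; congr w; apply/funext => -[[|[|//]] i] /=; congr v; exact/val_inj.
Qed.

End Algebra.

Section Coboundary.
Variable X : topologicalType.

Lemma deltaD q (a b : cochain X q) :
  delta (fun v => a v + b v) = fun v => delta a v + delta b v.
Proof. by apply/funext => v; rewrite /delta big_split. Qed.

Lemma deltaB q (a b : cochain X q) :
  delta (fun v => a v - b v) = fun v => delta a v - delta b v.
Proof. by apply/funext => v; rewrite /delta sumrB. Qed.

Lemma delta0 (a : cochain X 0) v :
  delta a v = a (fun=> v ord0) + a (fun=> v (lift ord0 ord0)).
Proof.
rewrite /delta big_ord_recl big_ord1 addrC.
congr (_ + _); congr a; apply/funext => i /=; congr v; apply/val_inj => /=;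
  by rewrite (ord1 i).
Qed.

Lemma delta1 (w : cochain X 1) v :
  delta w v = ev2d w (v ord0) (v (lift ord0 ord0)) (v (lift ord0 (lift ord0 ord0))).
Proof.
rewrite /delta big_ord_recl big_ord_recl big_ord1 /ev2d addrA.
by congr (_ + _ + _); rewrite ev2E /=; congr ev2; congr v; exact/val_inj.
Qed.

Lemma deltaK q (a : cochain X q) v : delta (delta a) v = 0.
Proof.
rewrite /delta /=.
(* Faces are indexed by natural numbers, so that the halves of the double sum can be exchanged
   without casts between ordinals. *)
pose F i j := a (fun k : 'I_q.+1 => v (inord (bump i (bump j k)))).
have -> : \sum_(i < q.+3) \sum_(j < q.+2) a ((v \o lift i) \o lift j) =
    \sum_(i < q.+3) \sum_(j < q.+2) F i j.
  apply: eq_bigr => i _; apply: eq_bigr => j _; congr a; apply/funext => k /=.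
  congr v; apply/val_inj => /=; rewrite inordK //.
  exact: (ltn_ord (lift i (lift j k))).
(* The simplicial identity: it matches the terms with i <= j to the remaining ones, and equal terms
   cancel in characteristic 2. *)
have Fsym i j : (i <= j)%N -> F i j = F j.+1 i.
  move=> ij; congr a; apply/funext => k; congr (v (inord _)).
  by rewrite bumpC /bump /unbump; congr (_ + _)%N; [congr nat_of_bool|]; lia.
under eq_bigr => i _ do rewrite (bigID (fun j : 'I_q.+2 => (i <= j)%N)) /=.
rewrite big_split /= (exchange_big_dep predT) //=.
have -> : \sum_(j < q.+2) \sum_(i < q.+3 | (i <= j)%N) F i j =
  \sum_(i < q.+3) \sum_(j < q.+2 | ~~ (i <= j)%N) F i j.
  rewrite [RHS]big_ord_recl [X in _ = X + _]big1 ?add0r //.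
  apply: eq_bigr => j _; rewrite (big_ord_widen_cond q.+3 (fun i => (i <= j)%N) (fun i => F i j)) //.
  rewrite big_mkcond [RHS]big_mkcond /= big_ord_recr /=.
  have -> : (q.+2 <= j)%N = false by apply/negbTE; rewrite -ltnNge.
  rewrite addr0; apply: eq_bigr => i _ /=.
  rewrite /bump /= add1n -ltnNge ltnS (ltnW (ltn_ord i)) andbT; rewrite ltnS.
  by case: ifP => // ij; exact: Fsym.
by rewrite F2_addxx.
Qed.

(** Only the points of [S] are tested, but the neighbourhoods and the tuples are those of [X]. This
    lets different cochains vanish on different members of a cover. *)
Definition lzero (S : set X) q (a : cochain X q) : Prop :=
  forall x, S x -> exists2 U : set X, nbhs x U &
    forall v : 'I_q.+1 -> X, (forall i, U (v i)) -> a v = 0.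

Lemma lzeroT q (a : cochain X q) : lzero setT a <-> locally_zero a.
Proof. by split=> [h x|h x _]; exact: h. Qed.

Lemma lzero_ext S q (a b : cochain X q) : a =1 b -> lzero S a -> lzero S b.
Proof. by move=> /funext ->. Qed.

Lemma lzero0 S q : lzero S ((fun=> 0) : cochain X q).
Proof. by move=> x _; exists setT => //; exact: filterT. Qed.

Lemma lzeroD S q (a b : cochain X q) :
  lzero S a -> lzero S b -> lzero S (fun v => a v + b v).
Proof.
move=> ha hb x Sx; have [U nU hU] := ha x Sx; have [U' nU' hU'] := hb x Sx.
exists (U `&` U'); first exact: filterI.
by move=> v hv; rewrite hU ?hU' ?addr0 // => i; have [] := hv i.
Qed.

Lemma lzeroS S S' q (a : cochain X q) : S `<=` S' -> lzero S' a -> lzero S a.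
Proof. by move=> SS' h x Sx; exact/h/SS'. Qed.

Lemma lzero_reindex S p q (a : cochain X p) (b : cochain X q)
    (s : 'I_p.+1 -> 'I_q.+1) :
  (forall v, a (v \o s) = 0 -> b v = 0) -> lzero S a -> lzero S b.
Proof.
move=> ab h x Sx; have [U nU hU] := h x Sx; exists U => // v hv.
by apply: ab; apply: hU => i; exact: hv.
Qed.

Lemma cupE m (w : cochain X 1) (P : cochain X m) v :
  cup w P v = ev2 w (v ord0) (v (lift ord0 ord0)) * P (v \o lift ord0).
Proof.
rewrite /cup ev2E; congr (ev2 _ (v _) (v _) * P _);
  try by apply/val_inj; rewrite /= inordK.
by apply/funext => j /=; congr v; apply/val_inj; rewrite /= inordK // ltnS ltn_ord.
Qed.

Definition cup0 m (c : X -> 'F_2) (P : cochain X m) : cochain X m :=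
  fun v => c (v ord0) * P v.

Lemma delta_cup0 m (c : X -> 'F_2) (P : cochain X m) v :
  delta (cup0 c P) v =
  (c (v ord0) + c (v (lift ord0 ord0))) * P (v \o lift ord0) + c (v ord0) * delta P v.
Proof.
rewrite /delta /cup0 big_ord_recl [X in _ = _ + _ * X]big_ord_recl /=.
rewrite (eq_bigr (fun i => c (v ord0) * P (v \o lift (lift ord0 i)))); last first.
  by move=> i _; congr (c (v _) * _); exact/val_inj.
rewrite -mulr_sumr; apply: (F2_eqD (t := - (c (v ord0) * P (v \o lift ord0)))).
set S := \sum_(i < _) _.
by ring.
Qed.

(** The Leibniz rule, exact on cochains: the product of [w] on the first two points with [P] on the
    points from the third on occurs in both summands and cancels. *)
Lemma delta_cup m (w : cochain X 1) (P : cochain X m) v :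
  delta (cup w P) v =
  ev2d w (v ord0) (v (lift ord0 ord0)) (v (lift ord0 (lift ord0 ord0))) *
    P (v \o (lift ord0 \o lift ord0)) + cup w (delta P) v.
Proof.
rewrite cupE /delta big_ord_recl big_ord_recl !cupE.
rewrite [X in _ = _ + _ * X]big_ord_recl /=.
under eq_bigr => i _ do rewrite cupE.
rewrite (eq_bigr (fun i : 'I_m.+1 => ev2 w (v ord0) (v (lift ord0 ord0)) *
    P ((v \o lift ord0) \o lift (lift ord0 i)))); last first.
  move=> i _; congr (ev2 w (v _) (v _) * P _); try exact/val_inj.
  apply/funext => j /=; congr v; apply/val_inj.
  have b0 k : bump 0 k = k.+1 by [].
  by rewrite /= !b0 bumpS.
rewrite -mulr_sumr.
have -> : P ((v \o lift (lift ord0 ord0)) \o lift ord0) =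
    P (v \o (lift ord0 \o lift ord0)).
  by congr P; apply/funext => j /=; congr v; exact/val_inj.
have -> : P ((v \o lift ord0) \o lift ord0) = P (v \o (lift ord0 \o lift ord0)) by [].
have -> : lift (lift ord0 ord0) ord0 = ord0 :> 'I_m.+3 by exact/val_inj.
have -> : lift (lift ord0 ord0) (lift ord0 ord0) = lift ord0 (lift ord0 ord0) :> 'I_m.+3.
  exact/val_inj.
rewrite /ev2d; set S := \sum_(i < _) _.
move: (ev2 w _ _) (ev2 w _ _) (ev2 w _ _) (P _) S => a b c p t.
by apply: (F2_eqD (t := - (a * p))); ring.
Qed.

Lemma lzero_cupr S m (w : cochain X 1) (P : cochain X m) :
  lzero S P -> lzero S (cup w P).
Proof.
apply: (@lzero_reindex _ _ _ _ _ (lift ord0)) => v vP.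
by rewrite cupE vP mulr0.
Qed.

Lemma lzero_cupl S m (w : cochain X 1) (P : cochain X m) :
  lzero S w -> lzero S (cup w P).
Proof.
pose s (i : 'I_2) : 'I_m.+2 := if i == ord0 then ord0 else lift ord0 ord0.
apply: (@lzero_reindex _ _ _ _ _ s) => v; rewrite ev2E => vw.
have {}vw : ev2 w (v ord0) (v (lift ord0 ord0)) = 0 by [].
by rewrite cupE vw mul0r.
Qed.

Lemma lzero_cocycle m (w : cochain X 1) (Q : ('I_m.+3 -> X) -> 'F_2) :
  as_cocycle w -> lzero setT
    ((fun v => ev2d w (v ord0) (v (lift ord0 ord0)) (v (lift ord0 (lift ord0 ord0)))
       * Q v) : cochain X m.+2).
Proof.
move/lzeroT.
pose s (i : 'I_3) : 'I_m.+3 := if i == ord0 then ord0 else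
  if i == lift ord0 ord0 then lift ord0 ord0 else lift ord0 (lift ord0 ord0).
apply: (@lzero_reindex _ _ _ _ _ s) => v; rewrite delta1 => vw.
have {}vw : ev2d w (v ord0) (v (lift ord0 ord0)) (v (lift ord0 (lift ord0 ord0))) = 0.
  by [].
by rewrite vw mul0r.
Qed.

Lemma as_coboundary_lzero q (a : cochain X q) : locally_zero a -> as_coboundary a.
Proof.
case: q a => [|q] a // /lzeroT h; exists (fun=> 0); apply/lzeroT.
apply: lzero_ext h => v.
by rewrite /delta big1 ?subr0.
Qed.

Lemma as_coboundaryD q (a b : cochain X q) : as_coboundary a -> as_coboundary b ->
  as_coboundary (fun v => a v + b v).
Proof.
case: q a b => [|q] a b; first by move=> /lzeroT ha /lzeroT hb; exact/lzeroT/lzeroD.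
move=> [p /lzeroT hp] [p' /lzeroT hp']; exists (fun v => p v + p' v); apply/lzeroT.
apply: lzero_ext (lzeroD hp hp') => v.
by rewrite deltaD /=; ring.
Qed.

Lemma as_coboundary_cup m (w : cochain X 1) (Q : cochain X m) :
  as_cocycle w -> as_coboundary Q -> as_coboundary (cup w Q).
Proof.
move=> cw; case: m Q => [|m] Q.
  move=> /lzeroT hQ; apply: as_coboundary_lzero; exact/lzeroT/lzero_cupr.
move=> [p /lzeroT hp]; exists (cup w p); apply/lzeroT.
have h := lzeroD (lzero_cupr w hp)
  (lzero_cocycle (fun v => p (v \o (lift ord0 \o lift ord0))) cw).
apply: lzero_ext h => v; rewrite delta_cup !cupE /=.
by rewrite -[X in _ + X = _]F2_opp; ring.
Qed.

Lemma cup_pow_cocycle (w : cochain X 1) m : as_cocycle w -> as_cocycle (cup_pow w m).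
Proof.
move=> cw; elim: m => [|m /lzeroT IH]; apply/lzeroT.
  by apply: (lzero_ext _ (@lzero0 setT _)) => v; rewrite delta0 /= F2_addxx.
have h := lzeroD (lzero_cupr w IH)
  (lzero_cocycle (fun v => cup_pow w m (v \o (lift ord0 \o lift ord0))) cw).
by apply: lzero_ext h => v; rewrite [RHS]delta_cup addrC.
Qed.

(** The effect on a cup product of replacing [w] by the cohomologous [w - delta p]: up to the
    coboundary of p P, the only error is p times the coboundary of P, which is locally zero for a
    cocycle. *)
Lemma cup_sub_delta m (w : cochain X 1) (p : cochain X 0) (P : cochain X m) v :
  cup w P v - delta (cup0 (fun x => p (fun=> x)) P) v =
  cup (fun u => w u - delta p u) P v + p (fun=> v ord0) * delta P v.
Proof.
rewrite delta_cup0 !cupE /ev2 delta0 /= -[X in _ = _ + X]F2_opp.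
by ring.
Qed.

(** Telescoping: w^(m+1) - w'^(m+1) = (w - w') w^m + w' (w^m - w'^m), and a product of an exact
    class with a cocycle is exact. *)
Lemma cup_pow_cohomologous (w w' : cochain X 1) m :
  as_cocycle w -> as_cocycle w' -> as_coboundary (fun v => w v - w' v) ->
  as_coboundary (fun v => cup_pow w m v - cup_pow w' m v).
Proof.
move=> cw cw' [p /lzeroT hp]; elim: m => [|m IH].
  apply: as_coboundary_lzero; apply/lzeroT.
  by apply: (lzero_ext _ (@lzero0 setT _)) => v; rewrite /= subrr.
pose P := cup_pow w m.
have h1 : as_coboundary (cup (fun v => w v - w' v) P).
  exists (cup0 (fun x => p (fun=> x)) P); apply/lzeroT.
  have h2 := lzero_cupl P hp.
  have h3 : lzero setT (fun v => p (fun=> v ord0) * delta P v).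
    have /lzeroT := cup_pow_cocycle m cw.
    by apply: (@lzero_reindex _ _ _ _ _ id) => v vP; rewrite (vP : delta P v = 0) mulr0.
  by apply: lzero_ext (lzeroD h2 h3) => v; rewrite cup_sub_delta.
have := as_coboundaryD h1 (as_coboundary_cup cw' IH).
congr as_coboundary; apply/funext => v; rewrite !cupE /ev2 /=.
by rewrite !cupE /ev2 /P; ring.
Qed.

Lemma as_coboundary_pow_leq (w : cochain X 1) m k : as_cocycle w -> (m <= k)%N ->
  as_coboundary (cup_pow w m) -> as_coboundary (cup_pow w k).
Proof.
move=> cw /subnK <-; elim: (k - m)%N => // n IH h.
by apply: as_coboundary_cup => //; exact: IH.
Qed.

(** Exactness near [S] only. Cochains are arbitrary functions, so the primitive can be taken on all
    of [X] and no relative cohomology is required. *)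
Definition cob_on (S : set X) q : cochain X q -> Prop :=
  match q with
  | 0 => fun a => lzero S a
  | q'.+1 => fun a => exists p : cochain X q', lzero S (fun v => a v - delta p v)
  end.

(* Lusternik's argument: a cup product of classes vanishing on the members of a
   cover vanishes. *)
Lemma cup_pow_cover (w : cochain X 1) m (S1 S2 : set X) : as_cocycle w ->
  cob_on S1 (cup_pow w m) -> cob_on S2 w -> S1 `|` S2 = setT ->
  as_coboundary (cup_pow w m.+1).
Proof.
move=> cw h1 [p hp] S12.
rewrite -[cup_pow w m.+1]/(cup w (cup_pow w m)); have := cup_pow_cocycle m cw.
move: (cup_pow w m) h1 => P h1 /lzeroT cP.
pose a u := w u - delta p u; pose c x := p (fun=> x).
have h3 : lzero setT (fun v => c (v ord0) * delta P v).
  apply: (@lzero_reindex _ _ _ _ _ id _ cP) => v vP.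
  by rewrite (vP : delta P v = 0) mulr0.
(* [a] = w - delta p vanishes near [S2] and [b] near [S1]; the two sets cover, so the product
   vanishes locally everywhere. *)
have both (b : cochain X m) : lzero S1 b -> lzero setT (cup a b).
  move=> hb x _; have : (S1 `|` S2) x by rewrite S12.
  by case=> [/(lzero_cupr a hb)|/(lzero_cupl b hp)].
case: m P h1 cP h3 both => [|m] /= P h1 _ h3 both.
  exists (cup0 c P); apply/lzeroT.
  by apply: lzero_ext (lzeroD (both _ h1) h3) => v; rewrite cup_sub_delta.
(* With P = delta p1 near [S1], the product w P is delta (c P) plus a P, and a P is delta (a p1) up
   to a locally zero term. *)
case: h1 => p1 hp1; exists (fun v => cup0 c P v + cup a p1 v); apply/lzeroT.
have ca : as_cocycle a.
  apply/lzeroT; have /lzeroT := cw; apply: lzero_ext => v.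
  by rewrite [in RHS]/a deltaB deltaK subr0.
have := lzeroD (lzeroD (both _ hp1) h3)
  (lzero_cocycle (fun v => p1 (v \o (lift ord0 \o lift ord0))) ca).
apply: lzero_ext => v.
rewrite deltaD delta_cup opprD addrA cup_sub_delta -/a opprD F2_opp !cupE.
by rewrite -/(c _); ring.
Qed.

End Coboundary.

Section Pullback.
Variables (X Y : topologicalType) (t : X -> Y).
Hypothesis ct : continuous t.

Lemma lzero_pullback S q (a : cochain Y q) :
  lzero S a -> lzero (t @^-1` S) (pullback t a).
Proof.
move=> h x Sx; have [U nU hU] := h _ Sx.
by exists (t @^-1` U); [exact: ct|move=> v hv; exact: hU].
Qed.

Lemma cup_pow_pullback (w : cochain Y 1) m :
  cup_pow (pullback t w) m = pullback t (cup_pow w m).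
Proof.
elim: m => //= m ->; apply/funext => v; rewrite [RHS]/pullback !cupE.
by rewrite /ev2 /pullback; congr (w _ * _); apply/funext => i /=; case: ifP.
Qed.

Lemma as_coboundary_pullback q (a : cochain Y q) :
  as_coboundary a -> as_coboundary (pullback t a).
Proof.
case: q a => [|q] a; first by move=> /lzeroT h; exact/lzeroT/(lzero_pullback h).
move=> [p /lzeroT hp]; exists (pullback t p); apply/lzeroT.
exact: (lzero_pullback hp).
Qed.

Lemma as_cocycle_pullback q (a : cochain Y q) :
  as_cocycle a -> as_cocycle (pullback t a).
Proof. by move=> /lzeroT h; exact/lzeroT/(lzero_pullback h). Qed.

End Pullback.

(** * The double cover of M/{u ~ -u} and its characteristic class *)

Section Antipodal.
Variables (R : realType) (V : preTopologicalLmodType R).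

Lemma proj_antipodalE (M : set V) (x y : M) :
  proj_antipodal x = proj_antipodal y <-> (val x = val y \/ val x = - val y).
Proof.
rewrite /proj_antipodal; split.
  by move=> /eqmodP /= /orP[/eqP|/eqP]; [left|right].
by move=> h; apply/eqmodP => /=; apply/orP; case: h => ->; [left|right].
Qed.

Lemma proj_antipodal_surj (M : set V) (z : mod_antipodal M) :
  exists x, proj_antipodal x = z.
Proof. by exists (repr z); rewrite /proj_antipodal reprK. Qed.

Lemma proj_antipodal_continuous (M : set V) : continuous (@proj_antipodal R V M).
Proof. exact: pi_continuous. Qed.

Definition neg_on (M : set V) (sM : symmetric_set M) (x : M) : M :=
  exist _ (- val x) (mem_set (sM _ (set_valP x))).

(** [c] names the sheet of each point and [w] records locally whether two points lie on the same
    sheet, so [w] represents the first Stiefel-Whitney class of the cover. No classifying map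
    occurs, which spares the uniqueness of such maps up to homotopy. *)
Definition characteristic (M : set V) (w : cochain (mod_antipodal M) 1)
    (c : M -> 'F_2) : Prop :=
  (forall x y : M, val y = - val x -> c y = c x + 1) /\
  forall x : M, exists2 U : set M, nbhs x U &
    forall y z, U y -> U z -> ev2 w (proj_antipodal y) (proj_antipodal z) = c y + c z.

Hypothesis opp_cont : continuous (-%R : V -> V).

Lemma neg_on_continuous (M : set V) (sM : symmetric_set M) : continuous (neg_on sM).
Proof.
apply/continuous_comp_initial => x.
apply: (@continuous_comp _ _ _ (val : M -> V) -%R); last exact: opp_cont.
exact: initial_continuous.
Qed.

(** The projection is open, because the preimage of the image of an open set is its union with its
    antipode. *)
Lemma nbhs_proj_antipodal (M : set V) (x : M) (U : set M) : symmetric_set M ->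
  nbhs x U -> nbhs (proj_antipodal x) (@proj_antipodal R V M @` U).
Proof.
move=> sM; rewrite nbhsE => -[D [oD Dx] DU].
apply: (@filterS _ _ _ (@proj_antipodal R V M @` D)); first exact: image_subset.
apply: open_nbhs_nbhs; split; last by exists x.
rewrite /open /= /quotient_open.
rewrite (_ : _ @^-1` _ = D `|` neg_on sM @^-1` D).
  by apply: openU => //; have /continuousP := @neg_on_continuous M sM; exact.
apply/seteqP; split=> [y [z Dz /proj_antipodalE [|]]|y [Dy|Dy]] /=.
- by move=> /val_inj <-; left.
- move=> zy; right; have -> // : neg_on sM y = z by apply/val_inj; rewrite /= zy.
- by exists y.
- by exists (neg_on sM y) => //; apply/proj_antipodalE; right.
Qed.

Lemma lzero_proj_antipodal (M S : set V) q (a : cochain (mod_antipodal M) q) :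
  symmetric_set M ->
  (forall x : M, S (val x) -> exists2 U : set M, nbhs x U & forall v : 'I_q.+1 -> M,
     (forall i, U (v i)) -> a (@proj_antipodal R V M \o v) = 0) ->
  lzero (@proj_antipodal R V M @` [set x | S (val x)]) a.
Proof.
move=> sM h _ [x Sx <-]; have [U nU hU] := h x Sx.
exists (@proj_antipodal R V M @` U); first exact: nbhs_proj_antipodal.
move=> v hv; have /choice[u hu] : forall i, exists y, U y /\ proj_antipodal y = v i.
  by move=> i; have [y Uy <-] := hv i; exists y.
have -> : v = @proj_antipodal R V M \o u by apply/funext => i /=; have [] := hu i.
by apply: hU => i; have [] := hu i.
Qed.

Lemma lzeroT_proj_antipodal (M : set V) q (a : cochain (mod_antipodal M) q) :
  symmetric_set M ->
  (forall x : M, exists2 U : set M, nbhs x U & forall v : 'I_q.+1 -> M,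
     (forall i, U (v i)) -> a (@proj_antipodal R V M \o v) = 0) ->
  lzero setT a.
Proof.
move=> sM h; apply: (@lzeroS _ _ (@proj_antipodal R V M @` [set x | setT (val x)])).
  by move=> z _; have [x <-] := proj_antipodal_surj z; exists x.
by apply: lzero_proj_antipodal => // x _; exact: h.
Qed.

Section Characteristic.
Variables (M : set V) (sM : symmetric_set M).

Lemma characteristic_cocycle w c : characteristic w c -> @as_cocycle (mod_antipodal M) 1 w.
Proof.
move=> [_ h]; apply/lzeroT/lzeroT_proj_antipodal => // x.
have [U nU hU] := h x; exists U => // v Uv.
rewrite delta1 /ev2d /= !hU //.
set a := c _; set b := c _; set d := c _.
by apply: (F2_eqD (t := a + b + d)); ring.
Qed.

(** Both sheet functions change by 1 under the antipode, so c + c' descends to the quotient, where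
    it is a primitive of w - w'. *)
Lemma characteristic_uniq w w' c c' : characteristic w c -> characteristic w' c' ->
  @as_coboundary (mod_antipodal M) 1 (fun v => w v - w' v).
Proof.
move=> [hc hw] [hc' hw']; pose p (x : M) := c x + c' x.
have pE (x y : M) : proj_antipodal x = proj_antipodal y -> p x = p y.
  move=> /proj_antipodalE [/val_inj -> //|e]; rewrite /p (hc _ _ e) (hc' _ _ e).
  by apply: (F2_eqD (t := 1)); ring.
have pr x : p (repr (proj_antipodal x)) = p x.
  by apply: pE; rewrite {1}/proj_antipodal reprK.
exists (fun v => p (repr (v ord0))).
apply/lzeroT/lzeroT_proj_antipodal => // x.
have [U nU hU] := hw x; have [U' nU' hU'] := hw' x.
exists (U `&` U'); first exact: filterI.
move=> v Uv; rewrite delta0 /= !ev2E /=.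
have [U0 U0'] := Uv ord0; have [U1 U1'] := Uv (lift ord0 ord0).
rewrite hU // hU' // !pr.
rewrite /p; set a := c _; set b := c _; set a' := c' _; set b' := c' _.
by apply: (F2_eqD (t := - (a' + b'))); ring.
Qed.

End Characteristic.
End Antipodal.

Section QuotientMap.
Variables (R : realType) (V V' : preTopologicalLmodType R).
Variables (M : set V) (M' : set V').
Variable f : M -> M'.

Definition odd_map := forall x y : M, val y = - val x -> val (f y) = - val (f x).

Definition quotient_map (z : mod_antipodal M) : mod_antipodal M' :=
  proj_antipodal (f (repr z)).

Hypothesis f_odd : odd_map.

Lemma quotient_mapE x : quotient_map (proj_antipodal x) = proj_antipodal (f x).
Proof.
rewrite /quotient_map; set y := repr _.
have : proj_antipodal y = proj_antipodal x by rewrite {1}/proj_antipodal reprK.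
move=> /proj_antipodalE [/val_inj -> //|e]; apply/proj_antipodalE; right.
exact: f_odd.
Qed.

Lemma quotient_map_continuous : continuous f -> continuous quotient_map.
Proof.
move=> cf; apply/quotient_continuous => x.
rewrite (_ : _ \o _ = @proj_antipodal _ _ _ \o f); last first.
  by apply/funext => y /=; exact: quotient_mapE.
apply: continuous_comp; first exact: cf.
exact: proj_antipodal_continuous.
Qed.

Lemma characteristic_pullback (t : mod_antipodal M -> mod_antipodal M') w c :
  continuous f -> (forall x, t (proj_antipodal x) = proj_antipodal (f x)) ->
  characteristic w c -> characteristic (pullback t w) (c \o f).
Proof.
move=> cf tE [hc hw]; split=> [x y e|x]; first by apply: hc; exact: f_odd.
have [U nU hU] := hw (f x); exists (f @^-1` U); first exact: cf.
move=> y z Uy Uz; rewrite -[RHS]hU // -!tE /ev2 /pullback /=.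
by congr w; apply/funext => i /=; case: ifP.
Qed.

End QuotientMap.

(** * The cohomology of the infinite projective space *)

Section SphereAtInfinity.
Variable R : realType.
Implicit Types (p x y z : {poly R}).

Lemma cvg_sum_ord (V : normedModType R) (T : topologicalType) (n : nat) (f : 'I_n -> T -> V)
    (a : T) :
  (forall i, {for a, continuous (f i)}) ->
  {for a, continuous (fun t => \sum_(i < n) f i t)}.
Proof.
move=> cf; apply: (cvg_big (op := +%R) (x0 := 0)) => [|i _]; last exact: cf.
exact: add_continuous.
Qed.

Definition sqnorm p : R := \sum_(i < size p) p`_i ^+ 2.

Lemma sqnormE n p : (size p <= n)%N -> sqnorm p = \sum_(i < n) p`_i ^+ 2.
Proof.
move=> pn; rewrite /sqnorm (big_ord_widen n (fun i => p`_i ^+ 2)) // big_mkcond.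
apply: eq_bigr => i _; case: ltnP => // /leq_sizeP -> //.
by rewrite expr0n.
Qed.

Lemma sqnormN p : sqnorm (- p) = sqnorm p.
Proof.
rewrite /sqnorm size_polyN; apply: eq_bigr => i _.
by rewrite coefN sqrrN.
Qed.

Lemma sqnorm_gt0 p : p != 0 -> 0 < sqnorm p.
Proof.
move=> p0; rewrite lt_neqAle eq_sym; apply/andP; split; last first.
  by apply: sumr_ge0 => i _; exact: sqr_ge0.
apply: contra p0 => /eqP h; rewrite -lead_coef_eq0 lead_coefE.
have [p0|sp] := posnP (size p); first by rewrite nth_default // p0.
have := @psumr_eq0P _ _ predT (fun i : 'I_(size p) => p`_i ^+ 2).
move=> /(_ (fun i _ => sqr_ge0 _) h).
have pn : ((size p).-1 < size p)%N by rewrite prednK.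
by move=> /(_ (Ordinal pn) isT) /eqP; rewrite sqrf_eq0.
Qed.

Lemma sqnorm0 : sqnorm 0 = 0.
Proof. by rewrite /sqnorm size_poly0 big_ord0. Qed.

Lemma sqnorm_neq0 p : 0 < sqnorm p -> p != 0.
Proof. by move=> h; apply: contraL h => /eqP ->; rewrite sqnorm0 ltxx. Qed.

Lemma sqnormZ (a : R) p : sqnorm (a *: p) = a ^+ 2 * sqnorm p.
Proof.
rewrite (@sqnormE (size p) (a *: p)) ?size_scale_leq // mulr_sumr.
by apply: eq_bigr => i _; rewrite coefZ exprMn.
Qed.

Lemma sqnorm_parallelogram p x :
  sqnorm (p - x) + sqnorm (p + x) = 2 * sqnorm p + 2 * sqnorm x.
Proof.
pose n := maxn (size p) (size x).
have hx : (size (- x) <= size x)%N by rewrite size_polyN.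
rewrite !(@sqnormE n) ?leq_maxl ?leq_maxr //; last 2 first.
- exact: size_polyD.
- by apply: leq_trans (size_polyD _ _) _; rewrite size_polyN.
rewrite !mulr_sumr -!big_split /=; apply: eq_bigr => i _.
by rewrite coefB coefD; ring.
Qed.

(** A triangle inequality for squares, read off from the parallelogram identity. *)
Lemma sqnormB_le x y z : sqnorm (y - z) <= 2 * sqnorm (y - x) + 2 * sqnorm (z - x).
Proof.
have := sqnorm_parallelogram (y - x) (z - x).
rewrite opprB addrA subrK => <-; rewrite lerDl.
by apply: sumr_ge0 => i _; exact: sqr_ge0.
Qed.

Lemma rVpoly_continuous n : continuous (@rVpoly R n : 'rV[R]_n -> Rinf R).
Proof. by apply/continuousP => U oU; exact: oU. Qed.

Lemma Rinf_continuousP (Y : topologicalType) (f : Rinf R -> Y) :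
  (forall n, continuous (fun v : 'rV[R]_n => f (rVpoly v))) -> continuous f.
Proof.
move=> cf; apply/continuousP => U oU; change (Rinf_open (f @^-1` U)) => n.
by have /continuousP := cf n; exact.
Qed.

Lemma Rinf_opp_continuous : continuous (-%R : Rinf R -> Rinf R).
Proof.
apply: Rinf_continuousP => n.
rewrite (_ : (fun _ => _) = (@rVpoly R n : 'rV[R]_n -> Rinf R) \o -%R).
  move=> v; apply: continuous_comp; first exact: opp_continuous.
  exact: rVpoly_continuous.
by apply/funext => v /=; rewrite linearN.
Qed.

Lemma sqnormB_continuous x : continuous (fun y : Rinf R => sqnorm (y - x)).
Proof.
apply: Rinf_continuousP => n v; pose N := maxn n (size x).
rewrite (_ : (fun _ => _) = fun v : 'rV[R]_n =>
    \sum_(i < N) ((if insub (i : nat) is Some j then v 0 j else 0) - x`_i) ^+ 2); last first.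
  apply/funext => u; rewrite (@sqnormE N); last first.
    apply: leq_trans (size_polyD _ _) _; rewrite size_polyN geq_max leq_maxr andbT.
    by apply: leq_trans (leq_maxl _ _); rewrite size_poly.
  by apply: eq_bigr => i _; rewrite coefB coef_rVpoly.
apply: cvg_sum_ord => i; apply: (@continuous_comp _ _ _ _ (fun a : R => a ^+ 2)); last first.
  exact: exprn_continuous.
apply: continuousB; last exact: cst_continuous.
case: insubP => [j _ _|_]; last exact: cst_continuous.
exact: coord_continuous.
Qed.

Lemma Sinf_sqnorm (x : Sinf R) : sqnorm (val x) = 1.
Proof. exact: (set_valP x). Qed.

Lemma Sinf_symmetric : symmetric_set (Sinf R).
Proof. by move=> p; rewrite /Sinf /= -!/(sqnorm _) sqnormN. Qed.

Lemma Sinf_neq0 (x : Sinf R) : (val x : {poly R}) != 0.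
Proof. by apply: sqnorm_neq0; rewrite Sinf_sqnorm. Qed.

Lemma oppr_neq (V : lmodType R) (u : V) : u != 0 -> u != - u.
Proof.
move=> u0; apply: contra u0 => /eqP e.
have /eqP : u + u = 0 by rewrite {2}e subrr.
by rewrite -mulr2n -scaler_nat scaler_eq0 pnatr_eq0.
Qed.

(** For unit vectors a squared distance below 2 means a positive inner product: the cochain compares
    the directions of the chosen representatives of two lines. *)
Definition Sinf_cochain : cochain (RPinf R) 1 := fun v =>
  if sqnorm (val (repr (v ord0)) - val (repr (v (lift ord0 ord0)))) < 2 then 0 else 1.

Definition Sinf_sheet (x : Sinf R) : 'F_2 :=
  if x == repr (proj_antipodal x) then 0 else 1.

Lemma Sinf_repr (x : Sinf R) :
  val (repr (proj_antipodal x)) = val x \/ val (repr (proj_antipodal x)) = - val x.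
Proof.
have : proj_antipodal (repr (proj_antipodal x)) = proj_antipodal x.
  by rewrite {1}/proj_antipodal reprK.
by move/proj_antipodalE.
Qed.

Lemma Sinf_sheetE (x : Sinf R) :
  Sinf_sheet x = if val x == val (repr (proj_antipodal x)) then 0 else 1.
Proof. by rewrite /Sinf_sheet -(inj_eq val_inj). Qed.

Lemma characteristic_Sinf : characteristic Sinf_cochain Sinf_sheet.
Proof.
split=> [x y e|x].
  have exy : proj_antipodal x = proj_antipodal y.
    by apply/proj_antipodalE; right; rewrite e opprK.
  have := Sinf_repr x; rewrite !Sinf_sheetE -exy e.
  case=> ->; rewrite ?eqxx.
    have /negbTE := oppr_neq (Sinf_neq0 x); rewrite eq_sym => ->.
    by rewrite add0r.
  by have /negbTE -> := oppr_neq (Sinf_neq0 x); rewrite F2_addxx.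
(* Radius 1/4 gives |y - z|^2 < 1, hence |y + z|^2 > 3 by the parallelogram identity; the threshold
   2 therefore decides whether the representatives of y and z have equal signs. *)
exists [set y : Sinf R | sqnorm (val y - val x) < 1 / 4].
  have c : continuous (fun y : Sinf R => sqnorm (val y - val x)).
    move=> y; apply: (@continuous_comp _ _ _ (val : Sinf R -> Rinf R) (fun q => sqnorm (q - val x))).
      exact: initial_continuous.
    exact: sqnormB_continuous.
  apply: (c x [set t | t < 1 / 4]); apply: open_nbhs_nbhs; split; first exact: open_lt.
  by rewrite /= subrr sqnorm0; lra.
move=> y z Uy Uz.
have {}Uy : sqnorm (val y - val x) < 1 / 4 := Uy.
have {}Uz : sqnorm (val z - val x) < 1 / 4 := Uz.
have -> a b : ev2 Sinf_cochain a b =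
  if sqnorm (val (repr a) - val (repr b)) < 2 then 0 else 1 by [].
have := sqnormB_le (val x) (val y) (val z).
have := sqnorm_parallelogram (val y) (val z); rewrite !Sinf_sqnorm => par tri.
rewrite !Sinf_sheetE.
have /negbTE ny := oppr_neq (Sinf_neq0 y); have /negbTE nz := oppr_neq (Sinf_neq0 z).
case: (Sinf_repr y) => ->; case: (Sinf_repr z) => ->; rewrite ?eqxx ?ny ?nz ?F2_addxx ?add0r ?addr0.
- by rewrite ifT //; lra.
- by rewrite opprK ifF //; apply/negbTE; rewrite -leNgt; lra.
- by rewrite -opprD sqnormN ifF //; apply/negbTE; rewrite -leNgt; lra.
- by rewrite -opprD sqnormN ifT //; lra.
Qed.

End SphereAtInfinity.

Section Lebesgue.
Variables (R : realType) (T : pseudoMetricType R) (K : set T) (Q : set T -> Prop).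

Lemma lebesgue_number : compact K -> (forall A B : set T, A `<=` B -> Q B -> Q A) ->
  (forall x, K x -> exists2 U, nbhs x U & Q U) ->
  exists2 e : R, 0 < e & forall x, K x -> Q (ball x e).
Proof.
move=> cK QS hQ.
have /compact_near_coveringP /(_ R (0^'+)%R (fun e x => Q (ball x e)) _) := cK.
have cov : forall x, K x -> \forall x' \near x & i \near (0^'+)%R, Q (ball x' i).
  move=> x Kx; have [U /nbhs_ballP [e /= e0 eU] QU] := hQ x Kx.
  exists (ball x (e / 2), [set t : R | t < e / 2]) => /=.
    split; first by apply: nbhsx_ballx; rewrite divr_gt0.
    by apply: nbhs_right_lt; rewrite divr_gt0.
  move=> [y t] /= [xy te]; apply: QS QU => z yz; apply: eU.
  by rewrite [e]splitr; apply: ball_triangle xy _; exact: le_ball (ltW te) _ yz.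
move=> /(_ cov) h.
have : \forall e \near (0^'+)%R, 0 < e /\ K `<=` [set x | Q (ball x e)].
  near=> e; split; [by near: e; exact: nbhs_right_gt | by near: e].
by move=> /filter_ex[e [e0 he]]; exists e => // x Kx; exact: he.
Unshelve. all: by end_near.
Qed.

End Lebesgue.

Section Homotopy.
Variables (R : realType) (X Y : topologicalType) (h : X -> R -> Y).
Hypothesis h_path : forall x, continuous (h x).
(** Takes the place of joint continuity of [h]; for the colimit topology it can be checked on each
    R^n separately. *)
Hypothesis h_tube : forall (D : set Y) (a b : R), open D ->
  open [set x | forall t, a <= t <= b -> D (h x t)].
Variable w : cochain Y 1.
Hypothesis cw : as_cocycle w.

Let additive (D : set Y) := forall a b c, D a -> D b -> D c ->
  ev2 w a c = ev2 w a b + ev2 w b c.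

Let additive_refl D a : additive D -> D a -> ev2 w a a = 0.
Proof. by move=> aD Da; have := aD a a a Da Da Da; rewrite F2_addxx. Qed.

(** A cocycle is additive only locally, so the path of [x] is cut into [N] pieces, each inside an
    open set on which [w] is additive. *)
Let sub (N : nat) (U : nat -> set Y) (x : X) := forall i, (i < N)%N ->
  [/\ open (U i), additive (U i) &
      forall t, i%:R / N%:R <= t <= i.+1%:R / N%:R -> U i (h x t)].

Let sub_ex x : exists N U, (0 < N)%N /\ sub N U x.
Proof.
pose Q (S : set R) := exists D, [/\ open D, additive D & forall s, S s -> D (h x s)].
have QS A B : A `<=` B -> Q B -> Q A.
  by move=> AB [D [oD aD hD]]; exists D; split => // s As; exact/hD/AB.
have hQ (t : R) : `[0, 1]%classic t -> exists2 U : set R, nbhs t U & Q U.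
  move=> _; have /lzeroT/(_ (h x t) I) [D0 nD hD] := cw.
  move: nD; rewrite nbhsE => -[D [oD Dt] DD0].
  exists (h x @^-1` D); first by apply: h_path; exact: open_nbhs_nbhs.
  exists D; split=> // a b c Da Db Dc.
  pose v (i : 'I_3) := if i == ord0 then a else if i == lift ord0 ord0 then b else c.
  have := hD v; rewrite delta1 /ev2d /v /= => e.
  have {}e : ev2 w b c + ev2 w a c + ev2 w a b = 0.
    by apply: e => i; apply: DD0; case: ifP => // _; case: ifP.
  have -> : ev2 w a c = ev2 w b c + ev2 w a c + ev2 w a b - (ev2 w a b + ev2 w b c).
    by ring.
  by rewrite e sub0r F2_opp.
have [e e0 he] := lebesgue_number (@segment_compact R 0 1) QS hQ.
pose N := (Num.trunc e^-1).+1; have N0 : 0 < N%:R :> R by rewrite ltr0n.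
have eN : N%:R^-1 < e by rewrite invf_plt ?posrE // truncnS_gt.
have /choice[U hU] : forall i, exists D, (i < N)%N -> [/\ open D, additive D &
      forall t, i%:R / N%:R <= t <= i.+1%:R / N%:R -> D (h x t)].
  move=> i; have [iN|] := boolP (i < N)%N; last by exists setT.
  have [|D [oD aD hD]] := he (i%:R / N%:R).
    rewrite /= in_itv /= divr_ge0 ?ler0n // ler_pdivrMr // mul1r ler_nat.
    exact: ltnW.
  exists D => _; split => // t /andP[t1 t2]; apply: hD.
  rewrite /ball /= ltr_distlC; apply/andP; split; first by lra.
  by apply: le_lt_trans t2 _; rewrite -natr1 mulrDl mul1r; lra.
by exists N, U; split.
Qed.

Let psum (N : nat) (x : X) : 'F_2 :=
  \sum_(0 <= i < N) ev2 w (h x (i%:R / N%:R)) (h x (i.+1%:R / N%:R)).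

Let psum_refine N M U x : (0 < N)%N -> (0 < M)%N -> sub N U x ->
  psum (N * M) x = psum N x.
Proof.
move=> N0 M0 sN; rewrite /psum big_nat_mul big_nat_cond [RHS]big_nat_cond.
apply: eq_bigr => i; rewrite andbT => /andP[_ iN].
have [oU aU hU] := sN i iN.
have M0r : 0 < M%:R :> R by rewrite ltr0n.
have N0r : 0 < N%:R :> R by rewrite ltr0n.
pose p j := h x ((i * M + j)%N%:R / (N * M)%N%:R).
have Up j : (j <= M)%N -> U i (p j).
  move=> jM; apply: hU; rewrite natrD !natrM invfM mulrDl.
  have -> : i%:R * M%:R * (N%:R^-1 / M%:R) = i%:R / N%:R :> R.
    by rewrite mulrACA mulfV ?mulr1 // gt_eqF.
  have N1 : 0 <= N%:R^-1 :> R by rewrite invr_ge0 ler0n.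
  have c0 : 0 <= N%:R^-1 * (j%:R / M%:R) :> R by rewrite mulr_ge0 // divr_ge0.
  have c1 : N%:R^-1 * (j%:R / M%:R) <= N%:R^-1 :> R.
    by rewrite ler_piMr // ler_pdivrMr // mul1r ler_nat.
  rewrite mulrCA -natr1 mulrDl mul1r; apply/andP; split; lra.
have hsum m : (m <= M)%N -> \sum_(i * M <= j < i * M + m)
    ev2 w (h x (j%:R / (N * M)%N%:R)) (h x (j.+1%:R / (N * M)%N%:R)) =
    ev2 w (p 0%N) (p m).
  elim: m => [|m IH] mM.
    by rewrite addn0 big_geq // (additive_refl aU) //; exact: Up.
  rewrite addnS big_nat_recr ?leq_addr //= IH; last exact: ltnW.
  rewrite (aU (p 0%N) (p m) (p m.+1)); [|exact: Up|exact/Up/ltnW|exact: Up].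
  by rewrite /p addnS.
rewrite mulSn addnC hsum // /p; congr (ev2 w (h x _) (h x _)).
  by rewrite addn0 !natrM invfM mulrACA mulfV ?mulr1 // gt_eqF.
by rewrite -[X in (_ + X)%N]mul1n -mulnDl addn1 !natrM invfM mulrACA mulfV ?mulr1 // gt_eqF.
Qed.

(** A prism operator in degree 1: [p x] sums [w] along a fine subdivision of the path of [x]. By
    local additivity the sum does not depend on the subdivision, and neighbouring paths can be
    compared piece by piece. *)
Lemma homotopy_cocycle : exists p : X -> 'F_2, forall x : X, exists2 U : set X, nbhs x U &
  forall y z, U y -> U z ->
    ev2 w (h y 1) (h z 1) + ev2 w (h y 0) (h z 0) = p y + p z.
Proof.
have /choice[N /choice[U hU]] := sub_ex.
exists (fun x => psum (N x) x) => x0.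
have [N0 sN] := hU x0; set n := N x0 in N0 sN *; set V := U x0 in sN.
pose G (y : X) := forall (i : 'I_n) (t : R), i%:R / n%:R <= t <= i.+1%:R / n%:R -> V i (h y t).
exists G.
  have /filter_forall : forall i : 'I_n, nbhs x0 [set y | forall t : R,
      i%:R / n%:R <= t <= i.+1%:R / n%:R -> V i (h y t)].
    move=> i; have [oV _ hV] := sN i (ltn_ord i).
    by apply: open_nbhs_nbhs; split; [exact: h_tube|exact: hV].
  by apply.
move=> y z Gy0 Gz0.
have Gn y' : G y' -> forall i, (i < n)%N -> forall t : R,
    i%:R / n%:R <= t <= i.+1%:R / n%:R -> V i (h y' t).
  by move=> Gy' i iN; exact: (Gy' (Ordinal iN)).
have Gy := Gn y Gy0; have Gz := Gn z Gz0.
have sG y' : G y' -> sub n V y'.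
  by move=> Gy' i iN; have [oV aV _] := sN i iN; split => //; exact: Gn.
(* The subdivision chosen for y' and the one chosen for the centre have a common refinement. *)
have pE y' : G y' -> psum (N y') y' = psum n y'.
  move=> Gy'; have [Ny sNy] := hU y'.
  by rewrite -(psum_refine Ny N0 sNy) -(psum_refine N0 Ny (sG _ Gy')) mulnC.
rewrite !pE // /psum -big_split /=.
have n0 : 0 < n%:R :> R by rewrite ltr0n.
(* A ladder between the two paths: each square contributes the difference of its rungs, and inner
   rungs cancel. *)
have lad m : (m <= n)%N ->
    \sum_(0 <= i < m) (ev2 w (h y (i%:R / n%:R)) (h y (i.+1%:R / n%:R)) +
      ev2 w (h z (i%:R / n%:R)) (h z (i.+1%:R / n%:R))) =
    ev2 w (h y (m%:R / n%:R)) (h z (m%:R / n%:R)) + ev2 w (h y 0) (h z 0).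
  elim: m => [|m IH] mn; first by rewrite big_geq // mul0r F2_addxx.
  rewrite big_nat_recr //= IH; last exact: ltnW.
  have [oV aV _] := sN m mn.
  have le : m%:R / n%:R <= m.+1%:R / n%:R :> R by rewrite ler_pM2r ?invr_gt0 // ler_nat.
  have Vy0 : V m (h y (m%:R / n%:R)) by apply: Gy => //; rewrite lexx le.
  have Vy1 : V m (h y (m.+1%:R / n%:R)) by apply: Gy => //; rewrite lexx le.
  have Vz0 : V m (h z (m%:R / n%:R)) by apply: Gz => //; rewrite lexx le.
  have Vz1 : V m (h z (m.+1%:R / n%:R)) by apply: Gz => //; rewrite lexx le.
  have e1 := aV _ _ _ Vy0 Vz0 Vz1; have e2 := aV _ _ _ Vy0 Vy1 Vz1.
  have {}e2 : ev2 w (h y (m%:R / n%:R)) (h z (m%:R / n%:R)) =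
    ev2 w (h y (m%:R / n%:R)) (h y (m.+1%:R / n%:R)) +
    ev2 w (h y (m.+1%:R / n%:R)) (h z (m.+1%:R / n%:R)) +
    ev2 w (h z (m%:R / n%:R)) (h z (m.+1%:R / n%:R)).
    by rewrite -e2 e1 -addrA F2_addxx addr0.
  rewrite e2; set a := ev2 w _ _; set b := ev2 w _ _; set c := ev2 w _ _.
  set d := ev2 w _ _; by apply: (F2_eqD (t := a + c)); ring.
by have := lad n (leqnn n); rewrite mulfV ?gt_eqF // => ->.
Qed.

End Homotopy.

Section ProjectiveSpace.
Variable R : realType.
Implicit Types p : {poly R}.

Lemma locally_constant_segment (b : R -> 'F_2) :
  (forall t, exists2 U : set R, nbhs t U & forall s, U s -> b s = b t) -> b 0 = b 1.
Proof.
move=> lc; pose f t : R := if b t == 0 then 0 else 1.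
have cf : continuous f.
  move=> t A /nbhs_singleton At; have [U nU hU] := lc t.
  by apply: filterS nU => s Us; rewrite /= /f hU.
have [e|ne] := eqVneq (f 0) (f 1).
  move: e; rewrite /f; case: (F2_cases (b 0)) => ->; case: (F2_cases (b 1)) => -> //=.
  - by move=> /esym/eqP; rewrite oner_eq0.
  - by move=> /eqP; rewrite oner_eq0.
have [||c _] := @IVT R f 0 1 (1 / 2) _ (continuous_subspaceT cf).
- by [].
- by move: ne; rewrite /f; case: ifP; case: ifP; rewrite ?eqxx // => _ _ _; rewrite ?minEle ?maxEle ?lexx ?ler01 ?ler10; lra.
- by rewrite /f; case: ifP => _ h; exfalso; lra.
Qed.

Lemma tube_open (T Y : topologicalType) (h : T * R -> Y) (D : set Y) (a b : R) :
  continuous h -> open D -> open [set x | forall t, a <= t <= b -> D (h (x, t))].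
Proof.
move=> ch oD; rewrite openE => x0 hx0.
have /compact_near_coveringP /(_ T (nbhs x0) (fun x t => D (h (x, t))) _) :=
  @segment_compact R a b.
have cov (t : R) : `[a, b]%classic t ->
    \forall t' \near t & x \near nbhs x0, D (h (x, t')).
  rewrite /= in_itv /= => tab.
  have : nbhs (x0, t) (h @^-1` D) by apply: ch; apply: open_nbhs_nbhs; split => //; exact: hx0.
  case=> -[A B] /= [nA nB] AB; exists (B, A) => //= -[t' x] /= [Bt Ax].
  exact: (AB (x, t')).
move=> /(_ cov); rewrite /interior; apply: filterS => x hx t tab.
by apply: (hx t); rewrite /= in_itv.
Qed.

Lemma continuous_fst_comp (T T' Y : topologicalType) (f : T -> Y) :
  continuous f -> continuous (fun z : T * T' => f z.1).
Proof.
move=> cf [x y] A nA; exists (f @^-1` A, setT) => /=.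
  by split; [exact: cf|exact: filterT].
by move=> [u v] [].
Qed.

Lemma matrix_continuous (T : topologicalType) m n (f : T -> 'M[R]_(m, n)) (t : T) :
  (forall i j, {for t, continuous (fun u => f u i j)}) -> {for t, continuous f}.
Proof.
move=> cf A [P nP PA].
have /filter_forall : forall i, nbhs t [set u | forall j, P i j (f u i j)].
  move=> i; apply: filter_forall => j; exact: (cf i j _ (nP i j)).
by apply: filterS => u hu; apply: PA.
Qed.

Lemma Rinf_valued_continuous (T : topologicalType) (f : T -> Rinf R) m :
  (forall t, (size (f t : {poly R}) <= m)%N) ->
  (forall i, continuous (fun t => (f t : {poly R})`_i : R)) -> continuous f.
Proof.
move=> sf cf.
rewrite (_ : f = (@rVpoly R m : _ -> Rinf R) \o (fun t => poly_rV (f t) : 'rV[R]_m)).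
  move=> t; apply: continuous_comp; last exact: rVpoly_continuous.
  apply: matrix_continuous => i j.
  rewrite (_ : (fun _ => _) = (fun u => (f u : {poly R})`_j)); first exact: cf.
  by apply/funext => u; rewrite mxE.
by apply/funext => t /=; rewrite poly_rV_K.
Qed.

Lemma Sinf_one : (1 : {poly R}) \in Sinf R.
Proof. by rewrite inE /Sinf /= size_poly1 big_ord1 coef1 expr1n. Qed.

Definition Sinf_pt : Sinf R := exist _ (1 : Rinf R) Sinf_one.

(** At p = 0 the value is the default point [Sinf_pt]; only nonzero p matter. *)
Definition normalize p : Sinf R := insubd Sinf_pt ((Num.sqrt (sqnorm p))^-1 *: p : Rinf R).

Lemma val_normalize p : p != 0 -> val (normalize p) = (Num.sqrt (sqnorm p))^-1 *: p :> Rinf R.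
Proof.
move=> p0; apply: insubdK; rewrite inE /Sinf /= -/(sqnorm _) sqnormZ exprVn.
by rewrite sqr_sqrtr ?ltW ?sqnorm_gt0 // mulVf // gt_eqF // sqnorm_gt0.
Qed.

Lemma normalize_id (x : Sinf R) : normalize (val x) = x.
Proof.
apply/val_inj; rewrite val_normalize ?Sinf_neq0 // Sinf_sqnorm sqrtr1 invr1.
by rewrite scale1r.
Qed.

Lemma Sinf_openP (D : set (Sinf R)) : open D ->
  exists2 D' : set (Rinf R), Rinf_open D' & D = val @^-1` D'.
Proof. by move=> [D' oD' <-]; exists D'. Qed.

Lemma normalize_open (D : set (Sinf R)) : open D ->
  Rinf_open [set p : Rinf R | (p : {poly R}) != 0 /\ D (normalize p)].
Proof.
move=> /Sinf_openP [D' oD' ->] n; rewrite openE => v [v0 Dv].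
pose f (u : 'rV[R]_n) := (Num.sqrt (sqnorm (rVpoly u)))^-1 *: u.
have csq : continuous (fun u : 'rV[R]_n => sqnorm (rVpoly u)).
  rewrite (_ : (fun _ => _) = (fun y : Rinf R => sqnorm (y - 0)) \o (@rVpoly R n : _ -> Rinf R)).
    move=> u; apply: continuous_comp; first exact: rVpoly_continuous.
    exact: sqnormB_continuous.
  by apply/funext => u /=; rewrite subr0.
have sv : 0 < sqnorm (rVpoly v) by exact: sqnorm_gt0.
have cf : {for v, continuous f}.
  apply: matrix_continuous => i j.
  rewrite (_ : (fun _ => _) =
    (fun u : 'rV[R]_n => (Num.sqrt (sqnorm (rVpoly u)))^-1) \* (fun u => u i j)); last first.
    by apply/funext => u; rewrite /f mxE.
  apply: continuousM; last exact: coord_continuous.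
  apply: continuousV; first by rewrite gt_eqF // sqrtr_gt0.
  by apply: continuous_comp; [exact: csq|exact: sqrt_continuous].
have n1 : nbhs v [set u | 0 < sqnorm (rVpoly u)].
  by apply: (csq v [set t | 0 < t]); apply: open_nbhs_nbhs; split => //; exact: open_gt.
have n2 : nbhs v [set u | D' (rVpoly (f u))].
  apply: (cf [set u | D' (rVpoly u)]); apply: open_nbhs_nbhs; split; first exact: oD'.
  by move: Dv; rewrite /= /f linearZ /= -val_normalize.
apply: filterS (filterI n1 n2) => u [u1 u2].
have u0 : rVpoly u != 0 by exact: sqnorm_neq0.
by split => //=; rewrite val_normalize //; move: u2; rewrite /= /f linearZ.
Qed.

Definition path (L1 L2 : {poly R} -> {poly R}) (x : Sinf R) (t : R) : Sinf R :=
  normalize ((1 - t) *: L1 (val x) + t *: L2 (val x)).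

Section Path.
Variables L1 L2 : {poly R} -> {poly R}.
Hypothesis L_neq0 : forall p t, p != 0 -> (1 - t) *: L1 p + t *: L2 p != 0.
Hypothesis L_size : forall n, exists m, forall p, (size p <= n)%N ->
  (size (L1 p) <= m)%N /\ (size (L2 p) <= m)%N.
Hypothesis L_cont : forall n i,
  continuous (fun v : 'rV[R]_n => (L1 (rVpoly v))`_i) /\
  continuous (fun v : 'rV[R]_n => (L2 (rVpoly v))`_i).

Lemma path_tube (D : set (Sinf R)) (a b : R) : open D ->
  open [set x | forall t, a <= t <= b -> D (path L1 L2 x t)].
Proof.
move=> oD; pose D' := [set p : Rinf R | (p : {poly R}) != 0 /\ D (normalize p)].
have oD' : open D' by exact: normalize_open.
pose g (p : {poly R}) t : Rinf R := (1 - t) *: L1 p + t *: L2 p.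
exists [set p : Rinf R | forall t, a <= t <= b -> D' (g p t)].
  change (Rinf_open [set p : Rinf R | forall t, a <= t <= b -> D' (g p t)]) => n.
  apply: (@tube_open _ _ (fun z : 'rV[R]_n * R => g (rVpoly z.1) z.2)) => //.
  have [m hm] := L_size n.
  apply: (@Rinf_valued_continuous _ _ m) => [z|i].
    have [h1 h2] := hm (rVpoly z.1) (size_poly _ _).
    apply: leq_trans (size_polyD _ _) _; rewrite geq_max.
    by rewrite !(leq_trans (size_scale_leq _ _)).
  have [c1 c2] := L_cont n i.
  rewrite (_ : (fun _ => _) = fun z : 'rV[R]_n * R =>
    (1 - z.2) * (L1 (rVpoly z.1))`_i + z.2 * (L2 (rVpoly z.1))`_i); last first.
    by apply/funext => z; rewrite /g coefD !coefZ.
  move=> z.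
  have d1 : {for z, continuous (fun z : 'rV[R]_n * R => (L1 (rVpoly z.1))`_i)}.
    exact: (continuous_fst_comp c1).
  have d2 : {for z, continuous (fun z : 'rV[R]_n * R => (L2 (rVpoly z.1))`_i)}.
    exact: (continuous_fst_comp c2).
  apply: cvgD; apply: cvgM; [|exact: d1|exact: cvg_snd|exact: d2].
  by apply: cvgB; [exact: cvg_cst|exact: cvg_snd].
apply/seteqP; split=> x /= hx t tab; first by have [] := hx t tab.
by split; [exact/L_neq0/Sinf_neq0|exact: hx].
Qed.

Lemma path_continuous (x : Sinf R) : continuous (path L1 L2 x).
Proof.
apply/continuousP => D oD; rewrite openE => t Dt.
pose g t : Rinf R := (1 - t) *: L1 (val x) + t *: L2 (val x).
have [m hm] := L_size (size (val x : {poly R})).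
have [h1 h2] := hm (val x) (leqnn _).
have cg : continuous g.
  apply: (@Rinf_valued_continuous _ _ m) => [u|i].
    apply: leq_trans (size_polyD _ _) _; rewrite geq_max.
    by rewrite !(leq_trans (size_scale_leq _ _)).
  rewrite (_ : (fun _ => _) = fun u : R => (1 - u) * (L1 (val x))`_i + u * (L2 (val x))`_i); last first.
    by apply/funext => u; rewrite /g coefD !coefZ.
  move=> u; apply: cvgD; apply: cvgMl; last exact: cvg_id.
  by apply: cvgB; [exact: cvg_cst|exact: cvg_id].
have : nbhs t (g @^-1` [set p : Rinf R | (p : {poly R}) != 0 /\ D (normalize p)]).
  apply: cg; apply: open_nbhs_nbhs; split; first exact: (normalize_open oD).
  by split; [exact/L_neq0/Sinf_neq0|exact: Dt].
by apply: filterS => u [].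
Qed.

End Path.

Let shift p : {poly R} := 'X * p.

Lemma coef_rVpoly_continuous n i : continuous (fun v : 'rV[R]_n => (rVpoly v)`_i).
Proof.
under eq_fun do rewrite coef_rVpoly.
by case: insubP => [j _ _|_]; [exact: coord_continuous|exact: cst_continuous].
Qed.

Lemma coef_shift_continuous n i : continuous (fun v : 'rV[R]_n => (shift (rVpoly v))`_i).
Proof.
rewrite /shift; under eq_fun do rewrite coefXM.
by case: i => [|i] /=; [exact: cst_continuous|exact: coef_rVpoly_continuous].
Qed.

Lemma size_shift n p : (size p <= n)%N -> (size (shift p) <= n.+1)%N.
Proof.
move=> pn; rewrite /shift mulrC.
by apply: leq_trans (size_polyMleq _ _) _; rewrite size_polyX addn2.
Qed.

(** The combination is (1 - t + t X) p, a product of nonzero elements of the domain of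
    polynomials. *)
Let path1_neq0 p t : p != 0 -> (1 - t) *: p + t *: shift p != 0.
Proof.
move=> p0; rewrite /shift -!mul_polyC mulrA -mulrDl mulf_neq0 //.
apply/eqP => /polyP e; have := e 0%N; have := e 1%N.
rewrite !coefD !coefC !coefCM !coefX /= mulr1 add0r => -> /eqP.
by rewrite mulr0 addr0 subr0 oner_eq0.
Qed.

(** X p has constant coefficient 0, so that of the combination is t; at t = 0 only X p is left. *)
Let path2_neq0 p t : p != 0 -> (1 - t) *: shift p + t *: 1 != 0.
Proof.
move=> p0; have [->|t0] := eqVneq t 0.
  by rewrite scale0r addr0 subr0 scale1r mulf_neq0 // polyX_eq0.
apply/eqP => /polyP/(_ 0%N)/eqP.
by rewrite coefD !coefZ coefXM coef1 coef0 /= mulr0 add0r mulr1 (negbTE t0).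
Qed.

Let path1_size n : exists m, forall p, (size p <= n)%N ->
  (size p <= m)%N /\ (size (shift p) <= m)%N.
Proof.
exists n.+1 => p pn; split; first exact: leqW.
exact: size_shift.
Qed.

Let path2_size n : exists m, forall p, (size p <= n)%N ->
  (size (shift p) <= m)%N /\ (size (1%R : {poly R}) <= m)%N.
Proof. by exists n.+1 => p pn; rewrite size_poly1; split => //; exact: size_shift. Qed.

Let path1_cont n i : continuous (fun v : 'rV[R]_n => (rVpoly v)`_i) /\
  continuous (fun v : 'rV[R]_n => (shift (rVpoly v))`_i).
Proof. by split; [exact: coef_rVpoly_continuous|exact: coef_shift_continuous]. Qed.

Let path2_cont n i : continuous (fun v : 'rV[R]_n => (shift (rVpoly v))`_i) /\
  continuous (fun v : 'rV[R]_n => (1 : {poly R})`_i).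
Proof. by split; [exact: coef_shift_continuous|exact: cst_continuous]. Qed.

Let path1 := path (fun p => p) shift.
Let path2 := path shift (fun=> 1).

Let path10 x : path1 x 0 = x.
Proof. by rewrite /path1 /path subr0 scale1r scale0r addr0 normalize_id. Qed.

Let path12 x : path2 x 0 = path1 x 1.
Proof. by rewrite /path1 /path2 /path !subrr !scale0r !subr0 !scale1r add0r addr0. Qed.

Let path21 x : path2 x 1 = Sinf_pt.
Proof. by rewrite /path2 /path subrr scale0r scale1r add0r (normalize_id Sinf_pt). Qed.

Lemma Sinf_locally_constant (b : Sinf R -> 'F_2) :
  (forall x : Sinf R, exists2 U : set (Sinf R), nbhs x U & forall y, U y -> b y = b x) ->
  forall x, b x = b Sinf_pt.
Proof.
move=> lc x.
have lcp (g : R -> Sinf R) : continuous g -> b (g 0) = b (g 1).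
  move=> cg; apply: (locally_constant_segment (b := b \o g)) => t.
  by have [U nU hU] := lc (g t); exists (g @^-1` U) => [|s Us]; [exact: cg|exact: hU].
rewrite -{1}(path10 x) (lcp (path1 x)); last exact: path_continuous.
by rewrite -path12 (lcp (path2 x)) ?path21 //; exact: path_continuous.
Qed.

(* The sphere contracts along [p -> X p -> 1]. *)
Lemma Sinf_cocycle_exact (w : cochain (Sinf R) 1) : as_cocycle w ->
  exists p : Sinf R -> 'F_2, forall x : Sinf R, exists2 U : set (Sinf R), nbhs x U &
    forall y z, U y -> U z -> ev2 w y z = p y + p z.
Proof.
move=> cw.
have [p1 h1] := homotopy_cocycle (path_continuous path1_neq0 path1_size)
  (path_tube path1_neq0 path1_size path1_cont) cw.
have [p2 h2] := homotopy_cocycle (path_continuous path2_neq0 path2_size)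
  (path_tube path2_neq0 path2_size path2_cont) cw.
have w1 : ev2 w Sinf_pt Sinf_pt = 0.
  have [U nU hU] := cw Sinf_pt.
  have := hU (fun=> Sinf_pt) (fun=> nbhs_singleton nU).
  by rewrite delta1 /ev2d F2_addxx add0r.
exists (fun x => p1 x + p2 x) => x.
have [U1 n1 hU1] := h1 x; have [U2 n2 hU2] := h2 x.
exists (U1 `&` U2); first exact: filterI.
move=> y z [y1 y2] [z1 z2]; have := hU1 y z y1 z1; have := hU2 y z y2 z2.
rewrite -/path1 -/path2 !path10 !path12 !path21 w1 add0r => e2.
rewrite {}e2 => e1; have -> : ev2 w y z = (p2 y + p2 z + ev2 w y z) + (p2 y + p2 z).
  by rewrite addrAC F2_addxx add0r.
by rewrite e1; ring.
Qed.

(** On the contractible sphere the pullback of a cocycle v has a primitive p. Locally p(-x) + p(x)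
    is constant, hence it is a constant a by connectedness; p + a times the sheet function is then
    even and descends to a primitive of v - a w. *)
Lemma generates_H1_Sinf : generates_H1 (@Sinf_cochain R).
Proof.
have char := @characteristic_Sinf R; have [hc hw] := char.
split; first exact: (characteristic_cocycle (@Rinf_opp_continuous R) (@Sinf_symmetric R) char).
move=> v cv; pose pr := @proj_antipodal R (Rinf R) (Sinf R).
have cpr : continuous pr by exact: proj_antipodal_continuous.
have [p hp] := Sinf_cocycle_exact (as_cocycle_pullback cpr cv).
pose nx (x : Sinf R) : Sinf R := neg_on (@Sinf_symmetric R) x.
have prN x : pr (nx x) = pr x by apply/proj_antipodalE; right.
have cn : continuous nx by exact: (neg_on_continuous (@Rinf_opp_continuous R)).
pose b x := p (nx x) + p x.
have lc x : exists2 U : set (Sinf R), nbhs x U & forall y, U y -> b y = b x.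
  have [U1 n1 hU1] := hp x; have [U2 n2 hU2] := hp (nx x).
  exists (U1 `&` nx @^-1` U2); first by apply: filterI => //; exact: cn.
  move=> y [y1 y2]; have := hU1 y x y1 (nbhs_singleton n1).
  have := hU2 (nx y) (nx x) y2 (nbhs_singleton n2).
  have -> : ev2 (pullback pr v) (nx y) (nx x) = ev2 (pullback pr v) y x.
    rewrite /ev2 /pullback; congr v; apply/funext => i /=.
    by case: ifP => _; rewrite prN.
  move=> -> e; rewrite /b; have -> : p (nx y) = (p (nx y) + p (nx x)) + p (nx x).
    by rewrite -addrA F2_addxx addr0.
  rewrite e; apply: (F2_eqD (t := p y)); ring.
pose a := b Sinf_pt; exists a.
have bE x : b x = a by exact: Sinf_locally_constant.
pose k x := p x + a * Sinf_sheet x.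
have kE x y : pr x = pr y -> k x = k y.
  move=> /proj_antipodalE [/val_inj -> //|e]; have -> : x = nx y by exact/val_inj.
  rewrite /k (hc y); last by [].
  have -> : p (nx y) = b y + p y by rewrite /b -addrA F2_addxx addr0.
  by rewrite bE; apply: (F2_eqD (t := a)); ring.
exists (fun v => k (repr (v ord0))).
apply/lzeroT/(lzeroT_proj_antipodal (@Rinf_opp_continuous R) (@Sinf_symmetric R)) => x.
have [U1 n1 hU1] := hp x; have [U2 n2 hU2] := hw x.
exists (U1 `&` U2); first exact: filterI.
move=> u Uu; rewrite delta0 /= !ev2E /=.
have kr y : k (repr (pr y)) = k y by apply: kE; rewrite {1}/pr /proj_antipodal reprK.
have [u01 u02] := Uu ord0; have [u11 u12] := Uu (lift ord0 ord0).
rewrite hU2 // !kr.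
have <- : ev2 (pullback pr v) (u ord0) (u (lift ord0 ord0)) =
  ev2 v (pr (u ord0)) (pr (u (lift ord0 ord0))).
  by rewrite /ev2 /pullback; congr v; apply/funext => i /=; case: ifP.
rewrite hU1 // /k -[X in _ - X]F2_opp opprK.
set c := p _; set d := p _; set e := Sinf_sheet _; set f := Sinf_sheet _.
by apply: (F2_eqD (t := c + d)); ring.
Qed.

End ProjectiveSpace.

(** * The cohomological index *)

(** A group generated by one element over the field with two elements has at most one nonzero class;
    the last case below is that both generators are exact. *)
Lemma generates_H1_uniq (X : topologicalType) (w w' : cochain X 1) :
  generates_H1 w -> generates_H1 w' -> as_coboundary (fun v => w v - w' v).
Proof.
move=> [cw gw] [cw' gw']; have [a ha] := gw w' cw'; have [b hb] := gw' w cw.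
have opp (u u' : cochain X 1) : as_coboundary (fun v => u v - u' v) ->
    as_coboundary (fun v => u' v - u v).
  congr as_coboundary; apply/funext => v; rewrite -[LHS]F2_opp; ring.
case: (F2_cases b) hb => -> hb; last first.
  by move: hb; congr as_coboundary; apply/funext => v; rewrite mul1r.
case: (F2_cases a) ha => -> ha; last first.
  by apply: opp; move: ha; congr as_coboundary; apply/funext => v; rewrite mul1r.
have := as_coboundaryD hb ha; congr as_coboundary; apply/funext => v.
by rewrite !mul0r !subr0 F2_opp.
Qed.

Section Index.
Variable R : realType.

Section Basics.
Variable V : preTopologicalLmodType R.

Definition classifiable (M : set V) :=
  exists f : M -> Sinf R, continuous f /\ odd_map f.

(** The index in terms of characteristic cochains. Classifiability is carried along because, for a
    nonempty set without odd map into the infinite sphere, [fr_index] would be a supremum over the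
    empty set. *)
Definition index_ge (k : nat) (M : set V) := classifiable M /\
  forall w c, @characteristic R V M w c -> ~ as_coboundary (cup_pow w k.-1).

Hypothesis opp_cont : continuous (-%R : V -> V).

Lemma classifiable_characteristic (M : set V) : classifiable M ->
  exists w c, @characteristic R V M w c.
Proof.
move=> [f [cf of_]]; exists (pullback (quotient_map f) (@Sinf_cochain R)).
exists (@Sinf_sheet R \o f); apply: characteristic_pullback => //.
- by move=> x; exact: quotient_mapE.
- exact: characteristic_Sinf.
Qed.

Lemma characteristic_pow_coboundary (M : set V) w w' c c' k : symmetric_set M ->
  @characteristic R V M w c -> @characteristic R V M w' c' ->
  as_coboundary (cup_pow w k) -> as_coboundary (cup_pow w' k).
Proof.
move=> sM h h'; have cw := characteristic_cocycle opp_cont sM h.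
have cw' := characteristic_cocycle opp_cont sM h'.
have := cup_pow_cohomologous k cw' cw (characteristic_uniq opp_cont sM h' h).
move=> hk /(as_coboundaryD hk); congr as_coboundary; apply/funext => v.
by rewrite subrK.
Qed.

Lemma index_ge_neq0 k (M : set V) : index_ge k M -> M != set0.
Proof.
move=> [/classifiable_characteristic[w [c hc]] h]; apply/eqP => M0.
apply: (h w c hc); apply: as_coboundary_lzero => z.
have [x _] := proj_antipodal_surj z; exfalso; have : M (val x) by exact: set_valP.
by rewrite {1}M0.
Qed.

Lemma fr_index_geP (M : set V) k : symmetric_set M -> (1 <= k)%N ->
  (k%:R%:E <= fr_index M)%E <-> index_ge k M.
Proof.
move=> sM k1; split=> [|hk].
  rewrite /fr_index; case: asboolP => [_|M0]; first by rewrite lee_fin lern0 -leqn0 leqNgt k1.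
  (* The supremum runs over natural numbers: were they all below k, then k - 1 would be an upper
     bound. *)
  move=> hs; have [m [km [m1 [t [w [[ct [f [cf of_ tf]]] gw hw]]]]]] :
    exists m, (k <= m)%N /\ ((1 <= m)%N /\
      exists (theta : mod_antipodal M -> RPinf R) (w : cochain (RPinf R) 1),
      [/\ classifying theta, generates_H1 w &
          ~ as_coboundary (pullback theta (cup_pow w m.-1))]).
    apply: contrapT => hn; suff : (k%:R%:E <= k.-1%:R%:E :> \bar R)%E.
      by rewrite lee_fin ler_nat leqNgt prednK ?leqnn.
    apply: le_trans hs _; apply: ge_ereal_sup => _ [m hm <-].
    rewrite lee_fin ler_nat -ltnS prednK // ltnNge; apply/negP => km.
    by apply: hn; exists m.
  split; first by exists f; split.
  move=> u c hu cu; apply: hw.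
  have h0 : characteristic (pullback t (@Sinf_cochain R)) (@Sinf_sheet R \o f).
    by apply: characteristic_pullback => //; exact: characteristic_Sinf.
  have := characteristic_pow_coboundary sM hu h0 cu.
  have km' : (k.-1 <= m.-1)%N by rewrite -!subn1 leq_sub2r.
  move=> /(as_coboundary_pow_leq (characteristic_cocycle opp_cont sM h0) km').
  rewrite cup_pow_pullback => h1.
  have hS := @generates_H1_Sinf R.
  have := cup_pow_cohomologous m.-1 gw.1 hS.1 (generates_H1_uniq gw hS).
  move=> /(as_coboundary_pullback ct) /as_coboundaryD /(_ h1).
  by congr as_coboundary; apply/funext => v; rewrite /pullback subrK.
have M0 := index_ge_neq0 hk; case: hk => -[f [cf of_]] h.
rewrite /fr_index; case: asboolP => [/eqP|_]; first by rewrite (negbTE M0).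
apply: ereal_sup_ubound; exists k => //; split => //.
exists (quotient_map f), (@Sinf_cochain R); split.
- split; first exact: quotient_map_continuous.
  by exists f; split => //; exact: quotient_mapE.
- exact: generates_H1_Sinf.
- rewrite -cup_pow_pullback; apply: (h _ (@Sinf_sheet R \o f)).
  apply: characteristic_pullback => //; last exact: characteristic_Sinf.
  by move=> x; exact: quotient_mapE.
Qed.

Lemma index_ge_leq k l (M : set V) : symmetric_set M -> (k <= l)%N ->
  index_ge l M -> index_ge k M.
Proof.
move=> sM kl [cM h]; split => // w c hw hk; apply: (h w c hw).
apply: as_coboundary_pow_leq hk; first exact: (characteristic_cocycle opp_cont sM hw).
by rewrite -!subn1 leq_sub2r.
Qed.

End Basics.

(** The characteristic class is natural under odd maps, so a power that is exact on the target is
    exact on the source. *)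
Lemma index_ge_map (V V' : preTopologicalLmodType R) (M : set V) (M' : set V')
    (h : V -> V') k :
  continuous (-%R : V -> V) -> symmetric_set M ->
  {within M, continuous h} -> (forall x, M x -> M' (h x)) ->
  (forall x, M x -> h (- x) = - h x) -> classifiable M' ->
  index_ge k M -> index_ge k M'.
Proof.
move=> oc sM ch hM hodd cM' [cM hk]; split => // w c hw cw.
pose j (x : M) : M' := exist _ (h (val x)) (mem_set (hM _ (set_valP x))).
have cj : continuous j.
  by apply/continuous_comp_initial; move/subspace_sigL_continuousP: ch.
have oj : odd_map j.
  by move=> x y e; rewrite /= -hodd; [congr h|exact: set_valP].
apply: (hk (pullback (quotient_map j) w) (c \o j)).
  by apply: characteristic_pullback => // x; exact: quotient_mapE.
rewrite cup_pow_pullback; apply: as_coboundary_pullback => //.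
exact: quotient_map_continuous.
Qed.

Lemma classifiable_map (V V' : preTopologicalLmodType R) (M : set V) (M' : set V')
    (h : V -> V') :
  {within M, continuous h} -> (forall x, M x -> M' (h x)) ->
  (forall x, M x -> h (- x) = - h x) -> classifiable M' -> classifiable M.
Proof.
move=> ch hM hodd [f [cf of_]].
pose j (x : M) : M' := exist _ (h (val x)) (mem_set (hM _ (set_valP x))).
have cj : continuous j.
  by apply/continuous_comp_initial; move/subspace_sigL_continuousP: ch.
exists (f \o j); split; first by move=> x; apply: continuous_comp; [exact: cj|exact: cf].
by move=> x y e; apply: of_; rewrite /= -hodd; [congr h|exact: set_valP].
Qed.

Section Subadditivity.
Variable V : preTopologicalLmodType R.
Hypothesis opp_cont : continuous (-%R : V -> V).
Variables (M D1 D2 : set V).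
Hypotheses (sM : symmetric_set M) (sD1 : symmetric_set D1) (oD1 : open D1).
Hypotheses (oD2 : open D2) (D12 : M `<=` D1 `|` D2).

Let M1 := M `&` D1.
Let incl (x : M1) : M := exist _ (val x) (mem_set (set_valP x).1).

Let incl_continuous : continuous incl.
Proof. by apply/continuous_comp_initial; exact: initial_continuous. Qed.

Let sM1 : symmetric_set M1.
Proof. by move=> x [Mx Dx]; split; [exact: sM|exact: sD1]. Qed.

Let lift1 (x : M) (Dx : D1 (val x)) : M1 := exist _ (val x) (mem_set (conj (set_valP x) Dx)).

Let nbhs_lift1 (x : M) (Dx : D1 (val x)) (U : set M1) : nbhs (lift1 Dx) U ->
  nbhs x [set y | exists Dy : D1 (val y), U (lift1 Dy)].
Proof.
case=> _ [[E oE <-]] Ex EU.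
have : nbhs (val x) (E `&` D1) by apply: open_nbhs_nbhs; split => //; exact: openI.
move=> nE; have nx : nbhs x (val @^-1` (E `&` D1)) by exact: (@initial_continuous M V val x).
by apply: filterS nx => y [Ey Dy]; exists Dy; exact: EU.
Qed.

Let cob_lift1 w q : as_coboundary (pullback (quotient_map incl) (cup_pow w q)) ->
  cob_on (@proj_antipodal R V M @` [set x | D1 (val x)]) (cup_pow w q).
Proof.
have qi (x : M) (Dx : D1 (val x)) :
    quotient_map incl (proj_antipodal (lift1 Dx)) = proj_antipodal x.
  by rewrite quotient_mapE //; congr proj_antipodal; exact/val_inj.
case: q => [|q] /=.
  move=> h; apply: (lzero_proj_antipodal opp_cont) => // x Dx.
  have [U nU hU] := h (proj_antipodal (lift1 Dx)).
  exists [set: M]; first exact: filterT.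
  by move=> v _; have := hU (fun=> proj_antipodal (lift1 Dx)) (fun=> nbhs_singleton nU).
move=> [p hp].
have inj (y y' : mod_antipodal M1) : quotient_map incl y = quotient_map incl y' -> y = y'.
  have [x <-] := proj_antipodal_surj y; have [x' <-] := proj_antipodal_surj y'.
  by rewrite !quotient_mapE // => /proj_antipodalE h; apply/proj_antipodalE.
(* The primitive on the quotient of [M1], extended by 0 to tuples that do not come from there. Since
   [D1] is open, this stays a primitive near the image of [M1]. *)
pose p' (v : 'I_q.+1 -> mod_antipodal M) : 'F_2 :=
  if pselect (exists u, v = quotient_map incl \o u) is left e then p (projT1 (cid e)) else 0.
have p'E u : p' (quotient_map incl \o u) = p u.
  rewrite /p'; case: pselect => [e|]; last by case; exists u.
  congr p; case: cid => u' /= e'; apply/funext => i; apply: inj.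
  by have := congr1 (fun g => g i) e'.
exists p'; apply: (lzero_proj_antipodal opp_cont) => // x Dx.
have [U nU hU] := hp (proj_antipodal (lift1 Dx)).
have := @proj_antipodal_continuous R V M1 _ _ nU => /nbhs_lift1 nU'.
exists [set y | exists Dy : D1 (val y), U (proj_antipodal (lift1 Dy))] => // v Uv.
have /choice[u hu] : forall i, exists y, U y /\ quotient_map incl y = proj_antipodal (v i).
  by move=> i; have [Dy Uy] := Uv i; exists (proj_antipodal (lift1 Dy)).
have -> : @proj_antipodal R V M \o v = quotient_map incl \o u.
  by apply/funext => i /=; have [] := hu i.
rewrite -[RHS](hU u); last by move=> i; have [] := hu i.
congr (_ - _); rewrite /delta; apply: eq_bigr => i _.
by rewrite -p'E.
Qed.

Variable c : V -> 'F_2.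
Hypothesis c_odd : forall x, M x -> D2 x -> D2 (- x) /\ c (- x) = c x + 1.
Hypothesis c_cst : forall x, M x -> D2 x ->
  exists2 U : set V, nbhs x U & forall y, U y -> c y = c x.

Let cob_sheet w c' : @characteristic R V M w c' ->
  cob_on (@proj_antipodal R V M @` [set x | D2 (val x)]) w.
Proof.
move=> [hc hw]; pose k (x : M) := c' x + c (val x).
have kE x y : D2 (val x) -> proj_antipodal y = proj_antipodal x -> k y = k x.
  move=> Dx /proj_antipodalE [/val_inj -> //|e]; rewrite /k e (hc x y e).
  rewrite (c_odd (set_valP x) Dx).2; apply: (F2_eqD (t := 1)); ring.
exists (fun v => k (repr (v ord0))).
apply: (lzero_proj_antipodal opp_cont) => // x Dx.
have [U1 n1 hU1] := hw x; have [U2 n2 hU2] := c_cst (set_valP x) Dx.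
have n3 : nbhs x [set y | U2 (val y) /\ D2 (val y)].
  apply: (@initial_continuous M V val x (U2 `&` D2)); apply: filterI => //.
  exact: open_nbhs_nbhs.
exists (U1 `&` [set y | U2 (val y) /\ D2 (val y)]); first exact: filterI.
move=> v Uv; rewrite delta0 /= !ev2E /=.
have [u0 [u0' u0'']] := Uv ord0; have [u1 [u1' u1'']] := Uv (lift ord0 ord0).
have kr (y : M) : D2 (val y) -> k (repr (proj_antipodal y)) = k y.
  by move=> Dy; apply: kE => //; rewrite {1}/proj_antipodal reprK.
rewrite hU1 // !kr //.
rewrite /k (hU2 _ u0') (hU2 _ u1'); set a := c' _; set b := c' _; set d := c _.
by apply: (F2_eqD (t := - d)); ring.
Qed.

(** Subadditivity for a piece of index at most 1: on [D2] the function [c] trivialises the cover, so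
    the class is exact there. If its power of degree j - 1 were exact on [D1], the covering argument
    would kill the power of degree j on [M]. *)
Lemma index_ge_split j : (1 <= j)%N -> index_ge j.+1 M -> index_ge j M1.
Proof.
move=> j1 [cM hk]; split.
  have [f [cf of_]] := cM; exists (f \o incl); split.
    by move=> x; apply: continuous_comp; [exact: incl_continuous|exact: cf].
  by move=> x y e; exact: of_.
move=> w1 c1 hw1 cw1; have [w [c' hw]] := classifiable_characteristic cM.
have hw' : characteristic (pullback (quotient_map incl) w) (c' \o incl).
  by apply: characteristic_pullback => // x; exact: quotient_mapE.
have := characteristic_pow_coboundary opp_cont sM1 hw1 hw' cw1.
rewrite cup_pow_pullback => /cob_lift1 h1.
apply: (hk w c' hw); rewrite -[j.+1.-1](prednK j1).
apply: (cup_pow_cover (characteristic_cocycle opp_cont sM hw) h1 (cob_sheet hw)).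
apply/seteqP; split=> // z _; have [x <-] := proj_antipodal_surj z.
by have [Dx|Dx] := D12 (set_valP x); [left|right]; exists x.
Qed.

End Subadditivity.
End Index.

Section Coordinates.
Variable R : realType.

Lemma normalize_continuous (T : topologicalType) (g : T -> Rinf R) :
  continuous g -> (forall t, (g t : {poly R}) != 0) ->
  continuous (fun t => normalize (g t)).
Proof.
move=> cg g0; apply/continuousP => D oD; rewrite openE => t Dt.
have : nbhs t (g @^-1` [set p : Rinf R | (p : {poly R}) != 0 /\ D (normalize p)]).
  by apply: cg; apply: open_nbhs_nbhs; split; [exact: (normalize_open oD)|split].
by apply: filterS => u [].
Qed.

Lemma normalizeN (p : {poly R}) : p != 0 -> val (normalize (- p)) = - val (normalize p).
Proof. by move=> p0; rewrite !val_normalize ?oppr_eq0 // sqnormN scalerN. Qed.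

Variable V : preTopologicalLmodType R.
Hypothesis opp_cont : continuous (-%R : V -> V).
Implicit Types (M : set V) (phi : nat -> V -> R).

Lemma classifiable_coordinates m phi M : (forall i, continuous (phi i)) ->
  (forall i x, phi i (- x) = - phi i x) ->
  (forall x, M x -> exists2 i, (i < m)%N & phi i x != 0) -> classifiable M.
Proof.
move=> cphi ophi hM; pose g (x : M) : Rinf R := \poly_(i < m) phi i (val x).
have g0 x : (g x : {poly R}) != 0.
  have [i im] := hM _ (set_valP x); apply: contra => /eqP gx.
  by have := coef_poly m (fun i => phi i (val x)) i; rewrite im -/(g x) gx coef0 => <-.
have cg : continuous g.
  apply: (@Rinf_valued_continuous _ _ _ m) => [x|i]; first exact: size_poly.
  rewrite (_ : (fun _ => _) = fun x : M => if (i < m)%N then phi i (val x) else 0); last first.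
    by apply/funext => x; rewrite coef_poly.
  case: ltnP => _; last exact: cst_continuous.
  by move=> x; apply: continuous_comp; [exact: initial_continuous|exact: cphi].
exists (fun x => normalize (g x)); split; first exact: normalize_continuous.
move=> x y e; rewrite -normalizeN //; congr (val (normalize _)).
apply/polyP => i; rewrite coefN !coef_poly e.
by case: ifP => _; rewrite ?ophi ?oppr0.
Qed.

(** Each coordinate raises the index by at most 1: where the last one is nonzero, its sign is a
    locally constant sheet function, and elsewhere the others have no common zero. *)
Lemma index_ge_coordinates m phi M : symmetric_set M -> (forall i, continuous (phi i)) ->
  (forall i x, phi i (- x) = - phi i x) ->
  (forall x, M x -> exists2 i, (i < m)%N & phi i x != 0) -> ~ index_ge m.+1 M.
Proof.
move=> + cphi ophi; elim: m M => [|m IH] M sM hM.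
  move=> /index_ge_neq0 /eqP; apply; apply/seteqP; split => // x /hM [i].
  by rewrite ltn0.
pose D1 := \bigcup_(i in [set i | (i < m)%N]) [set x | phi i x != 0].
pose D2 := [set x | phi m x != 0].
have oD i : open [set x | phi i x != 0].
  have /continuousP /(_ [set t | t != 0]) := cphi i.
  by apply; exact: open_neq.
have sD1 : symmetric_set D1.
  by move=> x [i im] /=; exists i; rewrite //= ophi oppr_eq0.
have D12 : M `<=` D1 `|` D2.
  move=> x /hM [i]; rewrite ltnS leq_eqVlt => /orP[/eqP ->|im] p0; first by right.
  by left; exists i.
pose c x : 'F_2 := if 0 < phi m x then 0 else 1.
move=> hidx; have [] : ~ index_ge m.+1 (M `&` D1).
  apply: IH => [x [Mx Dx]|x [_ [i im h]]]; last by exists i.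
  by split; [exact: sM|exact: sD1].
apply: (index_ge_split opp_cont sM sD1 _ (oD m) D12 (c := c)) hidx => //.
- by apply: bigcup_open => i _; exact: oD.
- move=> x _ /= p0; split; first by rewrite /= ophi oppr_eq0.
  rewrite /c ophi oppr_gt0; case: ltgtP p0 => //=; first by rewrite F2_addxx.
  by rewrite add0r.
- move=> x _ /= p0; have [h|h|h] := ltgtP 0 (phi m x); last by rewrite -h eqxx in p0.
    exists (phi m @^-1` [set t | 0 < t]).
      by apply: cphi; apply: open_nbhs_nbhs; split => //; exact: open_gt.
    by move=> y /= py; rewrite /c py h.
  exists (phi m @^-1` [set t | t < 0]).
    by apply: cphi; apply: open_nbhs_nbhs; split => //; exact: open_lt.
  by move=> y /= py; rewrite /c !ltNge (ltW py) (ltW h).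
Qed.

End Coordinates.

(** * Barycentric subdivision and the index of cross polytopes *)

Section Subdivision.
Variables (R : realType) (V : normedModType R).
Local Notation cochain := (@cochain V).

Definition bary n (v : 'I_n.+1 -> V) : V := n.+1%:R^-1 *: \sum_i v i.

Definition cons_tuple n (b : V) (u : 'I_n.+1 -> V) (i : 'I_n.+2) : V :=
  if unlift ord0 i is Some j then u j else b.

(** The transpose of coning a simplex off from the apex [b]; by [delta_cone] it is a contracting
    homotopy in positive degree. *)
Definition cone q (b : V) (phi : cochain q.+1) : cochain q :=
  fun u => phi (cons_tuple b u).

Lemma cons_tuple0 n b (u : 'I_n.+1 -> V) : cons_tuple b u ord0 = b.
Proof. by rewrite /cons_tuple unlift_none. Qed.

Lemma cons_tupleS n b (u : 'I_n.+1 -> V) i : cons_tuple b u (lift ord0 i) = u i.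
Proof. by rewrite /cons_tuple liftK. Qed.

Lemma delta_cone q b (phi : cochain q.+1) u :
  cone b (delta phi) u = phi u + delta (cone b phi) u.
Proof.
rewrite /cone /delta big_ord_recl; congr (_ + _).
  by congr phi; apply/funext => i /=; rewrite cons_tupleS.
apply: eq_bigr => i _; congr phi; apply/funext => j /=.
have [k ->|->] := unliftP ord0 j.
  have -> : lift (lift ord0 i) (lift ord0 k) = lift ord0 (lift i k).
    by apply/val_inj; rewrite /= /bump /=; lia.
  by rewrite !cons_tupleS.
have -> : lift (lift ord0 i) ord0 = ord0 by exact/val_inj.
by rewrite !cons_tuple0.
Qed.

Lemma delta_cone0 b (phi : cochain 0) u :
  cone b (delta phi) u = phi u + phi (fun=> b).
Proof.
rewrite /cone delta0 addrC cons_tuple0 cons_tupleS; congr (phi _ + _).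
by apply/funext => i; rewrite (ord1 i).
Qed.

(* The transpose of barycentric subdivision, acting on cochains. *)
Fixpoint sd q : cochain q -> cochain q :=
  match q with
  | 0 => id
  | q'.+1 => fun phi v => delta (sd (cone (bary v) phi)) v
  end.

Lemma sdD q (a b : cochain q) : sd (fun v => a v + b v) = fun v => sd a v + sd b v.
Proof.
elim: q a b => //= q IH a b; apply/funext => v.
have := congr1 (fun g => delta g v) (IH (cone (bary v) a) (cone (bary v) b)).
by rewrite deltaD.
Qed.

Lemma sd_delta q (phi : cochain q) : sd (delta phi) = delta (sd phi).
Proof.
elim: q phi => [|q IH] phi; apply/funext => v.
  rewrite [LHS]/=; set p := cone _ _.
  have -> : p = fun u => phi u + phi (fun=> bary v).
    by apply/funext => u; rewrite /p delta_cone0.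
  by rewrite !delta0 /=; apply: (F2_eqD (t := phi (fun=> bary v))); ring.
rewrite -[LHS]/(delta (sd (cone (bary v) (delta phi))) v).
have -> : cone (bary v) (delta phi) =
    fun u => phi u + delta (cone (bary v) phi) u.
  by apply/funext => u; exact: delta_cone.
by rewrite sdD deltaD IH deltaK addr0.
Qed.

Definition neg_cochain q (phi : cochain q) : cochain q := fun v => phi (fun i => - v i).

Lemma sd_neg q (phi : cochain q) : sd (neg_cochain phi) = neg_cochain (sd phi).
Proof.
elim: q phi => [//|q IH] phi; apply/funext => v /=.
have -> : cone (bary v) (neg_cochain phi) =
    neg_cochain (cone (bary (fun i => - v i)) phi).
  apply/funext => u; rewrite /cone /neg_cochain; congr phi; apply/funext => i.
  rewrite /cons_tuple; case: unlift => // ; rewrite /bary sumrN scalerN.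
  by [].
by rewrite IH.
Qed.

Definition avg_closed (C : set V) := forall n (u : 'I_n.+1 -> V),
  (forall i, C (u i)) -> C (bary u).

Lemma bary_dist n (v : 'I_n.+1 -> V) (x : V) (e : R) :
  (forall i, `|x - v i| <= e) -> `|x - bary v| <= e.
Proof.
move=> h; have -> : x - bary v = n.+1%:R^-1 *: \sum_(i < n.+1) (x - v i).
  rewrite sumrB scalerBr sumr_const card_ord -(scaler_nat _ x) scalerA mulVf ?scale1r //.
rewrite normrZ ger0_norm ?invr_ge0 // ler_pdivrMl ?ltr0n //.
apply: le_trans (ler_norm_sum _ _ _) _.
apply: le_trans (ler_sum _ (fun i _ => h i)) _.
by rewrite sumr_const card_ord mulr_natl.
Qed.

Lemma bary_vertex_dist n (v : 'I_n.+1 -> V) (D : R) j :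
  (forall i k, `|v i - v k| <= D) -> `|bary v - v j| <= n%:R / n.+1%:R * D.
Proof.
move=> h; have -> : bary v - v j = n.+1%:R^-1 *: \sum_(i < n.+1) (v i - v j).
  rewrite sumrB scalerBr sumr_const card_ord -(scaler_nat _ (v j)) scalerA mulVf ?scale1r //.
rewrite normrZ ger0_norm ?invr_ge0 // mulrAC mulrC ler_pM2r ?invr_gt0 ?ltr0n //.
rewrite (bigD1 j) //= subrr add0r; apply: le_trans (ler_norm_sum _ _ _) _.
apply: le_trans (ler_sum _ (fun i _ => h i j)) _.
by rewrite sumr_const cardC1 card_ord mulr_natl.
Qed.

(** Subdivision shrinks diameters by the factor q/(q+1); stated dually, [sd phi v] only involves the
    values of [phi] on tuples that small. *)
Lemma sd_local q (C : set V) (D : R) (phi : cochain q) v : avg_closed C ->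
  (forall i, C (v i)) -> (forall i j, `|v i - v j| <= D) ->
  (forall u, (forall i, C (u i)) ->
    (forall i j, `|u i - u j| <= q%:R / q.+1%:R * D) -> phi u = 0) ->
  sd phi v = 0.
Proof.
elim: q C D phi v => [|q IH] C D phi v aC Cv Dv h /=.
  by apply: h => // i j; rewrite !ord1 subrr normr0 mul0r mul0r.
have D0 : 0 <= D by apply: le_trans (Dv ord0 ord0); rewrite normr_ge0.
pose e := q.+1%:R / q.+2%:R * D.
have le_e : q%:R / q.+1%:R * D <= e.
  rewrite ler_wpM2r // ler_pdivrMr ?ltr0n // mulrAC ler_pdivlMr ?ltr0n //.
  by rewrite -!natrM ler_nat; lia.
rewrite /delta big1 // => i _.
(* The faces are subdivided among the points of [C] within [e] of the barycentre, so that adding the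
   barycentre as apex keeps the diameter at most [e]. *)
apply: (IH [set x | C x /\ `|bary v - x| <= e] D).
- move=> n u hu; split; first by apply: aC => k; have [] := hu k.
  by apply: bary_dist => k; have [] := hu k.
- by move=> k; split => //=; exact: bary_vertex_dist.
- by move=> k l; exact: Dv.
move=> u Cu Du; apply: h => k.
  have [k' ->|->] := unliftP ord0 k; first by rewrite cons_tupleS; have [] := Cu k'.
  by rewrite cons_tuple0; exact: aC.
move=> l; have [k' ->|->] := unliftP ord0 k; have [l' ->|->] := unliftP ord0 l;
  rewrite ?cons_tupleS ?cons_tuple0.
- exact: le_trans (Du _ _) le_e.
- by rewrite distrC; have [] := Cu k'.
- by have [] := Cu l'.
- by rewrite subrr normr0 mulr_ge0 // divr_ge0.
Qed.

Lemma iter_sd_local q (C : set V) (D : R) (phi : cochain q) v N : avg_closed C ->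
  (forall i, C (v i)) -> (forall i j, `|v i - v j| <= D) ->
  (forall u, (forall i, C (u i)) ->
    (forall i j, `|u i - u j| <= (q%:R / q.+1%:R) ^+ N * D) -> phi u = 0) ->
  iter N (@sd q) phi v = 0.
Proof.
move=> aC; elim: N D v => [|N IH] D v Cv Dv h /=.
  by apply: h => // i j; rewrite expr0 mul1r.
apply: (sd_local aC Cv Dv) => u Cu Du; apply: (IH _ u Cu Du) => u' Cu' Du'.
by apply: h => // i j; rewrite exprSr -mulrA.
Qed.

Lemma iter_sdD N q (a b : cochain q) : iter N (@sd q) (fun v => a v + b v) =
  fun v => iter N (@sd q) a v + iter N (@sd q) b v.
Proof. by elim: N => //= N ->; rewrite sdD. Qed.

Lemma iter_sd_delta N q (phi : cochain q) :
  iter N (@sd q.+1) (delta phi) = delta (iter N (@sd q) phi).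
Proof. by elim: N => // N IH; rewrite iterS IH sd_delta iterS. Qed.

Lemma iter_sd_neg N q (phi : cochain q) :
  iter N (@sd q) (neg_cochain phi) = neg_cochain (iter N (@sd q) phi).
Proof. by elim: N => //= N ->; rewrite sd_neg. Qed.

End Subdivision.

Section CrossPolytope.
Variables (R : realType) (m : nat).
Local Notation V := ('rV[R]_m.+1 : normedModType R).

Definition cross_polytope : set V := [set x : 'rV[R]_m.+1 | \sum_(i < m.+1) `|x 0 i| = 1].
Local Notation K := cross_polytope.

Lemma cross_polytope_symmetric : symmetric_set K.
Proof.
move=> x; rewrite /cross_polytope /= => <-; apply: eq_bigr => i _.
by rewrite mxE normrN.
Qed.

Lemma cross_polytope_neq0 x : K x -> x != 0.
Proof.
move=> Kx; apply/eqP => x0; move: Kx; rewrite /cross_polytope /= x0 big1.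
  by move=> /esym /eqP; rewrite oner_eq0.
by move=> i _; rewrite mxE normr0.
Qed.

Lemma cross_polytope_compact : compact K.
Proof.
apply: (@subclosed_compact _ K [set v : 'rV[R]_m.+1 | forall i, `[-1, 1]%classic (v ord0 i)]).
- rewrite (_ : K = (fun x : 'rV[R]_m.+1 => \sum_(i < m.+1) `|x 0 i|) @^-1` [set 1]) //.
  apply: closed_comp; last exact: closed_eq.
  move=> x _; apply: (@cvg_sum_ord R _ V m.+1 (fun i (x : 'rV[R]_m.+1) => `|x 0 i|)) => i.
  apply: (continuous_comp (f := fun x : 'rV[R]_m.+1 => x 0 i)); first exact: coord_continuous.
  exact: norm_continuous.
- by apply: (@rV_compact R m.+1 (fun=> `[-1, 1]%classic)) => i; exact: segment_compact.
- move=> x Kx i /=; rewrite in_itv /= -ler_norml -Kx (bigD1 i) //= lerDl.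
  by apply: sumr_ge0.
Qed.

Definition cross_vertex (e : {ffun 'I_m.+1 -> bool}) (i : 'I_m.+1) : V :=
  ((-1) ^+ (e i) *: delta_mx 0 i : 'rV[R]_m.+1).

Definition cross_face q (e : {ffun 'I_m.+1 -> bool}) (i : 'I_q.+1) : V :=
  cross_vertex e (inord i).

Definition facet (e : {ffun 'I_m.+1 -> bool}) : set V :=
  [set x : 'rV[R]_m.+1 | (forall i, 0 <= (-1) ^+ (e i) * x 0 i) /\
           \sum_i (-1) ^+ (e i) * x 0 i = 1].

Lemma facet_sub e : facet e `<=` K.
Proof.
move=> x [h0 h1]; rewrite /cross_polytope /= -h1; apply: eq_bigr => i _.
by rewrite -(ger0_norm (h0 i)) normrM normrX normrN1 expr1n mul1r.
Qed.

Lemma facet_avg e : avg_closed (facet e).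
Proof.
move=> n u hu.
have bE i : (-1) ^+ (e i) * (bary u : 'rV[R]_m.+1) 0 i =
    n.+1%:R^-1 * \sum_(k < n.+1) (-1) ^+ (e i) * (u k : 'rV[R]_m.+1) 0 i.
  by rewrite /bary mxE summxE mulrCA mulr_sumr.
split=> [i|].
  rewrite bE mulr_ge0 ?invr_ge0 // sumr_ge0 // => k _; by have [] := hu k.
under eq_bigr do rewrite bE; rewrite -mulr_sumr exchange_big /=.
under eq_bigr => k _ do rewrite (hu k).2.
by rewrite sumr_const card_ord mulVf.
Qed.

Lemma facet_face q e (i : 'I_q.+1) : facet e (cross_face e i).
Proof.
rewrite /cross_face /cross_vertex; set k := inord i.
have cE j : (-1) ^+ (e j) * ((-1) ^+ (e k) *: delta_mx 0 k : 'rV[R]_m.+1) 0 j = (j == k)%:R.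
  rewrite !mxE eqxx /=; have [->|_] := eqVneq j k; last by rewrite !mulr0.
  by rewrite mulr1 -exprD addnn -mul2n exprM sqrrN expr1n expr1n.
split=> [j|]; first by rewrite cE ler0n.
under eq_bigr do rewrite cE; rewrite (bigD1 k) //= eqxx big1 ?addr0 // => j /negbTE ->.
by [].
Qed.

(** A uniform form of local vanishing; [small_local] obtains it from compactness. Unlike local
    vanishing it can be exploited by subdividing a fixed number of times. *)
Definition small q (phi : cochain V q) := exists2 r : R, 0 < r &
  forall u, (forall i, K (u i)) -> (forall i j, `|u i - u j| <= r) -> phi u = 0.

Lemma small_sd q (phi : cochain V q) : small phi -> exists N0, forall N, (N0 <= N)%N ->
  forall e, iter N (@sd R V q) phi (cross_face e) = 0.
Proof.
(* [D] is a crude bound for the diameter of every face. *)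
move=> [r r0 h]; pose D := 2 * \sum_(i < m.+1) `|delta_mx 0 i : 'rV[R]_m.+1|.
have vb e i : `|cross_vertex e i| <= \sum_(i < m.+1) `|delta_mx 0 i : 'rV[R]_m.+1|.
  rewrite /cross_vertex normrZ normrX normrN1 expr1n mul1r (bigD1 i) //= lerDl.
  exact: sumr_ge0.
have D0 : 0 <= D by rewrite mulr_ge0 // sumr_ge0.
pose t : R := q%:R / q.+1%:R.
have t1 : `|t| < 1.
  rewrite ger0_norm ?divr_ge0 // ltr_pdivrMr ?ltr0n // mul1r ltr_nat.
  exact: ltnSn.
have : (fun N => t ^+ N * D) @ \oo --> (0 : R).
  rewrite -[X in _ --> X](mul0r D); apply: cvgM; last exact: cvg_cst.
  exact: cvg_expr.
move=> /cvgrPdist_lt /(_ r r0) [N0 _ hN]; exists N0 => N N0N e.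
apply: (iter_sd_local (C := facet e) (D := D)).
- exact: facet_avg.
- exact: facet_face.
- move=> i j; apply: le_trans (ler_normB _ _) _; rewrite /D mulr2n mulrDl mul1r.
  by apply: lerD; exact: vb.
- move=> u Cu Du; apply: h => [i|i j]; first exact/facet_sub/Cu.
  apply: le_trans (Du i j) _; have := hN N N0N.
  have tD : 0 <= t ^+ N * D by apply: mulr_ge0 => //; rewrite exprn_ge0 // divr_ge0.
  by rewrite /= sub0r normrN ger0_norm // => /ltW.
Qed.

Definition flip (A : pred 'I_m.+1) (e : {ffun 'I_m.+1 -> bool}) : {ffun 'I_m.+1 -> bool} :=
  [ffun i => e i (+) A i].

Lemma flipK A : involutive (flip A).
Proof. by move=> e; apply/ffunP => i; rewrite !ffunE addbK. Qed.

(** Evaluation on the half with nonnegative coordinate q of the q-dimensional cross polytope in the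
    first q + 1 coordinates. Later signs do not affect the faces and are fixed, so that each face is
    counted once; [ssum] is the evaluation on the whole q-dimensional polytope. *)
Definition hsum q (phi : cochain V q) : 'F_2 :=
  \sum_(e : {ffun 'I_m.+1 -> bool} | [forall j : 'I_m.+1, (q <= j)%N ==> ~~ e j])
    phi (cross_face e).

Definition ssum q (phi : cochain V q) : 'F_2 :=
  \sum_(e : {ffun 'I_m.+1 -> bool} | [forall j : 'I_m.+1, (q < j)%N ==> ~~ e j])
    phi (cross_face e).

(** A face that omits a vertex i <= q belongs to two simplices, which differ in the sign of i, and
    cancels. Only the faces that omit the last vertex remain, and they form the equator. *)
Lemma hsum_delta q (phi : cochain V q) : (q < m)%N -> hsum (delta phi) = ssum phi.
Proof.
move=> qm; rewrite /hsum /delta exchange_big big_ord_recr /=.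
rewrite big1 ?add0r => [|i _].
  apply: eq_bigr => e _; congr phi; apply/funext => k.
  by rewrite /cross_face /=; congr (cross_vertex e (inord _)); rewrite /bump leqNgt ltn_ord.
pose A : pred 'I_m.+1 := fun j => j == inord i.
have iq : (i < q.+1)%N := ltn_ord i.
rewrite (bigID (fun e : {ffun 'I_m.+1 -> bool} => e (inord i))) /=.
rewrite [X in _ + X](reindex_inj (inv_inj (flipK A))) /=.
set S := \sum_(e | _) _; set S' := \sum_(e | _) _.
suff -> : S' = S by rewrite F2_addxx.
apply: eq_big => [e|e _].
  rewrite ffunE /A eqxx addbT negbK; congr (_ && _).
  apply: eq_forallb => j; rewrite ffunE /A.
  have [qj|//] := boolP (q.+1 <= j)%N.
  have /negbTE -> : j != inord i.
    by apply: contraTneq qj => ->; rewrite inordK ?(ltn_trans iq) // -ltnNge ltnS // ltnW.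
  by rewrite addbF.
congr phi; apply/funext => k; rewrite /= /cross_face /cross_vertex ffunE /A.
have /negbTE -> : inord (bump i k) != inord i :> 'I_m.+1; last by rewrite addbF.
apply/eqP => /(congr1 val) /=; rewrite !inordK; last 2 first.
- by rewrite ltnS ltnW // (leq_trans iq).
- apply: (@leq_ltn_trans k.+1); first by rewrite /bump; case: (i <= k)%N; rewrite /= ?add1n ?add0n ?leqnn ?leqnSn.
  by rewrite ltnS (leq_trans (ltn_ord k) qm).
by move/eqP; rewrite eq_sym (negbTE (neq_bump _ _)).
Qed.

(** Reversing the signs of the coordinates up to q exchanges the two hemispheres and acts on their
    faces as the antipode. *)
Lemma ssumE q (phi : cochain V q) : (q <= m)%N ->
  ssum phi = hsum phi + hsum (neg_cochain phi).
Proof.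
move=> qm; rewrite /ssum (bigID (fun e : {ffun 'I_m.+1 -> bool} => ~~ e (inord q))) /=.
congr (_ + _).
  apply: eq_bigl => e; apply/andP/forallP => [[/forallP h hq] j|h].
    apply/implyP; rewrite leq_eqVlt => /orP[/eqP e'|]; last by apply/implyP.
    by move: hq; rewrite e' inord_val.
  split; last by apply: (implyP (h _)); rewrite inordK.
  by apply/forallP => j; apply/implyP => /ltnW; apply/implyP.
pose A : pred 'I_m.+1 := fun j => (j <= q)%N.
rewrite (reindex_inj (inv_inj (flipK A))) /=; apply: eq_big => [e|e _].
  apply/andP/forallP => [[/forallP h hq] j|h].
    apply/implyP; rewrite leq_eqVlt => /orP[/eqP e'|qj].
      by move: hq; rewrite ffunE /A e' inord_val leqnn addbT negbK.
    by have := h j; rewrite ffunE /A qj leqNgt qj addbF.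
  split; last by rewrite ffunE /A inordK // leqnn addbT negbK; apply: (implyP (h _)); rewrite inordK.
  apply/forallP => j; apply/implyP => qj; rewrite ffunE /A leqNgt qj addbF.
  by apply: (implyP (h _)); exact: ltnW.
rewrite /neg_cochain; congr phi; apply/funext => i.
rewrite /cross_face /cross_vertex ffunE /A inordK; last first.
  by rewrite ltnS (leq_trans _ qm) // -ltnS.
by rewrite -ltnS ltn_ord addbT -scaleNr; case: (e _); rewrite /= ?expr0 ?expr1 ?opprK.
Qed.

Lemma hsum0 (phi : cochain V 0) : hsum phi = phi (cross_face [ffun=> false]).
Proof.
rewrite /hsum (big_pred1 [ffun=> false]) // => e.
apply/forallP/eqP => [h|-> j]; last by rewrite ffunE implybT.
by apply/ffunP => j; rewrite ffunE; apply/negbTE/(implyP (h j)).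
Qed.

Lemma eventually_hsum q (phi : cochain V q) : small phi ->
  exists N0, forall N, (N0 <= N)%N -> hsum (iter N (@sd R V q) phi) = 0.
Proof.
move=> /small_sd[N0 h]; exists N0 => N N0N.
by rewrite /hsum big1 // => e _; exact: h.
Qed.

Lemma hsumD q (a b : cochain V q) : hsum (fun v => a v + b v) = hsum a + hsum b.
Proof. by rewrite /hsum big_split. Qed.

Lemma small_local q (phi : cochain V q) :
  (forall x : K, exists2 U : set K, nbhs x U & forall v : 'I_q.+1 -> K,
     (forall i, U (v i)) -> phi (fun i => val (v i)) = 0) -> small phi.
Proof.
move=> h; pose Q (S : set V) := forall u, (forall i, S (u i) /\ K (u i)) -> phi u = 0.
have QS A B : A `<=` B -> Q B -> Q A.
  by move=> AB QB u hu; apply: QB => i; have [/AB] := hu i.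
have hQ (x : V) : K x -> exists2 U : set V, nbhs x U & Q U.
  move=> Kx; have [U nU hU] := h (exist _ x (mem_set Kx)).
  case: nU => _ [[E oE <-]] /= Ex EU; exists E; first exact: open_nbhs_nbhs.
  move=> u hu; pose v i : K := exist _ (u i) (mem_set (hu i).2).
  by apply: (hU v) => i; apply: EU; have [] := hu i.
have [e e0 he] := lebesgue_number cross_polytope_compact QS hQ.
exists (e / 2); first by rewrite divr_gt0.
move=> u Ku Du; apply: (he (u ord0) (Ku ord0)) => i; split => //.
rewrite -ball_normE /=; apply: le_lt_trans (Du _ _) _.
by rewrite ltr_pdivrMr // ltr_pMr // ltr1n.
Qed.

Let p0 : K := exist _ (cross_face [ffun=> false] (ord0 : 'I_1))
  (mem_set (facet_sub (facet_face [ffun=> false] (ord0 : 'I_1)))).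

(** Subdivision acts on cochains of the whole space. Values off [K] are arbitrary, which is harmless
    since [small] only tests tuples of [K]. *)
Let lift (x : V) : K := insubd p0 x.

Let liftK x : K x -> val (lift x) = x.
Proof. by move=> Kx; rewrite /lift insubdK // inE. Qed.

Let lift_val (x : K) : lift (val x) = x.
Proof. by apply/val_inj; rewrite liftK //; exact: set_valP. Qed.

Let pr (x : V) : mod_antipodal K := proj_antipodal (lift x).

Let pullV q (a : cochain (mod_antipodal K) q) : cochain V q := fun u => a (pr \o u).

Let pullV_small q (a : cochain (mod_antipodal K) q) : lzero setT a -> small (pullV a).
Proof.
move=> ha; apply: small_local => x; have [U nU hU] := ha (proj_antipodal x) I.
exists (@proj_antipodal _ _ _ @^-1` U); first exact: proj_antipodal_continuous.
move=> v hv; apply: hU => i /=; rewrite /pr lift_val; exact: hv.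
Qed.

Let pullV_even q (a : cochain (mod_antipodal K) q) u : (forall i, K (u i)) ->
  neg_cochain (pullV a) u = pullV a u.
Proof.
move=> Ku; congr a; apply/funext => i /=; apply/proj_antipodalE; right.
by rewrite !liftK //; exact: cross_polytope_symmetric.
Qed.

Let small_on q (a b : cochain V q) : (forall u, (forall i, K (u i)) -> a u = b u) ->
  small (fun u => a u - b u).
Proof. by move=> h; exists 1 => // u Ku _; rewrite h // subrr. Qed.

Let hsum_small q (a b : cochain V q) : small (fun u => a u - b u) ->
  exists N0, forall N, (N0 <= N)%N ->
    hsum (iter N (@sd R V q) a) = hsum (iter N (@sd R V q) b).
Proof.
move=> /eventually_hsum[N0 h]; exists N0 => N /h.
rewrite (_ : (fun u => a u - b u) = fun u => a u + b u); last first.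
  by apply/funext => u; rewrite F2_opp.
rewrite iter_sdD hsumD => e.
have -> : hsum (iter N (@sd R V q) a) =
  (hsum (iter N (@sd R V q) a) + hsum (iter N (@sd R V q) b)) + hsum (iter N (@sd R V q) b).
  by rewrite -addrA F2_addxx addr0.
by rewrite e add0r.
Qed.

(* Stokes on the hemisphere: its boundary is the sum of a lower-dimensional
   hemisphere and its antipode. *)
Let hsum_stokes q (a : cochain V q) N : (q < m)%N ->
  hsum (iter N (@sd R V q.+1) (delta a)) =
  hsum (iter N (@sd R V q) (fun u => a u + neg_cochain a u)).
Proof.
move=> qm; rewrite iter_sd_delta hsum_delta // ssumE; last exact: ltnW.
by rewrite iter_sdD hsumD iter_sd_neg.
Qed.

(** Near the diagonal w^(q+1) is the coboundary of c w^q. By Stokes its value is that of c w^q plus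
    its antipode on a hemisphere one dimension lower; as c(-x) = c(x) + 1 and w^q is even, the sum
    is w^q. Identities valid near the diagonal hold after enough subdivisions. *)
Lemma cross_polytope_hsum_pow w c q : @characteristic R V K w c -> (q <= m)%N ->
  exists N0, forall N, (N0 <= N)%N -> hsum (iter N (@sd R V q) (pullV (cup_pow w q))) = 1.
Proof.
move=> hw; have [hc hwc] := hw.
have oc : continuous (-%R : V -> V) by exact: opp_continuous.
have cw := characteristic_cocycle oc cross_polytope_symmetric hw.
elim: q => [_|q IH qm].
  exists 0%N => N _; rewrite hsum0.
  by rewrite (_ : iter _ _ _ = pullV (cup_pow w 0)) //; elim: N => //= N ->.
have [N1 h1] := IH (ltnW qm).
pose P := pullV (cup_pow w q); pose a := cup0 (fun x => c (lift x)) P.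
have [N2 h2] : exists N0, forall N, (N0 <= N)%N ->
    hsum (iter N (@sd R V q.+1) (pullV (cup_pow w q.+1))) =
    hsum (iter N (@sd R V q.+1) (delta a)).
  apply: hsum_small; apply: small_local => x.
  have [U nU hU] := hwc x.
  have /lzeroT/(_ (proj_antipodal x) I)[U' nU' hU'] := cup_pow_cocycle q cw.
  exists (U `&` @proj_antipodal _ _ _ @^-1` U').
    by apply: filterI => //; exact: proj_antipodal_continuous.
  move=> v Uv; rewrite delta_cup0 !lift_val.
  have -> : delta P (fun i => val (v i)) = 0.
    apply: (hU' (fun i => pr (val (v i)))) => i.
    by rewrite /pr lift_val; have [] := Uv i.
  rewrite mulr0 addr0 /pullV [cup_pow w q.+1 _]cupE /= /pr !lift_val hU.
  - by rewrite subrr.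
  - by have [] := Uv ord0.
  - by have [] := Uv (fintype.lift ord0 ord0).
have [N3 h3] : exists N0, forall N, (N0 <= N)%N ->
    hsum (iter N (@sd R V q) (fun u => a u + neg_cochain a u)) =
    hsum (iter N (@sd R V q) P).
  apply: hsum_small; apply: small_on => u Ku.
  rewrite -[neg_cochain a u]/(c (lift (- u ord0)) * neg_cochain P u).
  have -> : neg_cochain P u = P u by exact: pullV_even.
  rewrite /a /cup0.
  have -> : c (lift (- u ord0)) = c (lift (u ord0)) + 1.
    by apply: hc; rewrite !liftK //; exact: cross_polytope_symmetric.
  by apply: (F2_eqD (t := c (lift (u ord0)) * P u)); ring.
exists (maxn N1 (maxn N2 N3)) => N; rewrite !geq_max => /and3P[n1 n2 n3].
by rewrite h2 // hsum_stokes // h3 // h1.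
Qed.

(** By Stokes a coboundary evaluates to a primitive plus its antipode, and a primitive that comes
    from the quotient is even. *)
Lemma hsum_coboundary q (a : cochain (mod_antipodal K) q) : (q <= m)%N ->
  as_coboundary a -> exists N0, forall N, (N0 <= N)%N ->
    hsum (iter N (@sd R V q) (pullV a)) = 0.
Proof.
case: q a => [|q] a qm.
  by move=> /lzeroT/pullV_small/eventually_hsum.
move=> [p /lzeroT /pullV_small hp].
have [N1 h1] := hsum_small (b := delta (pullV p)) hp.
have [N2 h2] : exists N0, forall N, (N0 <= N)%N ->
    hsum (iter N (@sd R V q) (fun u => pullV p u + neg_cochain (pullV p) u)) = 0.
  apply: eventually_hsum; exists 1 => // u Ku _.
  by rewrite pullV_even // F2_addxx.
exists (maxn N1 N2) => N; rewrite geq_max => /andP[n1 n2].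
by rewrite h1 // hsum_stokes // h2.
Qed.

Lemma cross_polytope_pow w c : @characteristic R V K w c -> ~ as_coboundary (cup_pow w m).
Proof.
move=> hw /(hsum_coboundary (leqnn m))[N1 h1].
have [N2 h2] := cross_polytope_hsum_pow hw (leqnn m).
have := h1 _ (leq_maxl N1 N2); by rewrite h2 ?leq_maxr.
Qed.

End CrossPolytope.

(** * Weak compactness *)

Section HahnBanach.
Variables (R : realType) (W : lmodType R).
Implicit Types p q : W -> R.

Definition sublinear q := (forall u v, q (u + v) <= q u + q v) /\
  (forall t u, 0 <= t -> q (t *: u) = t * q u).

Lemma sublinear0 q : sublinear q -> q 0 = 0.
Proof. by move=> [_ h]; have := h 0 0 (lexx _); rewrite scale0r mul0r. Qed.

Lemma sublinearN q v : sublinear q -> - q (- v) <= q v.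
Proof.
move=> hq; have := hq.1 v (- v); rewrite subrr (sublinear0 hq) => h.
by rewrite -subr_ge0 opprK.
Qed.

Definition shift_set q a v : set R := [set q (v + t *: a) - t * q a | t in [set t | 0 <= t]].

Lemma shift_set_lbound q a v : sublinear q -> lbound (shift_set q a v) (- q (- v)).
Proof.
move=> hq _ [t t0 <-]; have := hq.1 (v + t *: a) (- v).
rewrite addrAC subrr add0r (hq.2 _ _ t0); lra.
Qed.

Lemma shift_set_neq0 q a v : shift_set q a v !=set0.
Proof. by exists (q (v + 0 *: a) - 0 * q a); exists 0 => //=. Qed.

(** A sublinear minorant of [q] whose value at -a is at most -q(a). A minimal [q] must agree with it
    for every a, which makes [q] additive. *)
Definition shifted q a v := inf (shift_set q a v).

Lemma shift_le q a v t : sublinear q -> 0 <= t -> shifted q a v <= q (v + t *: a) - t * q a.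
Proof.
move=> hq t0; apply: ge_inf; last by exists t.
by exists (- q (- v)); exact: shift_set_lbound.
Qed.

Lemma shift_ge q a v x : (forall t, 0 <= t -> x <= q (v + t *: a) - t * q a) ->
  x <= shifted q a v.
Proof.
move=> h; apply: lb_le_inf; first exact: shift_set_neq0.
by move=> _ [t t0 <-]; exact: h.
Qed.

Lemma shift_sublinear q a : sublinear q -> sublinear (shifted q a).
Proof.
move=> hq; have scl t u : 0 < t -> shifted q a (t *: u) <= t * shifted q a u.
  move=> t0; rewrite -ler_pdivrMl //; apply: shift_ge => s s0; rewrite ler_pdivrMl //.
  apply: le_trans (shift_le _ _ hq (mulr_ge0 (ltW t0) s0)) _.
  by rewrite -scalerA -scalerDr (hq.2 _ _ (ltW t0)) mulrBr mulrA.
split=> [u v|t u].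
  rewrite -lerBlDl; apply: shift_ge => s s0; rewrite lerBlDl -lerBlDr.
  apply: shift_ge => t t0; rewrite lerBlDr.
  apply: le_trans (shift_le _ _ hq (addr_ge0 t0 s0)) _.
  have := hq.1 (u + t *: a) (v + s *: a).
  rewrite addrACA -scalerDl; lra.
rewrite le_eqVlt => /orP[/eqP <-|t0].
  rewrite scale0r mul0r; apply/eqP; rewrite eq_le; apply/andP; split.
    by have := shift_le a 0 hq (lexx 0); rewrite scale0r addr0 (sublinear0 hq) mul0r subr0.
  by apply: shift_ge => s s0; rewrite add0r hq.2 // subrr.
apply/eqP; rewrite eq_le scl //=.
have := scl t^-1 (t *: u); rewrite invr_gt0 => /(_ t0).
by rewrite scalerA mulVf ?gt_eqF // scale1r ler_pdivlMl.
Qed.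

Lemma shift_leq q a v : sublinear q -> shifted q a v <= q v.
Proof.
move=> hq; have := shift_le a v hq (lexx 0).
by rewrite scale0r addr0 mul0r subr0.
Qed.

(* A minimal sublinear functional is linear. *)
Lemma hahn_banach p u0 : sublinear p ->
  exists phi : W -> R, [/\ linear (phi : W -> R^o), forall v, phi v <= p v & phi u0 = p u0].
Proof.
(* Starting below [shifted p u0] forces phi(-u0) <= -p(u0), hence equality at u0. *)
move=> hp; pose p' := shifted p u0; have hp' : sublinear p' by exact: shift_sublinear.
pose T := {q : W -> R | sublinear q /\ forall v, q v <= p' v}.
pose r (s t : T) := `[< forall v, sval t v <= sval s v >].
have lb (t : T) v : - p' (- v) <= sval t v.
  case: t => q [hq qp] /=; apply: le_trans (sublinearN v hq).
  by rewrite lerN2.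
have [|||A tA|[q [hq qp]] qmin] := @Zorn T r.
- by move=> t; apply/asboolP.
- move=> s t u /asboolP st /asboolP tu; apply/asboolP => v.
  exact: le_trans (tu v) (st v).
- move=> s t /asboolP st /asboolP ts; apply: eq_sig_hprop => [x|]; first exact: Prop_irrelevance.
  by apply/funext => v; apply/eqP; rewrite eq_le ts st.
- have [A0|/set0P [a Aa]] := eqVneq A set0.
    exists (exist _ p' (conj hp' (fun=> lexx _))) => s.
    by rewrite A0.
  pose E v : set R := [set sval t v | t in A].
  have E0 v : E v !=set0 by exists (sval a v); exists a.
  have Elb v : has_lbound (E v) by exists (- p' (- v)) => _ [t _ <-]; exact: lb.
  pose m v := inf (E v).
  have mle t v : A t -> m v <= sval t v by move=> At; apply: ge_inf => //; exists t.
  have mge v x : (forall t, A t -> x <= sval t v) -> x <= m v.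
    by move=> h; apply: lb_le_inf => // _ [t At <-]; exact: h.
  have hm : sublinear m.
    split=> [u v|t u].
      rewrite -lerBlDl; apply: (mge) => s As; rewrite lerBlDl -lerBlDr.
      apply: (mge) => t At; rewrite lerBlDr.
      (* An infimum of sublinear functionals need not be subadditive; in a chain the smaller of the
         two members bounds both terms. *)
      have [/asboolP st|/asboolP ts] := tA s t As At.
        apply: le_trans (mle t _ At) _; apply: le_trans ((svalP t).1.1 _ _) _.
        by rewrite lerD2l.
      apply: le_trans (mle s _ As) _; apply: le_trans ((svalP s).1.1 _ _) _.
      by rewrite lerD2r.
    move=> t0; apply/eqP; rewrite eq_le; apply/andP; split.
      have [->|tn] := eqVneq t 0.
        rewrite mul0r scale0r; apply: le_trans (mle a _ Aa) _.
        by rewrite (sublinear0 (svalP a).1).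
      have {}t0 : 0 < t by rewrite lt_neqAle eq_sym tn.
      rewrite -ler_pdivrMl //; apply: (mge) => s As; rewrite ler_pdivrMl //.
      by rewrite -((svalP s).1.2 t u (ltW t0)); exact: mle.
    apply: (mge) => s As; rewrite (svalP s).1.2 //.
    by apply: ler_wpM2l => //; exact: mle.
  have mp v : m v <= p' v by apply: le_trans (mle a v Aa) _; exact: (svalP a).2.
  exists (exist _ m (conj hm mp)) => s As; apply/asboolP => v /=; exact: mle.
(* By minimality [q] equals [shifted q a]; parameter 1 in the infimum gives superadditivity. *)
have qs a v : q v <= q (v + a) - q a.
  have hs : sublinear (shifted q a) by exact: shift_sublinear.
  have sp w : shifted q a w <= p' w by apply: le_trans (qp w); exact: shift_leq.
  have := qmin (exist _ (shifted q a) (conj hs sp)).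
  have -> : r (exist _ q (conj hq qp)) (exist _ (shifted q a) (conj hs sp)).
    by apply/asboolP => w /=; exact: shift_leq.
  move=> /(_ isT)/(congr1 sval) /= e; rewrite -{1}e.
  by have := shift_le a v hq ler01; rewrite scale1r mul1r.
have qD u v : q (u + v) = q u + q v.
  apply/eqP; rewrite eq_le hq.1 /=; have := qs v u; lra.
have qN v : q (- v) = - q v.
  by apply/eqP; rewrite -subr_eq0 opprK -qD addNr (sublinear0 hq).
exists q; split.
- move=> t u v; rewrite qD; congr (_ + _).
  have [t0|t0] := leP 0 t; first exact: hq.2.
  rewrite -[t]opprK scaleNr qN hq.2 ?oppr_ge0 ?ltW //.
  by rewrite -mulNr.
- by move=> v; apply: le_trans (qp v) _; exact: shift_leq.
- apply/eqP; rewrite eq_le; apply/andP; split.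
    by apply: le_trans (qp u0) _; exact: shift_leq.
  have := qp (- u0); rewrite qN.
  have := shift_le u0 (- u0) hp ler01.
  rewrite scale1r addNr (sublinear0 hp) mul1r -/p'; lra.
Qed.

End HahnBanach.

Section Dual.
Variables (R : realType) (W : normedModType R).
Implicit Types (phi psi : W -> R) (u v : W).

Lemma linear_real phi : linear (phi : W -> R^o) -> (forall t u, phi (t *: u) = t * phi u) /\
  [/\ forall u v, phi (u + v) = phi u + phi v, forall u v, phi (u - v) = phi u - phi v,
      forall u, phi (- u) = - phi u & phi 0 = 0].
Proof.
move=> lp; have D u v : phi (u + v) = phi u + phi v.
  by have := lp 1 u v; rewrite !scale1r.
have p0 : phi 0 = 0.
  have /eqP := D 0 0; rewrite addr0 -[X in X == _]addr0 (inj_eq (addrI _)).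
  by move=> /eqP ->.
have Z t u : phi (t *: u) = t * phi u by have := lp t u 0; rewrite !addr0 p0 addr0.
have N u : phi (- u) = - phi u by rewrite -scaleN1r Z mulN1r.
by split => //; split => // u v; rewrite D N.
Qed.

Lemma dual_linear phi : dual phi -> (forall t u, phi (t *: u) = t * phi u) /\
  [/\ forall u v, phi (u + v) = phi u + phi v, forall u v, phi (u - v) = phi u - phi v,
      forall u, phi (- u) = - phi u & phi 0 = 0].
Proof. by move=> [/linear_real]. Qed.

Lemma dual_bounded phi : dual phi -> exists2 C, 0 <= C & forall v, `|phi v| <= C * `|v|.
Proof.
move=> dp; have [Z [_ _ _ p0]] := dual_linear dp.
have /cvgrPdist_lt /(_ 1 ltr01) /nbhs_ballP[d /= d0 hd] := dp.2 0.
exists (2 / d); first by rewrite divr_ge0 // ltW.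
move=> v; have [->|v0] := eqVneq v 0; first by rewrite p0 !normr0 mulr0.
have nv : 0 < `|v| by rewrite normr_gt0.
have := hd (d / 2 / `|v| *: v).
rewrite -ball_normE /= sub0r normrN p0 sub0r normrN Z normrM normrZ.
rewrite [`|d / 2 / _|]ger0_norm; last by rewrite !divr_ge0 // ltW.
rewrite divfK ?gt_eqF // ltr_pdivrMr // ltr_pMr // ltr1n => /(_ isT).
rewrite mulrAC ltr_pdivrMr // mul1r mulrC => h.
rewrite mulrAC ler_pdivlMr //; move: h; lra.
Qed.

Lemma bounded_dual phi C : linear (phi : W -> R^o) -> (forall v, `|phi v| <= C * `|v|) ->
  dual phi.
Proof.
move=> lp h; split => // u; apply/cvgrPdist_lt => e e0.
have D a b : phi (a + b) = phi a + phi b by have := lp 1 a b; rewrite !scale1r.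
have C1 : 0 < `|C| + 1 by rewrite ltr_wpDl.
apply/nbhs_ballP; exists (e / (`|C| + 1)); first by rewrite /= divr_gt0.
move=> v; rewrite -ball_normE /= ltr_pdivlMr // => uv.
have -> : phi u - phi v = phi (u - v) by have := D (u - v) v; rewrite subrK; lra.
apply: le_lt_trans (h _) _; apply: le_lt_trans uv; rewrite mulrC ler_wpM2l //.
by rewrite (le_trans (ler_norm _)) // lerDl.
Qed.

Lemma dual_norm_bounded phi : dual phi ->
  has_ubound [set `|phi v| | v in [set v : W | `|v| <= 1]].
Proof.
move=> /dual_bounded[C C0 hC]; exists C => _ [v /= v1 <-].
by apply: le_trans (hC v) _; rewrite ler_piMr.
Qed.

Lemma dual_norm_ge0 phi : dual phi -> 0 <= dual_norm phi.
Proof.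
move=> dp; apply: le_trans (normr_ge0 (phi 0)) _.
apply: ub_le_sup; first exact: dual_norm_bounded.
by exists 0 => //=; rewrite normr0.
Qed.

Lemma dual_le phi v : dual phi -> `|phi v| <= dual_norm phi * `|v|.
Proof.
move=> dp; have [Z [_ _ _ p0]] := dual_linear dp.
have [->|v0] := eqVneq v 0; first by rewrite p0 !normr0 mulr0.
have nv : 0 < `|v| by rewrite normr_gt0.
rewrite -ler_pdivrMr //; apply: ub_le_sup; first exact: dual_norm_bounded.
exists (`|v|^-1 *: v) => /=.
  by rewrite normrZ normfV normr_id mulVf ?gt_eqF.
by rewrite Z normrM normfV normr_id mulrC.
Qed.

Lemma dualB phi psi : dual phi -> dual psi -> dual (phi \- psi).
Proof.
move=> [lp cp] [lq cq]; split; last by move=> v; apply: continuousB; [exact: cp|exact: cq].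
move=> t u v /=; rewrite lp lq /GRing.scale /=; ring.
Qed.

Lemma dualZD (a : R) phi psi : dual phi -> dual psi -> dual (fun v => a * phi v + psi v).
Proof.
move=> [lp cp] [lq cq]; split.
  by move=> t u v /=; rewrite lp lq /GRing.scale /=; ring.
move=> v; apply: cvgD; last exact: cq.
by apply: cvgM; [exact: cvg_cst|exact: cp].
Qed.

Lemma dual_norm_functional u : exists phi, [/\ dual phi, forall v, `|phi v| <= `|v| &
  phi u = `|u|].
Proof.
have sn : sublinear (fun v : W => `|v|).
  by split=> [a b|t a t0]; [exact: ler_normD|rewrite normrZ ger0_norm].
have [phi [lp le pu]] := hahn_banach u sn.
have ab v : `|phi v| <= `|v|.
  rewrite ler_norml le andbT lerNl -normrN; apply: le_trans (le (- v)).
  have := lp (-1) v 0; rewrite addr0 scaleN1r => ->.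
  have := lp 1 0 0; rewrite !scale1r addr0 => /eqP.
  rewrite -[X in X == _]addr0 (inj_eq (addrI _)) => /eqP <-.
  by rewrite addr0 scaleN1r.
exists phi; split => //; apply: (bounded_dual (C := 1)) => // v.
by rewrite mul1r.
Qed.

End Dual.

Section WeakCompactness.
Variables (R : realType) (W : normedModType R).
Hypothesis W_refl : reflexive_space W.

Lemma ultra_bounded_lim (U : set_system nat) (a : nat -> R) (C : R) : UltraFilter U ->
  (forall j, `|a j| <= C) -> exists x, forall e : R, 0 < e -> U [set j | `|a j - x| < e].
Proof.
move=> UU aC; have UP : ProperFilter U by exact: ultra_proper.
have aF : (a @ U) `[- C, C]%classic.
  apply: (@filterS _ U _ setT) => [j _ /=|]; last exact: filterT.
  by rewrite /= in_itv /= -ler_norml.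
have [x [_ cx]] := @segment_compact R (- C) C (a @ U) _ aF.
exists x => e e0; have [//|nh] := in_ultra_setVsetC [set j | `|a j - x| < e] UU.
have [y [/= h1 h2]] := cx _ (ball x e) (nh : (a @ U) [set y | ~ `|y - x| < e]) (nbhsx_ballx _ _ e0).
by exfalso; apply: h1; move: h2; rewrite -ball_normE /= distrC.
Qed.

Lemma ultra_limit_eq (U : set_system nat) (a : nat -> R) x y : ProperFilter U ->
  (forall e : R, 0 < e -> U [set j | `|a j - x| < e]) ->
  (forall e : R, 0 < e -> U [set j | `|a j - y| < e]) -> x = y.
Proof.
move=> UP hx hy; apply: contrapT => /eqP; rewrite -subr_eq0 -normr_gt0 => d.
have d2 : 0 < `|x - y| / 2 by rewrite divr_gt0.
have [j [/= jx jy]] := filter_ex (filterI (hx _ d2) (hy _ d2)).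
have := ler_distD (a j) x y; rewrite (distrC x (a j)); lra.
Qed.

(** The limits of phi(u_j) along the ultrafilter form a bounded linear functional of phi, which
    reflexivity represents by a point. *)
Lemma ultra_weak_limit (U : set_system nat) (u : nat -> W) (M : R) : UltraFilter U ->
  (forall j, `|u j| <= M) -> exists l, forall phi, dual phi ->
    forall e : R, 0 < e -> U [set j | `|phi (u j) - phi l| < e].
Proof.
move=> UU uM; have UP : ProperFilter U by exact: ultra_proper.
have M0 : 0 <= M by apply: le_trans (uM 0%N).
have ab phi : dual phi -> forall j, `|phi (u j)| <= M * dual_norm phi.
  move=> dp j; apply: le_trans (dual_le _ dp) _; rewrite mulrC ler_wpM2r //.
  exact: dual_norm_ge0.
have /choice[xi hxi] : forall phi : W -> R, exists x, dual phi ->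
    forall e : R, 0 < e -> U [set j | `|phi (u j) - x| < e].
  move=> phi; have [dp|nd] := pselect (dual phi); last by exists 0.
  by have [x hx] := ultra_bounded_lim UU (ab phi dp); exists x.
have [|| l hl] := W_refl (xi := xi).
- move=> a phi psi dp dq.
  apply: (@ultra_limit_eq U (fun j => a * phi (u j) + psi (u j))).
    by apply: hxi; exact: dualZD.
  move=> e e0; have a1 : 0 < `|a| + 1 by rewrite ltr_wpDl.
  have e1 : 0 < e / 2 / (`|a| + 1) by rewrite !divr_gt0.
  have e2 : 0 < e / 2 by rewrite divr_gt0.
  apply: filterS (filterI (hxi _ dp _ e1) (hxi _ dq _ e2)) => j /= [h1 h2].
  have -> : a * phi (u j) + psi (u j) - (a * xi phi + xi psi) =
    a * (phi (u j) - xi phi) + (psi (u j) - xi psi) by ring.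
  rewrite [e]splitr; apply: le_lt_trans (ler_normD _ _) _.
  apply: ler_ltD h2; rewrite normrM; move: h1; rewrite ltr_pdivlMr // => /ltW.
  apply: le_trans; rewrite mulrC ler_wpM2l //; lra.
- exists M => phi dp; rewrite leNgt; apply/negP => h.
  have e0 : 0 < `|xi phi| - M * dual_norm phi by rewrite subr_gt0.
  have [j /=] := filter_ex (hxi _ dp _ e0).
  have := ab _ dp j; have := ler_distD (phi (u j)) (xi phi) 0.
  rewrite !subr0 distrC; lra.
- by exists l => phi dp; rewrite -(hl _ dp); exact: hxi.
Qed.

Section Subsequence.
Variables (u : nat -> W) (M : R).
Hypothesis uM : forall j, `|u j| <= M.

Definition comb (P : {poly R}) : W := \sum_(i < size P) P`_i *: u i.

Let combE n (P : {poly R}) : (size P <= n)%N -> comb P = \sum_(i < n) P`_i *: u i.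
Proof.
move=> Pn; rewrite /comb (big_ord_widen n (fun i => P`_i *: u i)) // big_mkcond.
apply: eq_bigr => i _; case: ltnP => // /leq_sizeP -> //.
by rewrite scale0r.
Qed.

Let combD P Q : comb (P + Q) = comb P + comb Q.
Proof.
pose n := maxn (size P) (size Q).
rewrite !(@combE n) ?leq_maxl ?leq_maxr ?size_polyD // -big_split /=.
by apply: eq_bigr => i _; rewrite coefD scalerDl.
Qed.

Let combZ t P : comb (t *: P) = t *: comb P.
Proof.
rewrite (@combE (size P) (t *: P)) ?size_scale_leq // scaler_sumr.
by apply: eq_bigr => i _; rewrite coefZ scalerA.
Qed.

Let dist_set v : set R := [set `|v - comb P| | P in setT].

(** The distance to the linear span of the u_i; polynomials serve as finite coefficient
    sequences. *)
Definition span_dist v := inf (dist_set v).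

Let span_dist_le v P : span_dist v <= `|v - comb P|.
Proof. by apply: ge_inf; [exists 0 => _ [Q _ <-]|exists P]. Qed.

Let span_dist_ge v x : (forall P, x <= `|v - comb P|) -> x <= span_dist v.
Proof.
by move=> h; apply: lb_le_inf => [|_ [P _ <-]]; [exists `|v - comb 0|; exists 0|exact: h].
Qed.

Let span_dist_sublinear : sublinear span_dist.
Proof.
have scl t v : 0 < t -> span_dist (t *: v) <= t * span_dist v.
  move=> t0; rewrite -ler_pdivrMl //; apply: span_dist_ge => P; rewrite ler_pdivrMl //.
  apply: le_trans (span_dist_le _ (t *: P)) _.
  by rewrite combZ -scalerBr normrZ gtr0_norm.
split=> [v w|t v].
  rewrite -lerBlDl; apply: span_dist_ge => Q; rewrite lerBlDl -lerBlDr.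
  apply: span_dist_ge => P; rewrite lerBlDr.
  apply: le_trans (span_dist_le _ (P + Q)) _; rewrite combD opprD addrACA.
  exact: ler_normD.
rewrite le_eqVlt => /orP[/eqP <-|t0].
  rewrite scale0r mul0r; apply/eqP; rewrite eq_le; apply/andP; split.
    have := span_dist_le 0 0; rewrite sub0r normrN /comb size_poly0 big_ord0.
    by rewrite normr0.
  by apply: span_dist_ge => P.
apply/eqP; rewrite eq_le scl //=.
have := scl t^-1 (t *: v); rewrite invr_gt0 => /(_ t0).
by rewrite scalerA mulVf ?gt_eqF // scale1r ler_pdivlMl.
Qed.

Let span_dist_norm v : span_dist v <= `|v|.
Proof.
by have := span_dist_le v 0; rewrite /comb size_poly0 big_ord0 subr0.
Qed.

Let rcomb (s : seq rat) : W := comb (Poly (map ratr s)).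

Let rcomb_dense v e : span_dist v = 0 -> 0 < e -> exists s, `|v - rcomb s| < e.
Proof.
move=> v0 e0; have [P hP] : exists P, `|v - comb P| < e / 2.
  apply: contrapT => hn; have : e / 2 <= span_dist v.
    by apply: span_dist_ge => P; rewrite leNgt; apply/negP => h; apply: hn; exists P.
  by rewrite v0; lra.
pose n := size P; pose C := \sum_(i < n) `|u i| + 1.
have C0 : 0 < C by rewrite ltr_wpDl // sumr_ge0.
have /choice[r hr] : forall i, exists r : rat, `|P`_i - ratr r| < e / 2 / C.
  move=> i; have e1 : 0 < e / 2 / C by rewrite !divr_gt0.
  have [|r] := @rat_in_itvoo R (P`_i - e / 2 / C) (P`_i + e / 2 / C); first by lra.
  by rewrite in_itv /= => /andP[h1 h2]; exists r; rewrite ltr_norml; apply/andP; split; lra.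
exists (mkseq r n); rewrite -(subrK (comb P) v) -addrA [e]splitr.
apply: le_lt_trans (ler_normD _ _) _; apply: ltr_leD => //.
have sz : (size (Poly (map ratr (mkseq r n)) : {poly R}) <= n)%N.
  by apply: leq_trans (size_Poly _) _; rewrite size_map size_mkseq.
rewrite /rcomb (combE sz) (@combE n P) // -sumrB.
apply: le_trans (ler_norm_sum _ _ _) _.
apply: (@le_trans _ _ (\sum_(i < n) e / 2 / C * `|u i|)).
  apply: ler_sum => i _; rewrite -scalerBl normrZ ler_wpM2r //.
  rewrite coef_Poly (nth_map 0) ?size_mkseq // nth_mkseq //; exact/ltW/hr.
rewrite -mulr_sumr mulrAC ler_pdivrMr // ler_wpM2l ?divr_ge0 ?ltW //.
by rewrite ltrDl.
Qed.

(** Norming functionals of the rational combinations. If s lies within |z|/3 of z and its norming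
    functional kills z, then |s| < |z|/3 and so |z| < 2|z|/3. *)
Let separating : exists Phi : nat -> W -> R, (forall i, dual (Phi i)) /\
  forall z, span_dist z = 0 -> (forall i, Phi i z = 0) -> z = 0.
Proof.
have /choice[psi hpsi] := fun s : seq rat => dual_norm_functional (rcomb s).
exists (fun i => psi (odflt [::] (unpickle i))); split.
  by move=> i; have [] := hpsi (odflt [::] (unpickle i)).
move=> z z0 h; apply: contrapT => /eqP; rewrite -normr_gt0 => nz.
have [|s hs] := @rcomb_dense z (`|z| / 3) z0; first by rewrite divr_gt0.
have [ds le es] := hpsi s; have [_ [_ B _ _]] := dual_linear ds.
have := h (pickle s); rewrite pickleK /= => e.
have := le (z - rcomb s); rewrite B e sub0r normrN es normr_id.
have := ler_distD (rcomb s) z 0; rewrite !subr0; lra.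
Qed.

Let span_dist_u j : span_dist (u j) = 0.
Proof.
apply/eqP; rewrite eq_le; apply/andP; split; last by apply: span_dist_ge.
have := span_dist_le (u j) 'X^j.
rewrite (@combE j.+1) ?size_polyXn // (bigD1 ord_max) //= coefXn eqxx scale1r big1.
  by rewrite addr0 subrr normr0.
move=> i ij; rewrite coefXn.
have /negbTE -> : (i : nat) != j by apply: contra ij => /eqP e; apply/eqP/val_inj.
by rewrite scale0r.
Qed.

Let span_distN v : span_dist (- v) = span_dist v.
Proof.
have h w : span_dist (- w) <= span_dist w.
  apply: span_dist_ge => P; apply: le_trans (span_dist_le _ (-1 *: P)) _.
  by rewrite combZ scaleN1r -opprD normrN.
by apply/eqP; rewrite eq_le h /= -{1}(opprK v) h.
Qed.

(** Closed subspaces are weakly closed: a linear functional dominated by the distance vanishes on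
    all u_j and takes the value [span_dist l] at l. *)
Let span_dist_limit (U : set_system nat) (n : nat -> nat) l : ProperFilter U ->
  (forall phi, dual phi -> forall e : R, 0 < e -> U [set j | `|phi (u (n j)) - phi l| < e]) ->
  span_dist l = 0.
Proof.
move=> UP h; have [phi [lp le pl]] := hahn_banach l span_dist_sublinear.
have [_ [_ _ N _]] := linear_real lp.
have le' v : `|phi v| <= 1 * `|v|.
  rewrite mul1r ler_norml (le_trans (le v)) // andbT lerNl -N -normrN.
  exact: le_trans (le _) _.
have dp : dual phi by exact: bounded_dual le'.
have pu j : phi (u j) = 0.
  apply/eqP; rewrite eq_le; apply/andP; split; first by rewrite -(span_dist_u j).
  by rewrite -oppr_le0 -N -(span_dist_u j) -span_distN.
rewrite -pl; apply: (@ultra_limit_eq U (fun=> 0)) => // e e0.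
- by have := h _ dp e e0; apply: filterS => j /=; rewrite pu.
- by apply: (@filterS _ U _ setT) => [j _ /=|]; [rewrite subrr normr0|exact: filterT].
Qed.

(** Countably many functionals separate the closed span of the sequence, so a subsequence can be
    chosen along which all of them converge to their value at an ultrafilter limit l. Any other weak
    cluster point lies in the span and agrees with l on them, hence is l. *)
Lemma weak_subsequence : exists n : nat -> nat, {homo n : i j / (i < j)%N} /\
  exists l, weakly_cvg (u \o n) l.
Proof.
have [Phi [dPhi sep]] := separating.
have [U [UU oU]] := ultraFilterLemma (_ : ProperFilter \oo).
have UP : ProperFilter U by exact: ultra_proper.
have [l hl] := ultra_weak_limit UU uM.
have /choice[f hf] : forall kN : nat * nat, exists j, (kN.2 < j)%N /\
    forall i, (i <= kN.1)%N -> `|Phi i (u j) - Phi i l| < kN.1.+1%:R^-1.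
  move=> [k N] /=.
  have h1 : U [set j | forall i : 'I_k.+1, `|Phi i (u j) - Phi i l| < k.+1%:R^-1].
    by apply: filter_forall => i; apply: hl => //; rewrite invr_gt0.
  have h2 : U [set j | (N < j)%N] by apply: oU; exact: nbhs_infty_gt.
  have [j [/= hj Nj]] := filter_ex (filterI h1 h2).
  by exists j; split => // i ik; exact: (hj (Ordinal (ik : (i < k.+1)%N))).
pose n := fix n k := if k is k'.+1 then f (k, n k') else f (0%N, 0%N).
have n_lt : {homo n : i j / (i < j)%N}.
  apply: homo_ltn; first exact: ltn_trans.
  by move=> k /=; have [] := hf (k.+1, n k).
have n_Phi i k : (i <= k)%N -> `|Phi i (u (n k)) - Phi i l| < k.+1%:R^-1.
  by case: k => [|k] ik; [have [_] := hf (0%N, 0%N)|have [_] := hf (k.+1, n k)]; apply.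
exists n; split => //; exists l => phi dp; apply/cvgrPdist_lt => e e0.
apply: contrapT => hn; pose S k := e <= `|phi (u (n k)) - phi l|.
have Sinf N : exists2 k, (N <= k)%N & S k.
  apply: contrapT => hN; apply: hn; exists N => // k /= Nk.
  by rewrite ltNge distrC; apply/negP => Sk; apply: hN; exists k.
(* If convergence fails for [phi], an ultrafilter through the bad indices yields a weak limit l',
   which must be l although phi stays away from phi(l). *)
pose F : set_system nat := [set A | exists N, forall k, (N <= k)%N -> S k -> A k].
have PF : ProperFilter F.
  apply: Build_ProperFilter_ex => [A [N hA]|].
    by have [k Nk Sk] := Sinf N; exists k; exact: hA.
  split; first by exists 0%N.
    move=> A B [N hA] [N' hB]; exists (maxn N N') => k.
    by rewrite geq_max => /andP[h1 h2] Sk; split; [exact: hA|exact: hB].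
  by move=> A B AB [N hA]; exists N => k Nk Sk; exact/AB/hA.
have [V [VU FV]] := ultraFilterLemma PF.
have VP : ProperFilter V by exact: ultra_proper.
have [l' hl'] := ultra_weak_limit VU (fun j => uM (n j)).
have sl : span_dist l = 0 by exact: (@span_dist_limit U id).
have sl' : span_dist l' = 0 by exact: (@span_dist_limit V n).
have ll' : l = l'.
  apply/eqP; rewrite -subr_eq0; apply/eqP; apply: sep.
    apply/eqP; rewrite eq_le; apply/andP; split; last exact: span_dist_ge.
    apply: le_trans (span_dist_sublinear.1 _ _) _.
    by rewrite span_distN sl sl' addr0.
  move=> i; have [_ [_ B _ _]] := dual_linear (dPhi i); rewrite B.
  apply/eqP; rewrite subr_eq0; apply/eqP.
  apply: (@ultra_limit_eq V (fun k => Phi i (u (n k)))) => [e1 e10|]; last exact: hl'.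
  apply: FV; exists (maxn i (Num.trunc e1^-1)) => k; rewrite geq_max => /andP[ik ek] _ /=.
  apply: lt_trans (n_Phi _ _ ik) _; rewrite invf_plt ?posrE //.
  by apply: lt_le_trans (truncnS_gt _) _; rewrite ler_nat ltnS.
have V1 : V [set k | S k] by apply: FV; exists 0%N.
have [k [/= Sk]] := filter_ex (filterI V1 (hl' _ dp _ e0)).
by rewrite -ll' ltNge -/(S k) Sk.
Qed.

End Subsequence.
End WeakCompactness.

(** * Odd deformations *)

Lemma well_founded_order (T : eqType) : exists lt : T -> T -> Prop,
  (forall x y, x <> y -> lt x y \/ lt y x) /\
  forall A : set T, A !=set0 -> exists2 z, A z & forall y, lt y z -> ~ A y.
Proof.
have [r wo] := wochoice.well_ordering_principle T.
exists (fun x y => r x y /\ x <> y); split=> [x y xy|A [a Aa]].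
  have [|z [[]]] := wo [pred z | (z == x) || (z == y)]; first by exists x; rewrite inE eqxx.
  rewrite inE => /orP[/eqP->|/eqP->] h _.
    by left; split => //; apply: h; rewrite inE eqxx orbT.
  by right; split; [apply: h; rewrite inE eqxx|move=> e; exact: xy].
have [|z [[Az hz] uz]] := wo (mem A); first by exists a; exact: mem_set.
exists z; first exact: set_mem.
move=> y [yz ne] Ay; apply: ne.
have refl x : r x x.
  have [|x' [[+ h] _]] := wo [pred w | w == x]; first by exists x; rewrite inE eqxx.
  by rewrite inE => /eqP xx'; have := h x; rewrite inE eqxx xx'; exact.
have zy : r z y by apply: hz; exact: mem_set.
have [|z' [_ uz']] := wo [pred w | (w == y) || (w == z)]; first by exists y; rewrite inE eqxx.
rewrite -(uz' y); last first.
  by split=> [|x]; rewrite inE ?eqxx // => /orP[/eqP->|/eqP->].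
apply: uz'; split=> [|x]; first by rewrite inE eqxx orbT.
by rewrite inE => /orP[/eqP->|/eqP->].
Qed.

Section Descent.
Variables (R : realType) (W : normedModType R) (E : W -> R) (sg lo : R).
Hypotheses (sg_gt0 : 0 < sg) (E_even : forall u, E (- u) = E u).

(** One direction [v] serves all starting points near [y]. The bound rho <= |y| keeps the balls
    about y and -y disjoint, so that opposite directions can be used on them. *)
Definition descent (y v : W) (rho : R) := [/\ 0 < rho, rho <= `|y|, `|v| <= 1 &
  forall z, `|z - y| < rho -> forall t, 0 <= t <= rho ->
    E (z - t *: v) <= E z - sg * t /\ lo < E (z - t *: v)].

Let Y : set W := [set y | exists v rho, descent y v rho].

Let descent_neq0 y v rho : descent y v rho -> v != 0.
Proof.
move=> [r0 _ _ h]; apply/eqP => v0; have := h y; rewrite subrr normr0 => /(_ r0 rho).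
rewrite lexx ltW // v0 scaler0 subr0 => /(_ isT) [+ _].
have := mulr_gt0 sg_gt0 r0; lra.
Qed.

(* Stone's construction: the balls on which E descends have a refinement by
   countably many discrete families, indexed by [n], of sets [core n (y, b)];
   on each family one may move in a single direction per set. *)
Lemma descent_fields : exists g : nat -> W -> W,
  [/\ forall n, continuous (g n), forall n u, g n (- u) = - g n u,
      forall n u t, 0 <= t <= 1 -> E (u - t *: g n u) <= E u - sg * `|t *: g n u|,
      forall n u t, 0 <= t <= 1 -> g n u != 0 -> lo < E (u - t *: g n u) &
      forall y, Y y -> exists n, g n y != 0].
Proof.
have [lt [lt_total lt_wf]] := well_founded_order W.
have /choice[v /choice[rho hd]] : forall y, exists v rho, Y y -> descent y v rho.
  move=> y; have [[v [rho h]]|nY] := pselect (Y y); last by exists 0, 0.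
  by exists v, rho.
pose sgn (b : bool) (x : W) := if b then - x else x.
have sgnN b x : sgn b (- x) = sgn (~~ b) x by case: b; rewrite /= ?opprK.
pose near_ y x := `|x - y| < rho y \/ `|x + y| < rho y.
pose e n : R := n.+1%:R^-1.
have e0 n : 0 < e n by rewrite invr_gt0.
(* Points at depth [e n] in the ball of y (or of -y, according to the sign) that lie in no ball of
   an earlier centre. Cores with different labels and the same n are at least [e n] apart. *)
pose core n (p : W * bool) (x : W) := [/\ Y p.1, `|sgn p.2 x - p.1| + e n <= rho p.1 &
  forall y', Y y' -> lt y' p.1 -> ~ near_ y' x].
have sgn_near n p x x' : core n p x -> `|x - x'| < e n -> `|sgn p.2 x' - p.1| < rho p.1.
  move=> [_ h _] xx'; have := ler_distD (sgn p.2 x) (sgn p.2 x') p.1.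
  have : `|sgn p.2 x' - sgn p.2 x| = `|x - x'|.
    by rewrite /sgn; case: ifP => _; [rewrite opprK addrC|rewrite distrC].
  lra.
have near_sgn n p x x' : core n p x -> `|x - x'| < e n -> near_ p.1 x'.
  move=> c /(sgn_near _ _ _ _ c); rewrite /sgn /near_; case: ifP => _; last by left.
  by rewrite -opprD normrN; right.
have core_sep n p p' x x' : core n p x -> core n p' x' -> `|x - x'| < e n -> p = p'.
  case: p p' => [y b] [y' b'] c c' xx'.
  have x'x : `|x' - x| < e n by rewrite distrC.
  have yy' : y = y'.
    apply: contrapT => /lt_total[l|l].
      by have [_ _ /(_ y (let: And3 h _ _ := c in h) l)] := c'; apply; exact: near_sgn c xx'.
    by have [_ _ /(_ y' (let: And3 h _ _ := c' in h) l)] := c; apply; exact: near_sgn c' x'x.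
  congr (_, _) => //; apply/eqP/negPn/negP => bb'.
  have h1 := sgn_near _ _ _ _ c xx'; have [/= Yy' h2 _] := c'.
  have [r0 ry _ _] := hd _ Yy'; rewrite yy' /= in h1.
  have e2 : sgn b x' = - sgn b' x' by move: bb'; rewrite /sgn; case: (b); case: (b'); rewrite //= opprK.
  have := ler_normD (sgn b x' - y') (sgn b' x' - y').
  have -> : sgn b x' - y' + (sgn b' x' - y') = - (y' *+ 2).
    by rewrite e2 addrACA addNr add0r mulr2n opprD.
  rewrite normrN normrMn mulr2n; have := e0 n; lra.
(* A tent of height [e n / 3] over the core; 0 is adjoined for empty cores. Supports of different
   tents keep a distance, so at each point at most one direction is active. *)
pose amp n p x := sup [set a | a = 0 \/ exists2 x', core n p x' & a = e n / 3 - `|x - x'|].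
have amp_ub n p x : has_ubound [set a | a = 0 \/ exists2 x', core n p x' & a = e n / 3 - `|x - x'|].
  exists (e n / 3) => a [->|[x' _ ->]]; first by rewrite divr_ge0 // ltW.
  by rewrite gerBl.
have amp_ge n p x x' : core n p x' -> e n / 3 - `|x - x'| <= amp n p x.
  by move=> c; apply: ub_le_sup; [exact: amp_ub|right; exists x'].
have amp_ge0 n p x : 0 <= amp n p x by apply: ub_le_sup; [exact: amp_ub|left].
have amp_le n p x a : 0 <= a -> (forall x', core n p x' -> e n / 3 - `|x - x'| <= a) -> amp n p x <= a.
  by move=> a0 h; apply: ge_sup => [|_ [->|[x' c ->]]]; [exists 0; left|by []|exact: h].
have amp_lip n p x z : amp n p x <= amp n p z + `|x - z|.
  apply: amp_le => [|x' c]; first by rewrite addr_ge0.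
  by have := amp_ge n p z x' c; have := ler_distD x z x'; rewrite (distrC z x); lra.
have amp_pos n p x : 0 < amp n p x -> exists2 x', core n p x' & `|x - x'| < e n / 3.
  move=> h; apply: contrapT => hn; have : amp n p x <= 0.
    apply: amp_le => // x' c; rewrite subr_le0 leNgt; apply/negP => l.
    by apply: hn; exists x'.
  by rewrite leNgt h.
have amp_uniq n p p' x z : 0 < amp n p x -> 0 < amp n p' z -> `|x - z| < e n / 3 -> p = p'.
  move=> /amp_pos[x' c xx'] /amp_pos[z' c' zz'] xz; apply: (core_sep n p p' x' z') => //.
  have := ler_distD x x' z'; have := ler_distD z x z'; rewrite (distrC x' x); lra.
have amp_e n p x : amp n p x <= e n / 3.
  by apply: amp_le => [|x' _]; [rewrite divr_ge0 // ltW|rewrite gerBl].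
have amp_small n p x : 0 < amp n p x -> [/\ Y p.1, `|sgn p.2 x - p.1| < rho p.1 & amp n p x <= rho p.1].
  move=> /amp_pos[x' c xx']; have [Yp h _] := c; split => //.
    by apply: (sgn_near n p x' x) => //; rewrite distrC; have := e0 n; lra.
  have := amp_e n p x; have := e0 n; have := normr_ge0 (sgn p.2 x' - p.1); lra.
pose g n x := if pselect (exists p, 0 < amp n p x) is left h
  then let p := projT1 (cid h) in amp n p x *: sgn p.2 (v p.1) else 0.
have gE n p x : 0 < amp n p x -> g n x = amp n p x *: sgn p.2 (v p.1).
  move=> h; rewrite /g; case: pselect => [h'|]; last by case; exists p.
  case: cid => p' /= h2; have -> // : p' = p.
  by apply: (amp_uniq n p' p x x) => //; rewrite subrr normr0 divr_gt0.
have g0 n x : (forall p, ~ 0 < amp n p x) -> g n x = 0.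
  by move=> h; rewrite /g; case: pselect => // -[p hp]; case: (h p).
have v1 p x n : 0 < amp n p x -> `|sgn p.2 (v p.1)| <= 1.
  move=> /amp_small[Yp _ _]; have [_ _ h _] := hd _ Yp.
  by rewrite /sgn; case: ifP => _; rewrite ?normrN.
have g_le n p x : 0 < amp n p x -> `|g n x| <= amp n p x.
  by move=> h; rewrite (gE n p) // normrZ ger0_norm // ler_piMr // (v1 _ x n).
have E_sgn b x : E (sgn b x) = E x by rewrite /sgn; case: ifP.
have step n u t p : 0 < amp n p u -> 0 <= t <= 1 ->
    E (u - t *: g n u) <= E u - sg * (t * amp n p u) /\ lo < E (u - t *: g n u).
  move=> hp /andP[t0 t1]; have [Yp h ar] := amp_small n p u hp.
  have [_ _ _ hE] := hd _ Yp; rewrite (gE n p u hp) -(E_sgn p.2 u).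
  rewrite -(E_sgn p.2 (u - _)).
  have -> : sgn p.2 (u - t *: (amp n p u *: sgn p.2 (v p.1))) =
      sgn p.2 u - (t * amp n p u) *: v p.1.
    rewrite scalerA /sgn; case: (p.2) => //.
    by rewrite scalerN opprK opprD.
  apply: hE => //; rewrite mulr_ge0 //=; apply: le_trans ar.
  by rewrite ler_piMl.
(* The antipode exchanges the cores of the two signs of a centre; this makes [g n] odd. *)
have ampN n p x : amp n (p.1, ~~ p.2) (- x) = amp n p x.
  have h q z : amp n (q.1, ~~ q.2) (- z) <= amp n q z.
    apply: amp_le => // x' [/= Yq hq hn].
    have -> : `|- z - x'| = `|z - (- x')| by rewrite opprK -opprD normrN.
    apply: amp_ge; split => //; first by rewrite sgnN.
    move=> y' Yy' l nr; apply: (hn y' Yy' l); move: nr; rewrite /near_.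
    by rewrite -opprD normrN => -[]; [right|left]; rewrite // -normrN opprB addrC.
  apply/eqP; rewrite eq_le h /=.
  by have := h (p.1, ~~ p.2) (- x); rewrite /= negbK opprK -surjective_pairing.
exists g; split.
- move=> n x; apply/cvgrPdist_lt => d d0; apply/nbhs_ballP.
  exists (Num.min d (e n / 3)); first by rewrite /= lt_min d0 divr_gt0.
  move=> z; rewrite -ball_normE /= lt_min => /andP[xzd xze].
  apply: le_lt_trans xzd.
  have [[p hp]|nx] := pselect (exists p, 0 < amp n p x).
    have [[p' hp']|nz] := pselect (exists p, 0 < amp n p z).
      have pp' := amp_uniq n p p' x z hp hp' xze; rewrite -pp' in hp'.
      rewrite (gE n p x) // (gE n p z) // -scalerBl normrZ.
      apply: le_trans (_ : `|amp n p x - amp n p z| <= _).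
        by rewrite ler_piMr // (v1 _ x n).
      rewrite ler_norml; have := amp_lip n p x z; have := amp_lip n p z x.
      by rewrite (distrC z x) => ? ?; apply/andP; split; lra.
    rewrite (g0 n z) ?subr0; last by move=> q hq; apply: nz; exists q.
    apply: le_trans (g_le n p x hp) _.
    have : amp n p z <= 0 by rewrite leNgt; apply/negP => hq; apply: nz; exists p.
    by have := amp_lip n p x z; lra.
  rewrite (g0 n x) ?sub0r ?normrN; last by move=> q hq; apply: nx; exists q.
  have [[p' hp']|nz] := pselect (exists p, 0 < amp n p z); last first.
    by rewrite (g0 n z) ?normr0 // => q hq; apply: nz; exists q.
  apply: le_trans (g_le n p' z hp') _.
  have : amp n p' x <= 0 by rewrite leNgt; apply/negP => hq; apply: nx; exists p'.
  by have := amp_lip n p' z x; rewrite (distrC z x); lra.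
- move=> n x; have [[p hp]|nx] := pselect (exists p, 0 < amp n p x).
    rewrite (gE n p x) // (gE n (p.1, ~~ p.2) (- x)) ?ampN //= -scalerN.
    by congr (_ *: _); rewrite /sgn; case: p.2; rewrite /= ?opprK.
  rewrite (g0 n x) ?oppr0 ?(g0 n) // => p hp; apply: nx.
  by exists (p.1, ~~ p.2); rewrite -[x]opprK ampN.
  by exists p.
- move=> n u t t01; have [[p hp]|nx] := pselect (exists p, 0 < amp n p u); last first.
    by rewrite g0 ?scaler0 ?normr0 ?mulr0 ?subr0 // => p hp; apply: nx; exists p.
  have [h1 h2] := step n u t p hp t01; apply: le_trans h1 _.
  rewrite lerD2l lerN2 ler_pM2l // normrZ ger0_norm; last by case/andP: t01.
  by rewrite ler_wpM2l ?g_le //; case/andP: t01.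
- move=> n u t t01 gn0; have [[p hp]|nx] := pselect (exists p, 0 < amp n p u).
    by have [_ ] := step n u t p hp t01.
  by move: gn0; rewrite g0 ?eqxx // => p hp; apply: nx; exists p.
(* Take the first centre whose ball, up to sign, contains y; once [e n] is below the remaining
   depth, y lies in its core. *)
- move=> y Yy; have [|y0 [Yy0 ny0] ymin] := lt_wf [set y' | Y y' /\ near_ y' y].
    by exists y; split => //; left; rewrite subrr normr0; have [] := hd _ Yy.
  have [b hb] : exists b, `|sgn b y - y0| < rho y0.
    case: ny0 => h; [by exists false|exists true].
    by rewrite /= -opprD normrN.
  pose n := Num.trunc (rho y0 - `|sgn b y - y0|)^-1.
  have en : e n < rho y0 - `|sgn b y - y0|.
    by rewrite /e invf_plt ?posrE ?subr_gt0 // truncnS_gt.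
  have c : core n (y0, b) y.
    split => //=; first by rewrite -lerBrDl ltW.
    by move=> y' Yy' l nr; apply: (ymin y' l).
  exists n; have hp : 0 < amp n (y0, b) y.
    apply: lt_le_trans (amp_ge n _ y y c); rewrite subrr normr0 subr0.
    by rewrite divr_gt0.
  rewrite (gE n _ _ hp) scaler_eq0 gt_eqF //= /sgn.
  have := descent_neq0 (hd _ Yy0); case: (b) => //=.
  by rewrite oppr_eq0.
Qed.

End Descent.

Section Deformation.
Variables (R : realType) (W : completeNormedModType R) (E : W -> R) (sg lo b hi r : R).
Hypotheses (sg_gt0 : 0 < sg) (E_even : forall u, E (- u) = E u).
(** Falling from [hi] to [lo] at rate [sg] takes a displacement of less than [r]. *)
Hypotheses (lo_b : lo < b) (hi_r : hi - lo < sg * r) (r_ge0 : 0 <= r).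

Section Orbits.
Variable g : nat -> W -> W.
Hypotheses (g_cont : forall n, continuous (g n)) (gN : forall n u, g n (- u) = - g n u)
  (g_desc : forall n u t, 0 <= t <= 1 -> E (u - t *: g n u) <= E u - sg * `|t *: g n u|)
  (g_lo : forall n u t, 0 <= t <= 1 -> g n u != 0 -> lo < E (u - t *: g n u)).

(** The 2-adic valuation of k + 1 takes every value infinitely often, so each field recurs; the
    factor [tau] allows a step to be shortened. *)
Fixpoint orbit (tau : nat -> W -> R) (k : nat) (u : W) : W :=
  if k is k'.+1 then
    let y := orbit tau k' u in y - tau k' u *: g (logn 2 k'.+1) y
  else u.

Lemma orbitN tau k u : (forall j, tau j (- u) = tau j u) ->
  orbit tau k (- u) = - orbit tau k u.
Proof.
by move=> tauN; elim: k => //= k ->; rewrite gN tauN scalerN opprB opprK addrC.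
Qed.

Lemma orbit_decr tau u : (forall j, 0 <= tau j u <= 1) ->
  {homo E \o orbit tau ^~ u : j k / (j <= k)%N >-> k <= j}.
Proof.
move=> t01; apply: (@homo_leq _ (E \o orbit tau ^~ u) (fun x y => y <= x)) => //.
  by move=> x y z h1 h2; exact: le_trans h2 h1.
move=> k /=; apply: le_trans (g_desc _ _ (t01 k)) _.
by rewrite gerBl mulr_ge0 // ltW.
Qed.

(** Every step that moves ends above [lo], so the total displacement is at most (hi - lo)/sg. *)
Lemma orbit_near tau u k : (forall j, 0 <= tau j u <= 1) -> E u < hi ->
  `|orbit tau k u - u| <= r.
Proof.
move=> t01 Eu; have h j : sg * `|orbit tau j u - u| <= E u - E (orbit tau j u).
  elim: j => [|j IH] /=; first by rewrite !subrr normr0 mulr0.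
  set y := orbit tau j u in IH *; set z := tau j u *: _.
  have := g_desc (logn 2 j.+1) y (t01 j); rewrite -/z => h1.
  have h2 : sg * `|y - z - u| <= sg * (`|y - u| + `|z|).
    by rewrite ler_pM2l // addrAC; exact: ler_normB.
  rewrite mulrDr in h2; lra.
have lo_or j : orbit tau j u = u \/ lo < E (orbit tau j u).
  elim: j => [|j IH]; [by left|rewrite /=].
  set y := orbit tau j u in IH *.
  have [->|gy] := eqVneq (g (logn 2 j.+1) y) 0; first by rewrite scaler0 subr0.
  by right; exact: g_lo.
have [->|l] := lo_or k; first by rewrite subrr normr0.
by rewrite -(ler_pM2l sg_gt0); have := h k; have := hi_r; lra.
Qed.

Lemma orbit_cont tau k u : (forall j, {for u, continuous (tau j)}) ->
  {for u, continuous (orbit tau k)}.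
Proof.
move=> ct; elim: k => [|k IH] /=; first exact: cvg_id.
apply: cvgB; first exact: IH.
apply: cvgZ; first exact: ct.
exact: (@continuous_cvg _ _ _ _ _ (orbit tau k) (g _) _ (@g_cont _ _) IH).
Qed.

Let flow := orbit (fun _ _ => 1).

Let b' := (lo + b) / 2.

(** Otherwise the steps are summable and the orbit converges, by completeness, to a point with level
    between [lo] and [hi]. Some field is nonzero there, but it recurs infinitely often with steps
    that tend to 0. *)
Lemma orbit_escape u : E u < hi ->
  (forall y, `|y - u| <= r -> {for y, continuous E} /\
    (lo < E y < hi -> exists n, g n y != 0)) ->
  exists k, E (flow k u) < b'.
Proof.
move=> Eu hE; apply: contrapT => nk.
have ge k : b' <= E (flow k u) by rewrite leNgt; apply/negP => h; apply: nk; exists k.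
have t01 : 0 <= (1 : R) <= 1 by rewrite ler01 lexx.
pose d := telescope (flow ^~ u).
have dE k : d k = - g (logn 2 k.+1) (flow k u).
  by rewrite /d /telescope /flow /= scale1r addrAC subrr add0r.
have d_le k : sg * `|d k| <= E (flow k u) - E (flow k.+1 u).
  rewrite dE normrN; have := g_desc (logn 2 k.+1) (flow k u) t01.
  by rewrite /flow /= !scale1r; lra.
have sd k : sg * [normed series d] k <= E u - E (flow k u).
  elim: k => [|k IH]; first by rewrite /= /series /= big_nil mulr0 subrr.
  rewrite /= /series /= big_nat_recr //= mulrDr; have := d_le k.
  move: IH; rewrite /= /series /=; lra.
have cs : cvgn [normed series d].
  apply: nondecreasing_is_cvgn.
    apply: homo_leq => // [x y z|k]; first exact: le_trans.
    by rewrite /= /series /= big_nat_recr //= lerDl.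
  exists ((hi - b') / sg) => _ [k _ <-]; rewrite ler_pdivlMr // mulrC.
  by have := sd k; have := ge k; lra.
have cd := normed_cvg cs.
pose y := u + limn (series d).
have cy : flow k u @[k --> \oo] --> y.
  have -> : flow ^~ u = fun k => u + series d k.
    by apply/funext => k; rewrite -(eq_sum_telescope (flow ^~ u)).
  by apply: cvgD; [exact: cvg_cst|exact: cd].
have yr : `|y - u| <= r.
  have c : `|flow k u - u| @[k --> \oo] --> `|y - u|.
    by apply: cvg_norm; apply: cvgB => //; exact: cvg_cst.
  rewrite -(cvg_lim _ c) //; apply: limr_le; first by apply/cvg_ex; exists `|y - u|.
  by near=> k; exact: orbit_near.
have [cE hy] := hE _ yr.
have cEy : E (flow k u) @[k --> \oo] --> E y by exact: (@continuous_cvg _ _ _ _ _ (flow ^~ u) E _ cE cy).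
have Ey : lo < E y < hi.
  have isc : cvgn (fun k => E (flow k u)) by apply/cvg_ex; exists (E y).
  rewrite -(cvg_lim _ cEy) //; apply/andP; split.
    apply: (@lt_le_trans _ _ b'); first by rewrite /b'; have := lo_b; lra.
    by apply: limr_ge => //; near=> k; exact: ge.
  apply: le_lt_trans Eu; apply: limr_le => //; near=> k.
  exact: (orbit_decr (fun=> t01) (leq0n k)).
have [n gn] := hy Ey.
have cg : g n (flow k u) @[k --> \oo] --> g n y by exact: (@continuous_cvg _ _ _ _ _ (flow ^~ u) (g n) _ (@g_cont n _) cy).
have e0 : 0 < `|g n y| / 2 by rewrite divr_gt0 // normr_gt0.
have /cvgrPdist_lt /(_ _ e0) [N1 _ h1] := cg.
have /cvgrPdist_lt /(_ _ e0) [N2 _ h2] := cvg_series_cvg_0 cd.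
(* k + 1 = 2^n (2m + 1): an arbitrarily late step that uses field n. *)
pose m := (N1 + N2)%N; pose k := (2 ^ n * m.*2.+1).-1.
have k1 : k.+1 = (2 ^ n * m.*2.+1)%N by rewrite prednK // muln_gt0 expn_gt0.
have mk : (m <= k)%N.
  rewrite -ltnS k1; apply: (@leq_trans (1 * m.*2.+1)); first by rewrite mul1n ltnS -addnn leq_addr.
  by rewrite leq_mul2r expn_gt0 orbT.
have lk : logn 2 k.+1 = n.
  rewrite k1 lognM // ?expn_gt0 // pfactorK // lognE /=.
  by rewrite dvdn2 /= odd_double addn0.
have := h1 k (leq_trans (leq_addr _ _) mk); have := h2 k (leq_trans (leq_addl _ _) mk).
rewrite /= sub0r normrN dE normrN lk.
have := ler_distD (g n (flow k u)) (g n y) 0; rewrite !subr0; lra.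
Unshelve. all: by end_near.
Qed.

(** Steps are faded out between the levels b and b' of the unstopped orbit. The stopped orbit is
    thus constant once the unstopped one is below b', and the infinite composition is locally
    finite. *)
Let theta k u := Num.max 0 (Num.min 1 ((E (flow k u) - b') / (b - b'))).

Let b'_b : b' < b. Proof. by rewrite /b'; have := lo_b; lra. Qed.

Let theta01 u j : 0 <= theta j u <= 1.
Proof. by rewrite /theta le_max lexx /= ge_max ler01 /= ge_min lexx. Qed.

Let theta0 u j : E (flow j u) <= b' -> theta j u = 0.
Proof.
move=> h; have : (E (flow j u) - b') / (b - b') <= 0.
  by rewrite pmulr_lle0 ?subr_le0 // invr_gt0 subr_gt0.
by move=> h'; apply/max_idPl; rewrite ge_min h' orbT.
Qed.

Let theta1 u j : b <= E (flow j u) -> theta j u = 1.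
Proof.
move=> h; have : 1 <= (E (flow j u) - b') / (b - b').
  by rewrite ler_pdivlMr ?subr_gt0 // mul1r lerD2r.
by rewrite /theta => /min_idPl ->; exact/max_idPr.
Qed.

Let flowN k u : flow k (- u) = - flow k u.
Proof. exact: orbitN. Qed.

Let thetaN k u : theta k (- u) = theta k u.
Proof. by rewrite /theta flowN E_even. Qed.

Let stopped := orbit theta.

Let stopped_stable u j k : (j <= k)%N -> E (flow j u) < b' -> stopped k u = stopped j u.
Proof.
move=> jk Ej; elim: k jk => [|k IH]; first by rewrite leqn0 => /eqP ->.
rewrite leq_eqVlt => /orP[/eqP <- //|jk].
rewrite /stopped /= -/stopped theta0 ?scale0r ?subr0 ?IH //.
apply: le_trans (ltW Ej).
have t01 : 0 <= (1 : R) <= 1 by rewrite ler01 lexx.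
exact: (@orbit_decr (fun _ _ => 1) u (fun=> t01) j k jk).
Qed.

(** The two orbits coincide while the level is at least b; from the first time below b the stopped
    one can only descend further. *)
Let stopped_low u k : E (flow k u) < b' -> E (stopped k u) < b.
Proof.
move=> Ek; have [->|//] : stopped k u = flow k u \/ E (stopped k u) < b.
  elim: k {Ek} => [|k IH]; first by left.
  have dec : E (stopped k.+1 u) <= E (stopped k u).
    exact: (orbit_decr (theta01 u) (leqnSn k)).
  case: IH => [e|h]; last by right; exact: le_lt_trans h.
  have [Eb|Eb] := leP b (E (flow k u)); last by right; apply: le_lt_trans dec _; rewrite e.
  by left; rewrite /stopped /= -/stopped e theta1.
exact: lt_trans b'_b.
Qed.

Let deformed u := if pselect (exists k, E (flow k u) < b') is left h
  then stopped (projT1 (cid h)) u else u.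

Let deformedE u k : E (flow k u) < b' -> deformed u = stopped k u.
Proof.
move=> h; rewrite /deformed; case: pselect => [h'|]; last by case; exists k.
case: cid => j /= hj; have [jk|/ltnW kj] := leqP j k.
  by rewrite -(stopped_stable jk hj).
by rewrite (stopped_stable kj h).
Qed.

Lemma orbit_deformation (D : set W) :
  (forall u, D u -> E u < hi /\ forall y, `|y - u| <= r -> {for y, continuous E} /\
    (lo < E y < hi -> exists n, g n y != 0)) ->
  exists eta : W -> W, forall u, D u ->
    [/\ {for u, continuous eta}, eta (- u) = - eta u, E (eta u) < b & `|eta u - u| <= r].
Proof.
move=> hD; exists deformed => u Du; have [Eu hE] := hD u Du.
have [k hk] := orbit_escape Eu hE.
have cf j : {for u, continuous (flow j)} by apply: orbit_cont => i; exact: cvg_cst.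
have cE j : {for u, continuous (fun z => E (flow j z))}.
  apply: (@continuous_cvg _ _ _ _ _ (flow j) E (flow j u)) (cf j).
  by have [] := hE (flow j u) (orbit_near j (fun=> (_ : 0 <= 1 <= 1)) Eu); rewrite ?ler01 ?lexx.
have ct j : {for u, continuous (theta j)}.
  have c1 : {for u, continuous (fun z => (E (flow j z) - b') / (b - b'))}.
    apply: cvgM; last exact: cvg_cst.
    by apply: cvgB; [exact: cE|exact: cvg_cst].
  have c2 : {for u, continuous (fun z => Num.min 1 ((E (flow j z) - b') / (b - b')))}.
    by apply: (@continuous_min _ _ (fun=> 1)) c1; exact: cvg_cst.
  by apply: (@continuous_max _ _ (fun=> 0)) c2; exact: cvg_cst.
rewrite (deformedE hk); split.
(* The same k works near u, so there the deformation is a finite composition of continuous steps. *)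
- rewrite /prop_for /continuous_at (deformedE hk).
  have : \forall z \near u, stopped k z = deformed z.
    have : \forall z \near u, E (flow k z) < b' by exact: (cvgr_lt _ (cE k)).
    by apply: filterS => z hz; rewrite (deformedE hz).
  by move=> /near_eq_cvg h; move=> A nA; apply: h; exact: (@orbit_cont theta k u ct A nA).
- rewrite (@deformedE (- u) k) ?flowN ?E_even //.
  by apply: orbitN => j; exact: thetaN.
- exact: stopped_low.
- exact: orbit_near.
Qed.

End Orbits.

Lemma deformation (D : set W) :
  (forall u, D u -> E u < hi /\ forall y, `|y - u| <= r -> {for y, continuous E} /\
    (lo < E y < hi -> exists v rho, descent E sg lo y v rho)) ->
  exists eta : W -> W, forall u, D u ->
    [/\ {for u, continuous eta}, eta (- u) = - eta u, E (eta u) < b & `|eta u - u| <= r].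
Proof.
have [g [g1 g2 g3 g4 g5]] := descent_fields lo sg_gt0 E_even.
move=> hD; apply: (@orbit_deformation g) => // u Du; have [Eu hy] := hD u Du.
split=> // y yu; have [cE h] := hy y yu; split => // /h; exact: g5.
Qed.

End Deformation.

(** * Potentials *)

Section Line.
Variables (R : realType) (W : normedModType R).

Lemma is_derive_line (P : W -> R) (L : W -> W -> R) (w v : W) (t : R) :
  is_diff (w + t *: v) (P : W -> R^o) (L (w + t *: v)) ->
  is_derive t 1 (fun t => P (w + t *: v)) (L (w + t *: v) v).
Proof.
move=> dP; have df := @ex_diff _ _ _ _ _ _ _ dP.
have eq : (fun h : R => h^-1 *: (((fun t => P (w + t *: v) : R^o) \o shift t) (h *: 1) - P (w + t *: v))) =
  (fun h : R => h^-1 *: (((P : W -> R^o) \o shift (w + t *: v)) (h *: v) - P (w + t *: v))).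
  apply/funext => h /=; congr (_ *: (P _ - _)).
  by rewrite -[h%:A]/(h * 1) mulr1 scalerDl addrCA.
apply: DeriveDef; first by rewrite /derivable eq; exact: diff_derivable.
have := @deriveE _ _ _ _ _ v df; rewrite diff_val /derive => <-.
by rewrite eq.
Qed.

Lemma line_continuous (w v : W) : continuous (fun t : R => w + t *: v).
Proof.
by move=> t; apply: cvgD; [exact: cvg_cst|apply: cvgZr_tmp; exact: cvg_id].
Qed.

Lemma mvt_line (P : W -> R) (L : W -> W -> R) (w v : W) :
  (forall t, 0 <= t <= 1 -> is_diff (w + t *: v) (P : W -> R^o) (L (w + t *: v))) ->
  exists2 t, 0 < t < 1 & P (w + v) - P w = L (w + t *: v) v.
Proof.
move=> dP; have [||t] := @MVT R (fun t => P (w + t *: v)) (fun t => L (w + t *: v) v) 0 1 ltr01.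
- move=> t; rewrite in_itv /= => /andP[t0 t1]; apply: is_derive_line; apply: dP.
  by rewrite !ltW.
- apply: continuous_in_subspaceT => t; rewrite inE /= in_itv /= => t01.
  apply: (@continuous_cvg _ _ _ _ _ (fun t => w + t *: v) P); last exact: line_continuous.
  exact/differentiable_continuous/(@ex_diff _ _ _ _ _ _ _ (dP t t01)).
rewrite in_itv /= => t01; rewrite scale1r scale0r addr0 subr0 mulr1 => e.
by exists t.
Qed.

End Line.

Section Potential.
Variables (R : realType) (W : normedModType R) (p : W -> W -> R).
Hypothesis p_pot : potential_operator p.

Lemma pot_dual u : dual (p u). Proof. by have [] := p_pot. Qed.

Lemma pot_continuous v : continuous (p ^~ v).
Proof.
move=> u; have [dp cp _] := p_pot; apply/cvgrPdist_lt => e e0.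
have e1 : 0 < e / (`|v| + 1) by rewrite divr_gt0 // ltr_wpDl.
have /cvgrPdist_lt /(_ _ e1) := cp u.
apply: filterS => z; rewrite sub0r normrN => h.
have := dual_le v (dualB (dp z) (dp u)) => /= h1; rewrite distrC; apply: le_lt_trans h1 _.
move: h; rewrite ger0_norm ?dual_norm_ge0 //; last exact: dualB.
rewrite ltr_pdivlMr ?ltr_wpDl // => h; apply: le_lt_trans h.
by rewrite ler_wpM2l ?dual_norm_ge0 ?lerDl //; exact: dualB.
Qed.

Lemma potentialE (P : W -> R) u : (forall u, is_diff u (P : W -> R^o) (p u)) ->
  potential p u = P u - P 0.
Proof.
move=> dP; have cl : continuous (fun t : R => 0 + t *: u) by exact: line_continuous.
have dl (t : R) : is_derive t 1 (fun t => P (0 + t *: u)) (p (0 + t *: u) u).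
  by apply: is_derive_line; exact: dP.
have cP : continuous (fun t : R => P (0 + t *: u) : R^o).
  move=> t; apply: (@continuous_cvg _ _ _ _ _ (fun t => 0 + t *: u) P); last exact: cl.
  exact/differentiable_continuous/(@ex_diff _ _ _ _ _ _ _ (dP _)).
have -> : P u - P 0 = P (0 + 1 *: u) - P (0 + 0 *: u) by rewrite scale1r scale0r !add0r.
rewrite /potential /Rintegral.
rewrite (@continuous_FTC2 _ _ (fun t => P (0 + t *: u)) 0 1 ltr01) //=.
- apply: continuous_subspaceT => t.
  apply: (@continuous_cvg _ _ _ _ _ (fun t => t *: u) (p ^~ u)); first exact: pot_continuous.
  by apply: cvgZr_tmp; exact: cvg_id.
- split; first by move=> t _; exact: (@ex_derive _ _ _ _ _ _ _ (dl t)).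
    by apply: cvg_at_right_filter; exact: cP.
  by apply: cvg_at_left_filter; exact: cP.
- move=> t _; rewrite derive1E (@derive_val _ _ _ _ _ _ _ (dl t)).
  by rewrite add0r.
Qed.

Lemma potential_diff u : is_diff u (potential p : W -> R^o) (p u).
Proof.
have [_ _ [P dP]] := p_pot.
have -> : (potential p : W -> R^o) = P - cst (P 0) by apply/funext => v; exact: potentialE.
apply: is_diff_eq; apply/funext => v /=.
by rewrite /GRing.add /= /GRing.opp /= subr0.
Qed.

Lemma potential_continuous : continuous (potential p).
Proof. by move=> u; exact/differentiable_continuous/(@ex_diff _ _ _ _ _ _ _ (potential_diff u)). Qed.

Lemma potential0 : potential p 0 = 0.
Proof. by have [_ _ [P dP]] := p_pot; rewrite (potentialE _ dP) subrr. Qed.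

Lemma potential_mvt u v : exists2 t, 0 < t < 1 &
  potential p u - potential p v = p (v + t *: (u - v)) (u - v).
Proof.
have [|t t01] := @mvt_line _ _ (potential p) p v (u - v).
  by move=> t _; exact: potential_diff.
by rewrite subrKC; exists t.
Qed.

Lemma potentialN u : odd_operator p -> potential p (- u) = potential p u.
Proof.
move=> po; apply: eq_Rintegral => t _; rewrite scalerN po.
by have [_ [_ _ N _]] := dual_linear (pot_dual (t *: u)); rewrite N opprK.
Qed.

Lemma potential_gt0 u : (forall u, u != 0 -> 0 < p u u) -> u != 0 -> 0 < potential p u.
Proof.
move=> pp u0; have [t /andP[t0 t1]] := potential_mvt u 0.
rewrite potential0 !subr0 add0r => ->.
have := pp (t *: u); rewrite scaler_eq0 (gt_eqF t0) (negbTE u0) => /(_ isT).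
by have [-> _] := dual_linear (pot_dual (t *: u)); rewrite pmulr_rgt0.
Qed.

Lemma potential_lipschitz M : bounded_operator p -> exists C, forall u v,
  `|u| <= M -> `|v| <= M -> `|potential p u - potential p v| <= C * `|u - v|.
Proof.
move=> bp; have [C hC] := bp M; exists C => u v uM vM.
have [t /andP[t0 t1] ->] := potential_mvt u v.
apply: le_trans (dual_le _ (pot_dual _)) _; apply: ler_wpM2r => //; apply: hC.
have -> : v + t *: (u - v) = (1 - t) *: v + t *: u.
  by rewrite scalerBr scalerBl scale1r -addrA [- _ + _]addrC.
apply: le_trans (ler_normD _ _) _; rewrite !normrZ (gtr0_norm t0) gtr0_norm ?subr_gt0 //.
have := ler_wpM2l (ltW t0) uM; have : (1 - t) * `|v| <= (1 - t) * M.
  by rewrite ler_wpM2l // subr_ge0 ltW.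
lra.
Qed.

(** Norm convergence of the functionals allows p(w_j) to be replaced by p(l), which is then paired
    with a weakly null sequence. *)
Lemma weak_pairing (w u : nat -> W) l M : weak_to_strong p -> weakly_cvg w l ->
  (forall j, `|u j| <= M) -> weakly_cvg u l -> p (w j) (u j - l) @[j --> \oo] --> (0 : R).
Proof.
move=> wp wl uM ul.
have pw : dual_norm (p (w j) \- p l) @[j --> \oo] --> (0 : R) by exact: wp.
have Ml j : `|u j - l| <= M + `|l| by apply: le_trans (ler_normB _ _) _; rewrite lerD2r.
have pl : p l (u j - l) @[j --> \oo] --> (0 : R).
  have [_ [_ B _ _]] := dual_linear (pot_dual l).
  under eq_fun do rewrite B.
  by rewrite -(subrr (p l l)); apply: cvgB; [exact: (ul _ (pot_dual l))|exact: cvg_cst].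
apply/cvgrPdist_lt => e e0; have e2 : 0 < e / 2 by rewrite divr_gt0.
have M1 : 0 < M + `|l| + 1.
  by rewrite ltr_wpDl // addr_ge0 //; exact: le_trans (uM 0%N).
have e3 : 0 < e / 2 / (M + `|l| + 1) by rewrite divr_gt0.
have /cvgrPdist_lt /(_ _ e2) h1 := pl; have /cvgrPdist_lt /(_ _ e3) h2 := pw.
apply: filterS (filterI h1 h2) => j []; rewrite !sub0r !normrN => h3.
have dB := dualB (pot_dual (w j)) (pot_dual l).
rewrite ger0_norm ?dual_norm_ge0 // ltr_pdivlMr // => h4.
have := dual_le (u j - l) dB; rewrite /= => h5.
have h6 : dual_norm (p (w j) \- p l) * `|u j - l| <= dual_norm (p (w j) \- p l) * (M + `|l| + 1).
  by rewrite ler_wpM2l ?dual_norm_ge0 //; have := Ml j; lra.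
have := ler_distD (p l (u j - l)) (p (w j) (u j - l)) 0; rewrite !subr0; lra.
Qed.

(** The mean value points between l and u_j also converge weakly to l, so [weak_pairing] applies to
    the increment. *)
Lemma potential_weak_continuous (u : nat -> W) l M : weak_to_strong p ->
  (forall j, `|u j| <= M) -> weakly_cvg u l ->
  potential p (u j) @[j --> \oo] --> potential p l.
Proof.
move=> wp uM ul.
have /choice[t ht] : forall j, exists t, 0 < t < 1 /\
    potential p (u j) - potential p l = p (l + t *: (u j - l)) (u j - l).
  by move=> j; have [t t01 e] := potential_mvt (u j) l; exists t.
pose w j := l + t j *: (u j - l).
have wl : weakly_cvg w l.
  move=> phi dphi; have [Z [D B _ _]] := dual_linear dphi.
  have h : phi (u j) - phi l @[j --> \oo] --> (0 : R).
    by rewrite -(subrr (phi l)); apply: cvgB; [exact: ul|exact: cvg_cst].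
  apply/cvgrPdist_lt => e e0; have /cvgrPdist_lt /(_ _ e0) := h.
  apply: filterS => j; rewrite sub0r normrN /w D Z B opprD addrA subrr sub0r normrN normrM.
  have [/andP[t0 t1] _] := ht j; apply: le_lt_trans; rewrite (gtr0_norm t0).
  by rewrite ler_piMl // ltW.
have h : potential p (u j) - potential p l @[j --> \oo] --> (0 : R).
  by under eq_fun do rewrite (ht _).2; exact: (weak_pairing wp wl uM ul).
have -> : (fun j => potential p (u j)) = fun j => potential p (u j) - potential p l + potential p l.
  by apply/funext => j; rewrite subrK.
by rewrite -[X in _ --> X]add0r; apply: cvgD => //; exact: cvg_cst.
Qed.

End Potential.

Lemma potential_scale (R : realType) (W : normedModType R) (sc : W -> R -> W) (s a : R)
  (p : W -> W -> R) u t : potential_operator p -> is_scaling sc s -> scales_with sc a p ->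
  0 <= t -> potential p (sc u t) = t `^ a * potential p u.
Proof.
move=> pp hs ha t0; rewrite /potential -RintegralZl //.
- apply: eq_Rintegral => x _.
  by rewrite -(scaling_homogeneous hs) // ha.
- apply: continuous_compact_integrable; first exact: segment_compact.
  apply: continuous_subspaceT => x.
  apply: (@continuous_cvg _ _ _ _ _ (fun t => t *: u) (p ^~ u)); first exact: pot_continuous.
  by apply: cvgZr_tmp; exact: cvg_id.
Qed.

(** * Minimax levels of scaled functionals *)

Section Minimax.
Variables (R : realType) (W : normedModType R).
Implicit Types (M N : set W) (E : W -> R).

Lemma minimax_le N E k M (x : \bar R) : (1 <= k)%N -> M `<=` N -> symmetric_set M ->
  index_ge k M -> (forall u, M u -> ((E u)%:E <= x)%E) -> (minimax N E k <= x)%E.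
Proof.
move=> k1 MN sM hM hx; apply: (@le_trans _ _ (ereal_sup [set (E u)%:E | u in M])).
  apply: ereal_inf_lbound; exists M => //; split => //.
  by apply/fr_index_geP => //; exact: opp_continuous.
by apply: ge_ereal_sup => _ [u Mu <-]; exact: hx.
Qed.

Lemma minimax_lt N E k (x : \bar R) : (1 <= k)%N -> (minimax N E k < x)%E ->
  exists M y, [/\ M `<=` N, symmetric_set M, index_ge k M, (y < x)%E &
    forall u, M u -> ((E u)%:E <= y)%E].
Proof.
move=> k1 /ereal_inf_lt[_ [M [MN sM /fr_index_geP iM] <-] sx].
exists M, (ereal_sup [set (E u)%:E | u in M]); split => //.
  by apply: iM => //; exact: opp_continuous.
by move=> u Mu; apply: ereal_sup_ubound; exists u.
Qed.

Lemma minimax_ge N E k (x : \bar R) : (1 <= k)%N ->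
  (forall M, M `<=` N -> symmetric_set M -> index_ge k M -> forall y,
    (forall u, M u -> ((E u)%:E <= y)%E) -> (x <= y)%E) -> (x <= minimax N E k)%E.
Proof.
move=> k1 h; rewrite leNgt; apply/negP => /(minimax_lt k1)[M [y [MN sM iM yx hy]]].
by have := h M MN sM iM y hy; rewrite leNgt yx.
Qed.

Lemma minimax_leq N E k l : (1 <= k <= l)%N -> (minimax N E k <= minimax N E l)%E.
Proof.
move=> /andP[k1 kl]; apply: minimax_ge; first exact: leq_trans kl.
move=> M MN sM iM y hy; apply: (minimax_le k1 MN sM) => //.
by apply: index_ge_leq kl iM => //; exact: opp_continuous.
Qed.

(** Images under [h] are competitors with the same values; the odd left inverse [g] makes them
    classifiable. *)
Lemma minimax_transfer N N' E E' (h g : W -> W) k : (1 <= k)%N ->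
  (forall u, N u -> [/\ {for u, continuous h}, N' (h u), h (- u) = - h u, g (h u) = u &
    E' (h u) = E u]) ->
  (forall u, N' u -> {for u, continuous g} /\ g (- u) = - g u) ->
  (minimax N' E' k <= minimax N E k)%E.
Proof.
move=> k1 hh hg; apply: minimax_ge => // M MN sM iM y hy.
apply: (@minimax_le _ _ _ (h @` M)) => //.
- by move=> _ [u /MN /hh[_ ? _ _ _] <-].
- by move=> _ [u Mu <-]; exists (- u); [exact: sM|have [] := hh u (MN u Mu)].
- apply: (@index_ge_map _ _ _ M _ h) (iM) => //; first exact: opp_continuous.
  + by apply: continuous_in_subspaceT => u; rewrite inE => /MN /hh[].
  + by move=> u /MN /hh[].
  + apply: (@classifiable_map _ _ _ _ M g); last by case: iM.
    * by apply: continuous_in_subspaceT => u; rewrite inE => -[v /MN /hh[_ Nv _ _ _] <-]; have [] := hg _ Nv.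
    * by move=> _ [v Mv <-]; have [_ _ _ -> _] := hh v (MN v Mv).
    * by move=> _ [v /MN /hh[_ Nv _ _ _] <-]; have [] := hg _ Nv.
- by move=> _ [u Mu <-]; have [_ _ _ _ ->] := hh u (MN u Mu); exact: hy.
Qed.

End Minimax.

Section Embedding.
Variables (R : realType) (W : normedModType R).

Lemma independent_vectors : infinite_dimensional W -> forall k, exists e : nat -> W,
  forall a : nat -> R, \sum_(i < k) a i *: e i = 0 -> forall i, (i < k)%N -> a i = 0.
Proof.
move=> Winf; elim=> [|k [e he]]; first by exists (fun=> 0).
have [u hu] := Winf k (fun i => e i).
exists (fun i => if (i < k)%N then e i else u) => a.
rewrite big_ord_recr /= ltnn.
have -> : \sum_(i < k) a (widen_ord (leqnSn k) i) *: (if (i < k)%N then e i else u) =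
    \sum_(i < k) a i *: e i.
  by apply: eq_bigr => i _; rewrite ltn_ord.
have [ak|ak] := eqVneq (a k) 0.
  rewrite ak scale0r addr0 => /he h i; rewrite ltnS leq_eqVlt => /orP[/eqP -> //|].
  exact: h.
move=> h; exfalso; apply: (hu (fun i => - (a k)^-1 * a i)).
under eq_bigr do rewrite -scalerA.
rewrite -scaler_sumr; move/eqP: h; rewrite addr_eq0 => /eqP ->.
by rewrite scalerN scaleNr opprK scalerA mulVf // scale1r.
Qed.

Lemma index_ge_cross_polytope (N : set W) m (h : 'rV[R]_m.+1 -> W) :
  (forall x, @cross_polytope R m x -> {for x, continuous h}) ->
  (forall x, @cross_polytope R m x -> h (- x) = - h x) ->
  (forall x, @cross_polytope R m x -> N (h x)) -> classifiable N -> index_ge m.+1 N.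
Proof.
move=> ch oh hN cN.
have wh : {within @cross_polytope R m, continuous h}.
  by apply: continuous_in_subspaceT => x; rewrite inE; exact: ch.
apply: (@index_ge_map R ('rV[R]_m.+1 : normedModType R) W (@cross_polytope R m) N h) => //.
- exact: opp_continuous.
- exact: cross_polytope_symmetric.
- split; first exact: classifiable_map wh hN oh cN.
  by move=> w c; exact: cross_polytope_pow.
Qed.

Lemma sphere_embedding m : infinite_dimensional W -> exists h : 'rV[R]_m.+1 -> W,
  [/\ continuous h, forall x, h (- x) = - h x & forall x, x != 0 -> h x != 0].
Proof.
move=> /independent_vectors /(_ m.+1)[e he].
exists (fun x => \sum_(i < m.+1) x 0 i *: e i); split.
- move=> x; apply: (@cvg_sum_ord R _ _ m.+1 (fun i (x : 'rV[R]_m.+1) => x 0 i *: e i)) => i.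
  apply: (@continuous_comp _ _ _ (fun x : 'rV[R]_m.+1 => x 0 i) (fun t : R => t *: e i)).
    exact: coord_continuous.
  by apply: cvgZr_tmp; exact: cvg_id.
- by move=> x; rewrite -sumrN; apply: eq_bigr => i _; rewrite mxE scaleNr.
- move=> x; apply: contra_neq => h; apply/rowP => i; rewrite mxE.
  have := he (fun j => if insub j is Some i then x 0 i else 0).
  have -> : \sum_(i < m.+1) (if insub (val i) is Some i then x 0 i else 0) *: e i =
     \sum_(i < m.+1) x 0 i *: e i by apply: eq_bigr => j _; rewrite valK.
  by move=> /(_ h i (ltn_ord i)); rewrite valK.
Qed.

End Embedding.

Section PowR.
Variable R : realType.

Lemma powR_continuous (a x : R) : 0 < x -> {for x, continuous (fun y => powR y a)}.
Proof.
move=> x0; apply: differentiable_continuous; apply/derivable1_diffP.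
exact: (@ex_derive _ _ _ _ _ _ _ (is_derive1_powR a x0)).
Qed.

Lemma powRVK (t a : R) : 0 <= t -> a != 0 -> (t `^ a) `^ a^-1 = t.
Proof. by move=> t0 a0; rewrite -powRrM mulfV // powRr1. Qed.

Lemma powR_inv (t a : R) : t^-1 `^ a = (t `^ a)^-1.
Proof.
have [t0|t0] := leP 0 t; first by rewrite -(powR_inv1 t0) -powRrM mulN1r powRN.
by rewrite !lt0_powR1 ?invr1 // invr_lt0.
Qed.

End PowR.

Lemma homo_ltn_ge (n : nat -> nat) : {homo n : i j / (i < j)%N} -> forall j, (j <= n j)%N.
Proof. by move=> h; elim=> // j IH; apply: leq_ltn_trans IH _; exact: h. Qed.

Lemma homo_ltn_cvg (n : nat -> nat) : {homo n : i j / (i < j)%N} -> n @ \oo --> \oo.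
Proof.
move=> /homo_ltn_ge h S [N _ hN]; exists N => // j /= Nj; apply: hN => /=.
exact: leq_trans (h j).
Qed.

Lemma weak_potential_bounded (R : realType) (W : normedModType R) (p : W -> W -> R) (M : R) :
  reflexive_space W -> potential_operator p -> weak_to_strong p ->
  exists2 C, 0 < C & forall u, `|u| <= M -> `|potential p u| <= C.
Proof.
move=> Wr pp wp; apply: contrapT => hn.
have /choice[u hu] : forall j : nat, exists u : W, `|u| <= M /\ j%:R < `|potential p u|.
  move=> j; apply: contrapT => hj; apply: hn; exists (j%:R + 1).
    by rewrite ltr_wpDl.
  move=> u uM; rewrite leNgt; apply/negP => h; apply: hj; exists u; split => //.
  by apply: lt_trans h; rewrite ltrDl.
have [n [nlt [l ul]]] := weak_subsequence Wr (fun j => (hu j).1).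
have /cvgrPdist_lt /(_ 1 ltr01) [N _ hN] :=
  potential_weak_continuous pp wp (fun j => (hu (n j)).1) ul.
pose j := maxn N (Num.trunc (`|potential p l| + 1)).+1.
have h1 := hN j (leq_maxl _ _); have [_ h2] := hu (n j).
have h3 : `|potential p l| + 1 < (n j)%:R.
  apply: lt_le_trans (truncnS_gt _) _; rewrite ler_nat.
  apply: leq_trans (leq_maxr N _) _; exact: homo_ltn_ge.
move: h1 => /=; have := ler_distD (potential p l) (potential p (u (n j))) 0.
rewrite !subr0 (distrC (potential p (u (n j)))); lra.
Qed.

(** * The level functional on M_s and its minimax values *)

Section ScaledFunctionals.
Variables (R : realType) (W : completeNormedModType R) (sc : W -> R -> W) (q s : R).
Variables A B f : W -> W -> R.
Hypotheses (W_reflexive : reflexive_space W) (q_gt0 : 0 < q) (q_lt_s : q < s).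
Hypotheses (scs : is_scaling sc s) (A_scaled : scaled_operator sc s A)
  (B_scaled : scaled_operator sc s B) (f_potential : potential_operator f)
  (f_odd : odd_operator f).
Hypotheses (A6 : forall u, u != 0 -> 0 < A u u)
  (A7 : forall (u : nat -> W) (l : W), weakly_cvg u l ->
     A (u j) (u j - l) @[j --> \oo] --> (0 : R) ->
     exists2 n : nat -> nat, {homo n : i j / (i < j)%N} & (u \o n) @ \oo --> l)
  (A8 : forall u, u != 0 -> 0 < B u u) (A9 : weak_to_strong B)
  (A10 : forall C : R, exists N : R, forall u, N <= `|u| -> C <= potential A u)
  (H1_f : scales_with sc q f) (H2_f : weak_to_strong f)
  (F_lt0 : forall u, u != 0 -> potential f u < 0).

Let I := potential A.
Let J := potential B.
(** The sign is reversed here: this [F] is positive away from 0 and so admits real powers. *)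
Let F u := - potential f u.

Let s_gt0 : 0 < s. Proof. exact: lt_trans q_lt_s. Qed.
Let A_pot : potential_operator A. Proof. by have [] := A_scaled. Qed.
Let B_pot : potential_operator B. Proof. by have [] := B_scaled. Qed.

Lemma I_scale u t : 0 <= t -> I (sc u t) = t `^ s * I u.
Proof. by have [_ _ _ h] := A_scaled; exact: (potential_scale _ A_pot scs h). Qed.

Lemma J_scale u t : 0 <= t -> J (sc u t) = t `^ s * J u.
Proof. by have [_ _ _ h] := B_scaled; exact: (potential_scale _ B_pot scs h). Qed.

Lemma F_scale u t : 0 <= t -> F (sc u t) = t `^ q * F u.
Proof. by move=> t0; rewrite /F (potential_scale _ f_potential scs H1_f t0) mulrN. Qed.

Lemma I_gt0 u : u != 0 -> 0 < I u. Proof. exact: potential_gt0. Qed.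
Lemma J_gt0 u : u != 0 -> 0 < J u. Proof. exact: potential_gt0. Qed.
Lemma F_gt0 u : u != 0 -> 0 < F u. Proof. by move=> u0; rewrite oppr_gt0 F_lt0. Qed.
Lemma F_ge0 u : 0 <= F u.
Proof. by have [->|/F_gt0/ltW //] := eqVneq u 0; rewrite /F potential0 // oppr0. Qed.

Lemma I_even u : I (- u) = I u. Proof. by apply: potentialN => //; have [] := A_scaled. Qed.
Lemma J_even u : J (- u) = J u. Proof. by apply: potentialN => //; have [] := B_scaled. Qed.
Lemma F_even u : F (- u) = F u. Proof. by congr (- _); exact: potentialN. Qed.

Lemma I_cont : continuous I. Proof. exact: potential_continuous. Qed.
Lemma J_cont : continuous J. Proof. exact: potential_continuous. Qed.
Lemma F_cont : continuous F.
Proof. by move=> u; apply: cvgN; exact: potential_continuous. Qed.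

Lemma scN u t : 0 <= t -> sc (- u) t = - sc u t.
Proof. by move=> t0; rewrite -scaleN1r (scaling_homogeneous scs) // scaleN1r. Qed.

Lemma sc_neq0 u t : u != 0 -> 0 < t -> sc u t != 0.
Proof.
move=> u0 t0; apply/eqP => e; have := I_scale u (ltW t0).
rewrite e /I potential0 // => /esym/eqP.
by rewrite mulf_eq0 powR_eq0 (gt_eqF t0) (gt_eqF (I_gt0 u0)).
Qed.

Lemma scK u t : 0 < t -> sc (sc u t) t^-1 = u.
Proof.
move=> t0; rewrite (scaling_mul scs) ?invr_ge0 ?ltW // mulfV ?gt_eqF //.
exact: (scaling_1 scs).
Qed.

Lemma sc_continuous (T : W -> R) u : {for u, continuous T} -> 0 < T u ->
  {for u, continuous (fun z => sc z (T z))}.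
Proof.
move=> cT T0 U nU; have := scaling_continuous scs.
move=> /subspace_continuousP /(_ (u, T u) (ltW T0) U nU) [[P Q] /= [nP nQ] PQ].
have h1 : \forall z \near u, Q (T z) by exact: cT.
have h2 : \forall z \near u, 0 < T z by exact: (cvgr_gt _ cT).
apply: filterS (filterI nP (filterI h1 h2)) => z [Pz [Qz /ltW Tz]].
exact: (PQ (z, T z) (conj Pz Qz) Tz).
Qed.

Lemma unit_neq0 u : unit_level A u -> u != 0.
Proof.
move=> Mu; apply/eqP => u0; move: Mu; rewrite /unit_level /= u0 potential0 // => /esym/eqP.
by rewrite oner_eq0.
Qed.

Lemma unit_bounded : exists2 N, 0 < N & forall u, unit_level A u -> `|u| <= N.
Proof.
have [N hN] := A10 2; exists (`|N| + 1); first by rewrite ltr_wpDl.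
move=> u Mu; have [/hN|] := leP N `|u|.
  by rewrite (_ : potential A u = 1) // lern1.
by have := ler_norm N; lra.
Qed.

Definition unit_scale u := sc u (I u `^ (- s^-1)).

Lemma unit_scaleP u : u != 0 -> [/\ unit_level A (unit_scale u),
  unit_scale (- u) = - unit_scale u & {for u, continuous unit_scale}].
Proof.
move=> /I_gt0 I0; split.
- rewrite /unit_level /= -/I I_scale ?powR_ge0 // -powRrM mulNr mulVf ?gt_eqF //.
  by rewrite powR_inv1 ?mulVf ?gt_eqF // ltW.
- by rewrite /unit_scale I_even scN ?powR_ge0.
- apply: sc_continuous; last exact: powR_gt0.
  apply: (@continuous_cvg _ _ _ _ _ I (fun y => powR y (- s^-1))); first exact: powR_continuous.
  exact: I_cont.
Qed.

(** On a minimising sequence J and F pass to a weak limit; there J >= e, so the limit is nonzero and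
    F is positive at it. *)
Lemma F_low e : 0 < e -> exists2 d, 0 < d &
  forall u, unit_level A u -> e <= J u -> d <= F u.
Proof.
move=> e0; apply: contrapT => hn; have [N N0 hN] := unit_bounded.
have /choice[u hu] : forall j : nat, exists u, [/\ unit_level A u, e <= J u & F u < j.+1%:R^-1].
  move=> j; apply: contrapT => hj; apply: hn; exists j.+1%:R^-1; first by rewrite invr_gt0.
  by move=> u Mu Ju; rewrite leNgt; apply/negP => h; apply: hj; exists u.
have uN j : `|u j| <= N by apply: hN; have [] := hu j.
have [n [nlt [l ul]]] := weak_subsequence W_reflexive uN.
have cJ : J (u (n j)) @[j --> \oo] --> J l.
  exact: (potential_weak_continuous B_pot A9 (fun j => uN (n j)) ul).
have cF := potential_weak_continuous f_potential H2_f (fun j => uN (n j)) ul.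
have Jl : e <= J l.
  rewrite -(cvg_lim _ cJ) //; apply: limr_ge; first by apply/cvg_ex; exists (J l).
  by near=> j; have [_ + _] := hu (n j).
have l0 : l != 0 by apply: contraTneq Jl => ->; rewrite /J potential0 // -ltNge.
have := F_gt0 l0; rewrite oppr_gt0 ltNge; apply/negP; rewrite negbK.
rewrite -oppr_le0 -/(F l); apply/ler_addgt0Pr => d d0; rewrite add0r.
have d2 : 0 < d / 2 by rewrite divr_gt0.
have /cvgrPdist_lt /(_ _ d2) [N1 _ h1] := cF.
pose j := maxn N1 (Num.trunc (d / 2)^-1).
have := h1 j (leq_maxl _ _); have [_ _] := hu (n j).
have h2 : (n j).+1%:R^-1 < d / 2.
  rewrite invf_plt ?posrE //; apply: lt_le_trans (truncnS_gt _) _; rewrite ler_nat ltnS.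
  by apply: leq_trans (leq_maxr N1 _) _; exact: homo_ltn_ge.
rewrite /F /= ltr_norml => /lt_trans/(_ h2) h3 /andP[]; lra.
Unshelve. all: by end_near.
Qed.

Lemma unit_upper : exists2 C, 0 < C & forall u, unit_level A u -> J u <= C /\ F u <= C.
Proof.
have [N N0 hN] := unit_bounded.
have [C1 C10 h1] := weak_potential_bounded N W_reflexive B_pot A9.
have [C2 C20 h2] := weak_potential_bounded N W_reflexive f_potential H2_f.
exists (C1 + C2); first exact: addr_gt0.
move=> u /hN uN; have := h1 u uN; have := h2 u uN; rewrite !ler_norml /J /F => /andP[? ?] /andP[? ?].
by split; lra.
Qed.

Section Coordinates.
Variable e : R.
Hypothesis e_gt0 : 0 < e.

(* If no finite family of functionals B(w) separated the set from 0, one could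
   choose u_j in it with B(w_i) u_j = 0 for i < j and B(w_j) u_j = J(u_j) >= e,
   and compactness of B would be violated. *)
Lemma unit_coordinates : exists m (phi : nat -> W -> R),
  [/\ forall i, continuous (phi i), forall i x, phi i (- x) = - phi i x &
      forall u, unit_level A u -> e <= J u -> exists2 i, (i < m)%N & phi i u != 0].
Proof.
apply: contrapT => hn; have [N N0 hN] := unit_bounded.
have dB w := pot_dual B_pot w.
have /choice[next hnext] : forall ws : seq W, exists uw : W * W,
    [/\ `|uw.1| <= N, `|uw.2| <= N, e <= B uw.2 uw.1 & forall w, w \in ws -> B w uw.1 = 0].
  move=> ws; apply: contrapT => hws; apply: hn; exists (size ws), (fun i => B (nth 0 ws i)).
  split=> [i|i x|u Mu Ju]; first by have [] := dB (nth 0 ws i).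
    by have [_ [_ _ ->]] := dual_linear (dB (nth 0 ws i)).
  (* By the mean value theorem J(u) = B(t u) u, so t u is the new functional. *)
  apply: contrapT => h; apply: hws; have [t /andP[t0 t1]] := potential_mvt B_pot u 0.
  rewrite potential0 // !subr0 add0r => Jt; exists (u, t *: u); split => //=.
  - exact: hN.
  - rewrite normrZ gtr0_norm //; apply: le_trans (hN u Mu).
    by rewrite ler_piMl // ltW.
  - by rewrite -Jt.
  - move=> w /(nthP 0)[i iw <-]; apply/eqP/negPn/negP => h'.
    by apply: h; exists i.
pose ws := fix ws j := if j is j'.+1 then (next (ws j')).2 :: ws j' else [::].
pose w j := (next (ws j)).2; pose u j := (next (ws j)).1.
have wM j : `|w j| <= N by have [] := hnext (ws j).
have wws i j : (i < j)%N -> w i \in ws j.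
  elim: j => // j IH; rewrite ltnS leq_eqVlt => /orP[/eqP ->|/IH h] /=.
    by rewrite inE eqxx.
  by rewrite inE h orbT.
have [n [nlt [l wl]]] := weak_subsequence W_reflexive wM.
have d0 : 0 < e / 3 / N by rewrite !divr_gt0.
have /cvgrPdist_lt /(_ _ d0) [j0 _ hj] := A9 wl.
(* At one vector u an earlier functional is 0 and the current one at least e, yet both are within
   e/3 of the limit functional. *)
have close j : (j0 <= j)%N -> `|B (w (n j)) (u (n j.+1)) - B l (u (n j.+1))| < e / 3
    /\ `|B (w (n j.+1)) (u (n j.+1)) - B l (u (n j.+1))| < e / 3.
  have aux i k : (j0 <= i)%N -> `|B (w (n i)) (u (n k)) - B l (u (n k))| < e / 3.
    move=> ji; have := hj i ji; rewrite /= sub0r normrN.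
    have dBl := dualB (dB (w (n i))) (dB l).
    rewrite ger0_norm ?dual_norm_ge0 // ltr_pdivlMr // => h.
    apply: le_lt_trans h; apply: le_trans (dual_le (u (n k)) dBl) _.
    by rewrite ler_wpM2l ?dual_norm_ge0 //; have [] := hnext (ws (n k)).
  by move=> jj; split; apply: aux => //; exact: leqW.
have [h1 h2] := close j0 (leqnn _).
have [_ _ h3 h4] : [/\ `|u (n j0.+1)| <= N, `|w (n j0.+1)| <= N,
    e <= B (w (n j0.+1)) (u (n j0.+1)) &
    forall x, x \in ws (n j0.+1) -> B x (u (n j0.+1)) = 0] := hnext (ws (n j0.+1)).
have := h4 (w (n j0)); rewrite wws ?nlt // => /(_ isT) h5.
move: h1 h2; rewrite h5 sub0r normrN !ltr_norml => /andP[? ?] /andP[? ?].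
have := e_gt0; lra.
Qed.

Lemma unit_classifiable M : (forall u, M u -> unit_level A u /\ e <= J u) -> classifiable M.
Proof.
move=> hM; have [m [phi [cp op hp]]] := unit_coordinates.
by apply: (@classifiable_coordinates R W m phi) => // x /hM[]; exact: hp.
Qed.

End Coordinates.

(* The maximum over t of lambda_c (sc u t), as a function of kappa = kappa(c). *)
Definition level (kappa : R) (u : W) : R := (I u + kappa * F u `^ (s / q)) / J u.
Local Notation E := level.

Lemma powR_qs (t : R) : (t `^ q) `^ (s / q) = t `^ s.
Proof. by rewrite -powRrM mulrCA mulfV ?gt_eqF // mulr1. Qed.

Lemma ler_powR_sq (x y : R) : 0 <= x <= y -> x `^ (s / q) <= y `^ (s / q).
Proof.
move=> /andP[x0 xy]; apply: ge0_ler_powR; rewrite ?nnegrE ?divr_ge0 ?(ltW q_gt0) ?(ltW s_gt0) //.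
exact: le_trans xy.
Qed.

Lemma level_scale kappa u t : 0 < t -> E kappa (sc u t) = E kappa u.
Proof.
move=> t0; rewrite /level I_scale ?J_scale ?F_scale ?ltW // powRM ?powR_ge0 ?F_ge0 //.
rewrite powR_qs mulrCA -mulrDr -mulf_div mulfV ?mul1r //.
by rewrite gt_eqF // powR_gt0.
Qed.

Lemma level_even kappa u : E kappa (- u) = E kappa u.
Proof. by rewrite /level I_even J_even F_even. Qed.

Lemma level_continuous kappa u : u != 0 -> {for u, continuous (E kappa)}.
Proof.
move=> u0; apply: cvgM.
  apply: cvgD; first exact: I_cont.
  apply: cvgM; first exact: cvg_cst.
  apply: (@continuous_cvg _ _ _ _ _ F (fun y => powR y (s / q))); last exact: F_cont.
  by apply: powR_continuous; exact: F_gt0.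
by apply: cvgV; [rewrite gt_eqF // J_gt0|exact: J_cont].
Qed.

Lemma level_unit_scale kappa u : u != 0 -> E kappa (unit_scale u) = E kappa u.
Proof. by move=> u0; apply: level_scale; rewrite powR_gt0 // I_gt0. Qed.

Lemma level_ge_inv kappa u : 0 <= kappa -> unit_level A u -> (J u)^-1 <= E kappa u.
Proof.
move=> k0 Mu; have u0 := unit_neq0 Mu; rewrite /level (_ : I u = 1) // mulrDl mul1r lerDl.
by rewrite !mulr_ge0 ?powR_ge0 // invr_ge0 ltW // J_gt0.
Qed.

(** A bound on the level keeps J away from 0, which is what the coordinates and the lower bound for
    F ask for. *)
Lemma level_le_J kappa L u : 0 <= kappa -> unit_level A u -> E kappa u <= L ->
  0 < L /\ L^-1 <= J u.
Proof.
move=> k0 Mu h; have J0 := J_gt0 (unit_neq0 Mu).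
have h' := le_trans (level_ge_inv k0 Mu) h.
have L0 : 0 < L by apply: lt_le_trans h'; rewrite invr_gt0.
by split => //; rewrite invf_ple.
Qed.

Lemma levelB kappa kappa' u : u != 0 ->
  E kappa' u - E kappa u = (kappa' - kappa) * (F u `^ (s / q) / J u).
Proof. by move=> u0; rewrite /level -mulrBl opprD addrACA subrr add0r -mulrBl mulrA. Qed.

Definition mlevel kappa k : \bar R := minimax (unit_level A) (E kappa) k.

Lemma unit_symmetric : symmetric_set (unit_level A).
Proof. by move=> u Mu; rewrite /unit_level /= -/(I (- u)) I_even. Qed.

Lemma mlevel_witness kappa k (x : \bar R) : 0 <= kappa -> (1 <= k)%N ->
  (mlevel kappa k < x)%E -> exists2 u, unit_level A u & ((E kappa u)%:E < x)%E.
Proof.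
move=> k0 k1 /(minimax_lt k1)[M [y [MN sM iM yx hy]]].
have /set0P[u Mu] := index_ge_neq0 iM.
by exists u; [exact: MN|exact: (le_lt_trans (hy u Mu) yx)].
Qed.

Lemma mlevel_ge0 kappa k : 0 <= kappa -> (1 <= k)%N -> (0 <= mlevel kappa k)%E.
Proof.
move=> k0 k1; rewrite leNgt; apply/negP => /(mlevel_witness k0 k1)[u Mu].
rewrite lte_fin ltNge; apply/negP; rewrite negbK.
apply: le_trans (level_ge_inv k0 Mu); rewrite invr_ge0 ltW // J_gt0 //.
exact: unit_neq0.
Qed.

Lemma mlevel_lt_pinfty kappa k : infinite_dimensional W -> 0 <= kappa -> (1 <= k)%N ->
  (mlevel kappa k < +oo)%E.
Proof.
move=> Winf k0; case: k => // m _.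
have [h [ch oh h0]] := sphere_embedding m Winf.
pose g x := unit_scale (h x).
have hK x : @cross_polytope R m x -> h x != 0 by move=> /cross_polytope_neq0; exact: h0.
have cg x : @cross_polytope R m x -> {for x, continuous g}.
  move=> /hK /unit_scaleP[_ _ cu].
  by apply: (@continuous_comp _ _ _ h unit_scale); [exact: ch|exact: cu].
have cE : {within @cross_polytope R m, continuous (fun x => E kappa (g x))}.
  apply: continuous_in_subspaceT => x; rewrite inE => Kx.
  apply: (@continuous_comp _ _ _ g (E kappa)); first exact: cg.
  by apply: level_continuous; have [+ _ _] := unit_scaleP (hK x Kx); exact: unit_neq0.
have cpt := continuous_compact cE (@cross_polytope_compact R m).
have [L [_ hL]] := compact_bounded cpt.
have hL1 x : @cross_polytope R m x -> E kappa (g x) <= `|L| + 1.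
  move=> Kx; apply: le_trans (ler_norm _) _; apply: hL; last by exists x.
  by have := ler_norm L; lra.
(* The competitor is a whole sublevel, classifiable by coordinates, and not just the image of the
   cross polytope. *)
pose N := [set u | unit_level A u /\ E kappa u <= `|L| + 1].
have gN x : @cross_polytope R m x -> N (g x).
  by move=> Kx; split; [have [] := unit_scaleP (hK x Kx)|exact: hL1].
have L1 : 0 < `|L| + 1 by rewrite ltr_wpDl.
apply: (@le_lt_trans _ _ (`|L| + 1)%:E); last exact: ltry.
apply: (@minimax_le _ _ _ _ _ N) => //; first by move=> u [].
- by move=> u [Mu Eu]; split; [exact: unit_symmetric|rewrite level_even].
- apply: (@index_ge_cross_polytope _ _ N m g) => //.
  + by move=> x /hK /unit_scaleP[_ + _]; rewrite /g oh.
  + apply: (@unit_classifiable (`|L| + 1)^-1); first by rewrite invr_gt0.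
    by move=> u [Mu Eu]; split => //; have [] := level_le_J k0 Mu Eu.
- by move=> u [_ Eu]; rewrite lee_fin.
Qed.

(** A sublevel carries m odd coordinates without common zero, so it contains no set of index above
    m. *)
Lemma mlevel_coercive kappa (L : R) : 0 <= kappa -> exists m, forall k, (m < k)%N ->
  (L%:E <= mlevel kappa k)%E.
Proof.
move=> k0; pose N := `|L| + 1; have N0 : 0 < N^-1 by rewrite invr_gt0 ltr_wpDl.
have [m [phi [cphi ophi hphi]]] := unit_coordinates N0.
exists m => k mk; rewrite leNgt; apply/negP => /minimax_lt.
case; first exact: leq_ltn_trans mk.
move=> M [y [MN sM iM yL hy]].
have iM1 : index_ge m.+1 M by apply: index_ge_leq mk iM => //; exact: opp_continuous.
suff hp u : M u -> exists2 i, (i < m)%N & phi i u != 0.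
  have oc : continuous (-%R : W -> W) by exact: opp_continuous.
  exact: (index_ge_coordinates oc sM cphi ophi hp iM1).
move=> Mu; apply: hphi; first exact: MN.
have [] // := @level_le_J kappa N u k0 (MN _ Mu).
have := le_lt_trans (hy u Mu) yL; rewrite lte_fin => /ltW h; apply: le_trans h _.
by rewrite /N; have := ler_norm L; lra.
Qed.

(** The increment in kappa is at most a constant times 1/J, which E_kappa itself dominates on M_s;
    hence an estimate proportional to the level. *)
Lemma mlevel_upper : exists2 C, 0 < C & forall kappa kappa' k x,
  0 <= kappa <= kappa' -> (1 <= k)%N -> (mlevel kappa k < x%:E)%E ->
  (mlevel kappa' k <= ((1 + (kappa' - kappa) * C) * x)%:E)%E.
Proof.
have [C C0 hC] := unit_upper; exists (C `^ (s / q)); first exact: powR_gt0.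
move=> kappa kappa' k x /andP[k0 kk] k1 /(minimax_lt k1)[M [y [MN sM iM yx hy]]].
apply: (minimax_le k1 MN sM iM) => u Mu; rewrite lee_fin.
have Eu : E kappa u <= x by rewrite -lee_fin; apply/ltW/(le_lt_trans (hy u Mu)).
have u0 := unit_neq0 (MN _ Mu); have J0 := J_gt0 u0.
have := levelB kappa kappa' u0.
have h1 : F u `^ (s / q) <= C `^ (s / q).
  by apply: ler_powR_sq; rewrite F_ge0; have [] := hC u (MN _ Mu).
have h2 : F u `^ (s / q) / J u <= C `^ (s / q) * x.
  apply: ler_pM; rewrite ?powR_ge0 ?invr_ge0 ?(ltW J0) //.
  exact: le_trans (level_ge_inv k0 (MN _ Mu)) Eu.
have h3 : (kappa' - kappa) * (F u `^ (s / q) / J u) <= (kappa' - kappa) * (C `^ (s / q) * x).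
  by apply: ler_wpM2l => //; rewrite subr_ge0.
by move=> h4; lra.
Qed.

(** The gain [eta] is uniform over competitors: below level L the function J, hence also F, is
    bounded away from 0. A pointwise gain could be lost in the infimum. *)
Lemma mlevel_lower kappa kappa' k L : 0 <= kappa < kappa' -> (1 <= k)%N ->
  exists2 eta, 0 < eta & forall x, x <= L -> (mlevel kappa' k < x%:E)%E ->
    (mlevel kappa k <= (x - eta)%:E)%E.
Proof.
move=> /andP[k0 kk] k1; have [C C0 hC] := unit_upper.
have L0 : 0 < (`|L| + 1)^-1 by rewrite invr_gt0 ltr_wpDl.
have [d d0 hd] := F_low L0; have kk0 : 0 < kappa' - kappa by rewrite subr_gt0.
exists ((kappa' - kappa) * (d `^ (s / q) / C)).
  by rewrite mulr_gt0 // divr_gt0 // powR_gt0.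
move=> x xL /(minimax_lt k1)[M [y [MN sM iM yx hy]]].
apply: (minimax_le k1 MN sM iM) => u Mu; rewrite lee_fin.
have Eu : E kappa' u <= x by rewrite -lee_fin; apply/ltW/(le_lt_trans (hy u Mu)).
have u0 := unit_neq0 (MN _ Mu); have J0 := J_gt0 u0.
have [JC _] := hC u (MN _ Mu).
have k'0 : 0 <= kappa' by apply: le_trans k0 (ltW kk).
have [|_ JL] := @level_le_J kappa' (`|L| + 1) u k'0 (MN _ Mu).
  by apply: le_trans Eu _; apply: le_trans xL _; have := ler_norm L; lra.
have h1 : d `^ (s / q) <= F u `^ (s / q).
  by apply: ler_powR_sq; rewrite (ltW d0); exact: (hd u (MN _ Mu) JL).
have h2 : d `^ (s / q) / C <= F u `^ (s / q) / J u.
  by apply: ler_pM; rewrite ?powR_ge0 ?invr_ge0 ?(ltW C0) // lef_pV2 ?posrE.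
have h3 : (kappa' - kappa) * (d `^ (s / q) / C) <= (kappa' - kappa) * (F u `^ (s / q) / J u).
  by apply: ler_wpM2l => //; rewrite ltW.
have := levelB kappa kappa' u0; lra.
Qed.

Lemma mlevel_infty L : exists2 kappa0, 0 < kappa0 & forall kappa k, kappa0 <= kappa ->
  (1 <= k)%N -> (L%:E <= mlevel kappa k)%E.
Proof.
have [C C0 hC] := unit_upper.
have L1 : 0 < `|L| + 1 by rewrite ltr_wpDl.
have L0 : 0 < (`|L| + 1)^-1 by rewrite invr_gt0.
have [d d0 hd] := F_low L0; have dC : 0 < d `^ (s / q) / C by rewrite divr_gt0 // powR_gt0.
(* Where the level is at most |L| + 1, F^(s/q)/J is at least d^(s/q)/C; this kappa makes its
   contribution alone reach |L| + 1. *)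
exists ((`|L| + 1) / (d `^ (s / q) / C)); first exact: divr_gt0.
move=> kappa k; rewrite ler_pdivrMr // => kk k1; rewrite leNgt; apply/negP.
have k0 : 0 <= kappa.
  by rewrite -(pmulr_lge0 _ dC); apply: le_trans kk; exact: ltW.
move=> /(mlevel_witness k0 k1)[u Mu]; rewrite lte_fin => EL.
have L2 : E kappa u <= `|L| + 1 by have := ler_norm L; lra.
have [_ JL] := level_le_J k0 Mu L2; have u0 := unit_neq0 Mu; have [JC _] := hC u Mu.
have h1 : d `^ (s / q) <= F u `^ (s / q).
  by apply: ler_powR_sq; rewrite (ltW d0); exact: hd.
have h2 : d `^ (s / q) / C <= F u `^ (s / q) / J u.
  by apply: ler_pM; rewrite ?powR_ge0 ?invr_ge0 ?(ltW C0) // lef_pV2 ?posrE // J_gt0.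
have h3 : kappa * (d `^ (s / q) / C) <= kappa * (F u `^ (s / q) / J u) by apply: ler_wpM2l.
have : kappa * (F u `^ (s / q) / J u) <= E kappa u.
  by rewrite /level mulrDl mulrA lerDr divr_ge0 // ltW ?I_gt0 ?J_gt0.
have := ler_norm L; lra.
Qed.

(** * The differential of the level functional, compactness, and critical values *)

Definition dlevel (kappa : R) (y v : W) : R :=
  (A y v - kappa * (s / q * F y `^ (s / q - 1)) * f y v - E kappa y * B y v) / J y.

Lemma dlevel_linear kappa y : linear (dlevel kappa y : W -> R^o).
Proof.
move=> t u v; rewrite /dlevel.
have [ZA [DA _ _ _]] := dual_linear (pot_dual A_pot y).
have [ZB [DB _ _ _]] := dual_linear (pot_dual B_pot y).
have [Zf [Df _ _ _]] := dual_linear (pot_dual f_potential y).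
rewrite DA DB Df ZA ZB Zf /GRing.scale /=; ring.
Qed.

Lemma is_derive_level kappa (w v : W) (t : R) : w + t *: v != 0 ->
  is_derive t 1 (fun t => E kappa (w + t *: v)) (dlevel kappa (w + t *: v) v).
Proof.
move=> y0; have F0 := F_gt0 y0; have J0 := J_gt0 y0.
have dI : is_derive t 1 (fun t => I (w + t *: v)) (A (w + t *: v) v).
  by apply: is_derive_line; exact: potential_diff.
have dJ : is_derive t 1 (fun t => J (w + t *: v)) (B (w + t *: v) v).
  by apply: is_derive_line; exact: potential_diff.
have df : is_derive t 1 (fun t => F (w + t *: v)) (- f (w + t *: v) v).
  apply: is_deriveN; apply: (is_derive_line (P := potential f)); exact: potential_diff.
have dp := @is_derive1_comp R (fun y => y `^ (s / q)) (fun t => F (w + t *: v)) t _ _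
  (is_derive1_powR (s / q) F0) df.
have J0' : J (w + t *: v) != 0 by rewrite gt_eqF.
have dV := is_deriveV J0' dJ.
have d1 := is_deriveD dI (is_deriveZ kappa dp).
have h := is_deriveM d1 dV; refine (is_derive_eq h _).
rewrite /dlevel /level /=; set y := w + t *: v in J0' *.
have sE (a b : R) : a *: (b : R^o) = a * b by [].
rewrite -[X in X *: (- _ *: _)]/(I y + kappa * F y `^ (s / q)) !sE.
by field; rewrite J0' gt_eqF.
Qed.

Lemma dlevel_continuous kappa v y : y != 0 -> {for y, continuous (dlevel kappa ^~ v)}.
Proof.
move=> y0; have cA := @pot_continuous _ _ _ A_pot v y.
have cB := @pot_continuous _ _ _ B_pot v y.
have cf := @pot_continuous _ _ _ f_potential v y.
have cF : {for y, continuous (fun y => F y `^ (s / q - 1))}.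
  apply: (@continuous_cvg _ _ _ _ _ F (fun y => powR y (s / q - 1))); last exact: F_cont.
  by apply: powR_continuous; exact: F_gt0.
apply: cvgM; last by apply: cvgV; [rewrite gt_eqF // J_gt0|exact: J_cont].
apply: cvgB; last by apply: cvgM; [exact: level_continuous|exact: cB].
apply: cvgB; first exact: cA.
apply: cvgM; last exact: cf.
apply: cvgM; first exact: cvg_cst.
by apply: cvgM; [exact: cvg_cst|exact: cF].
Qed.

(** [descent] keeps the direction fixed, so continuity of [dlevel] in the base point gives a uniform
    rate near y. *)
Lemma level_descent kappa sg lo y v : y != 0 -> `|v| <= 1 -> sg < dlevel kappa y v ->
  lo < E kappa y -> exists rho, descent (E kappa) sg lo y v rho.
Proof.
move=> y0 v1 dv loE.
have h1 : \forall z \near y, sg < dlevel kappa z v by exact: (cvgr_gt _ (dlevel_continuous y0)).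
have h2 : \forall z \near y, lo < E kappa z by exact: (cvgr_gt _ (level_continuous y0)).
have h3 : nbhs y [set z | sg < dlevel kappa z v /\ lo < E kappa z] by exact: filterI.
have /nbhs_ballP[d /= d0 hd] := h3.
have ny : 0 < `|y| by rewrite normr_gt0.
(* The first half keeps the whole segment in the ball of radius d, the second keeps it away from
   0. *)
pose rho := Num.min (d / 2) (`|y| / 2).
have rd : rho <= d / 2 by rewrite ge_min lexx.
have ry : rho <= `|y| / 2 by rewrite ge_min lexx orbT.
have r0 : 0 < rho by rewrite lt_min !divr_gt0.
exists rho; split => //; first lra.
move=> z zy t /andP[t0 tr].
have key x : 0 <= x <= t -> [/\ z - x *: v != 0, sg < dlevel kappa (z - x *: v) v &
    lo < E kappa (z - x *: v)].
  move=> /andP[x0 xt].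
  have xv : `|x *: v| <= rho.
    by rewrite normrZ ger0_norm //; apply: le_trans tr; apply: le_trans xt; rewrite ler_piMr.
  have h : `|z - x *: v - y| < rho + rho.
    by rewrite addrAC; apply: le_lt_trans (ler_normB _ _) _; exact: ltr_leD.
  have [] : sg < dlevel kappa (z - x *: v) v /\ lo < E kappa (z - x *: v).
    apply: hd; rewrite -ball_normE /= distrC; lra.
  split => //; apply: contraTneq h => ->; rewrite sub0r normrN -leNgt; lra.
split; last by have [] := key t; rewrite ?t0 ?lexx.
have [->|t1] := eqVneq t 0; first by rewrite scale0r mulr0 !subr0.
have {}t1 : 0 < t by rewrite lt_neqAle eq_sym t1.
have [||x] := @MVT R (fun x => E kappa (z + x *: - v)) (fun x => dlevel kappa (z + x *: - v) (- v)) 0 t t1.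
- move=> x; rewrite in_itv /= => /andP[x0 xt]; apply: is_derive_level.
  by rewrite scalerN; have [] := key x; rewrite ?ltW.
- apply: continuous_in_subspaceT => x; rewrite inE /= in_itv /= => /key[h _ _].
  apply: (@continuous_cvg _ _ _ _ _ (fun x => z + x *: - v) (E kappa)); last exact: line_continuous.
  by apply: level_continuous; rewrite scalerN.
rewrite in_itv /= => /andP[x0 xt]; rewrite scale0r addr0 subr0 !scalerN.
have [_ [_ _ -> _]] := linear_real (dlevel_linear kappa (z - x *: v)).
have [_ h _] : [/\ z - x *: v != 0, sg < dlevel kappa (z - x *: v) v &
    lo < E kappa (z - x *: v)] by apply: key; rewrite !ltW.
have := ler_wpM2r t0 (ltW h); rewrite mulNr; lra.
Qed.

Lemma unit_away : exists2 d, 0 < d & forall u, unit_level A u -> d <= `|u|.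
Proof.
have h : \forall z \near (0 : W), I z < 1.
  have cI0 : I z @[z --> (0 : W)] --> I 0 by exact: I_cont.
  by apply: (cvgr_lt _ cI0); rewrite /I potential0.
have /nbhs_ballP[d /= d0 hd] := h; exists d => // u Mu; rewrite leNgt; apply/negP => ud.
have := hd u; rewrite -ball_normE /= sub0r normrN => /(_ ud).
by rewrite /I (_ : potential A u = 1) // ltxx.
Qed.

Definition critical_level kappa u := forall v, dlevel kappa u v = 0.

(** The almost critical points x_j are only close to points u_j of M_s, because the deformation
    moves points off M_s. *)
Lemma level_palais_smale kappa a (x u : nat -> W) (e : nat -> R) : 0 <= kappa ->
  (forall j, unit_level A (u j)) -> e @ \oo --> 0 -> (forall j, `|x j - u j| <= e j) ->
  (forall j, x j != 0) ->
  (forall j, `|E kappa (x j) - a| <= e j) -> (forall j v, `|dlevel kappa (x j) v| <= e j * `|v|) ->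
  exists n l, [/\ {homo n : i j / (i < j)%N}, u (n j) @[j --> \oo] --> l, E kappa l = a
    & critical_level kappa l].
Proof.
move=> k0 Mu e0 xu x0 Ex dx; have [N N0 hN] := unit_bounded.
have xu0 : x j - u j @[j --> \oo] --> (0 : W).
  apply/cvgr0Pnorm_le => d d0; have /cvgr0Pnorm_le /(_ _ d0) := e0.
  by apply: filterS => j ed; apply: le_trans (xu j) _; apply: le_trans ed; exact: ler_norm.
have [C C1] : exists C, forall j, e j <= C.
  have /cvg_seq_bounded[C [_ hC]] : cvgn e by apply/cvg_ex; exists 0.
  exists (`|C| + 1) => j; apply: le_trans (ler_norm _) _; apply: hC => //.
  by have := ler_norm C; lra.
have xM j : `|x j| <= N + C.
  have := ler_normD (x j - u j) (u j); rewrite subrK.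
  have := hN _ (Mu j); have := xu j; have := C1 j; lra.
have [n [nlt [l ul]]] := weak_subsequence W_reflexive (fun j => hN _ (Mu j)).
have sub (T : topologicalType) (g : nat -> T) (z : T) : g @ \oo --> z -> g (n j) @[j --> \oo] --> z.
  by move=> h; apply: cvg_comp h; exact: homo_ltn_cvg.
have xl : weakly_cvg (x \o n) l.
  move=> phi dphi; have [_ [_ Bp _ p0]] := dual_linear dphi.
  have h : phi (x j - u j) @[j --> \oo] --> (0 : R).
    rewrite -p0; apply: (@continuous_cvg _ _ _ _ _ (fun j => x j - u j) phi) => //.
    exact: dphi.2.
  have -> : (fun j => phi ((x \o n) j)) = fun j => phi (x (n j) - u (n j)) + phi (u (n j)).
    by apply/funext => j /=; rewrite Bp subrK.
  rewrite -[phi l]add0r; apply: cvgD; last exact: (ul phi dphi).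
  exact: (sub _ (fun j => phi (x j - u j))).
have cJ : J (x (n j)) @[j --> \oo] --> J l.
  exact: (potential_weak_continuous B_pot A9 (fun j => xM (n j)) xl).
have cF : F (x (n j)) @[j --> \oo] --> F l.
  by apply: cvgN; exact: (potential_weak_continuous f_potential H2_f (fun j => xM (n j)) xl).
have cE0 : E kappa (x j) @[j --> \oo] --> a.
  apply/cvgrPdist_le => d d0; have /cvgr0Pnorm_le /(_ _ d0) := e0.
  by apply: filterS => j ed; rewrite distrC; apply: le_trans (Ex j) _; apply: le_trans ed; exact: ler_norm.
have cE := sub _ _ _ cE0.
have cI : I (x j) @[j --> \oo] --> (1 : R).
  have [_ _ bA _] := A_scaled; have [C' hC'] := potential_lipschitz A_pot (N + C) bA.
  have C0 : 0 <= C by apply: le_trans (C1 0%N); apply: le_trans (xu 0%N).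
  have h : C' * `|x j - u j| @[j --> \oo] --> (0 : R).
    rewrite -(mulr0 C') -(@normr0 _ W); apply: cvgM; first exact: cvg_cst.
    exact: cvg_norm.
  apply/cvgrPdist_le => d d0; have /cvgr0Pnorm_le /(_ _ d0) := h.
  apply: filterS => j hd; rewrite distrC -[1](Mu j) -/I.
  apply: le_trans (hC' _ _ (xM j) _) _; first by have := hN _ (Mu j); lra.
  exact: le_trans (ler_norm _) hd.
(* E_kappa J >= I tends to 1, whereas at a zero weak limit J would tend to 0. *)
have l0 : l != 0.
  apply/eqP => l0; have h : E kappa (x (n j)) * J (x (n j)) @[j --> \oo] --> a * J l by exact: cvgM.
  have : 1 <= a * J l.
    apply: (ler_cvg_to (sub _ _ _ cI) h); near=> j.
    have J0 := J_gt0 (x0 (n j)); rewrite /level divfK ?gt_eqF // lerDl.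
    by rewrite mulr_ge0 // powR_ge0.
  by rewrite l0 /J potential0 // mulr0 ler10.
have pB := weak_pairing B_pot A9 xl (fun j => xM (n j)) xl.
have pf := weak_pairing f_potential H2_f xl (fun j => xM (n j)) xl.
have pd : dlevel kappa (x (n j)) (x (n j) - l) @[j --> \oo] --> (0 : R).
  have h : e j * (N + C + `|l|) @[j --> \oo] --> (0 : R).
    by rewrite -(mul0r (N + C + `|l|)); apply: cvgM => //; exact: cvg_cst.
  apply/cvgr0Pnorm_le => d d0; have /cvgr0Pnorm_le /(_ _ d0) := sub _ _ _ h.
  apply: filterS => j hd; apply: le_trans (dx _ _) _; apply: le_trans hd.
  apply: le_trans (ler_norm _); apply: ler_wpM2l; first exact: le_trans (xu (n j)).
  by apply: le_trans (ler_normB _ _) _; rewrite lerD2r.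
have cFp : F (x (n j)) `^ (s / q - 1) @[j --> \oo] --> F l `^ (s / q - 1).
  apply: (@continuous_cvg _ _ _ _ _ (fun j => F (x (n j))) (fun y => powR y (s / q - 1))) => //.
  by apply: powR_continuous; exact: F_gt0.
(* Solving the formula for [dlevel] for A leaves a term that is small by assumption and terms in f
   and B that vanish by compactness; then [A7] gives strong convergence. *)
have pA : A (x (n j)) (x (n j) - l) @[j --> \oo] --> (0 : R).
  have -> : (fun j => A (x (n j)) (x (n j) - l)) =
      fun j => J (x (n j)) * dlevel kappa (x (n j)) (x (n j) - l) +
        kappa * (s / q * F (x (n j)) `^ (s / q - 1)) * f (x (n j)) (x (n j) - l) +
        E kappa (x (n j)) * B (x (n j)) (x (n j) - l).
    apply/funext => j; have J0 : J (x (n j)) != 0 by rewrite gt_eqF // J_gt0.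
    by rewrite /dlevel [J _ * _]mulrC divfK //; ring.
  have -> : 0 = J l * 0 + kappa * (s / q * F l `^ (s / q - 1)) * 0 + a * 0 by rewrite !mulr0 !addr0.
  apply: cvgD; last exact: cvgM.
  apply: cvgD; first exact: cvgM.
  apply: cvgM => //; apply: cvgM; first exact: cvg_cst.
  by apply: cvgM => //; exact: cvg_cst.
have [n2 n2lt xn2] := A7 xl pA.
have sub2 (T : topologicalType) (g : nat -> T) (z : T) : g @ \oo --> z -> g (n2 j) @[j --> \oo] --> z.
  by move=> h; apply: cvg_comp h; exact: homo_ltn_cvg.
exists (n \o n2), l; split.
- by move=> i j ij; apply: nlt; exact: n2lt.
- have -> : (fun j => u ((n \o n2) j)) = fun j => x (n (n2 j)) - (x (n (n2 j)) - u (n (n2 j))).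
    by apply/funext => j /=; rewrite opprB addrC subrK.
  rewrite -[l]subr0; apply: cvgB; first exact: xn2.
  exact: (sub2 _ _ _ (sub _ _ _ xu0)).
- apply: (@cvg_unique _ (@norm_hausdorff _ R^o) (E kappa (x (n (n2 j))) @[j --> \oo])).
    apply: (@continuous_cvg _ _ _ _ _ (fun j => x (n (n2 j))) (E kappa)) => //.
    exact: level_continuous.
  exact: (sub2 _ _ _ cE).
- move=> v.
  apply: (@cvg_unique _ (@norm_hausdorff _ R^o) (dlevel kappa (x (n (n2 j))) v @[j --> \oo])).
    apply: (@continuous_cvg _ _ _ _ _ (fun j => x (n (n2 j))) (dlevel kappa ^~ v)) => //.
    exact: dlevel_continuous.
  have h : e j * `|v| @[j --> \oo] --> (0 : R).
    by rewrite -(mul0r `|v|); apply: cvgM => //; exact: cvg_cst.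
  apply/cvgr0Pnorm_le => d d0; have /cvgr0Pnorm_le /(_ _ d0) := sub2 _ _ _ (sub _ _ _ h).
  by apply: filterS => j hd; apply: le_trans (dx _ _) _; exact: le_trans (ler_norm _) hd.
Unshelve. all: by end_near.
Qed.

Lemma level_noncritical kappa a (D : set W) : 0 <= kappa -> closed D ->
  D `<=` unit_level A -> (forall u, D u -> E kappa u = a -> ~ critical_level kappa u) ->
  exists2 e, 0 < e & forall u y, D u -> `|y - u| <= e -> y != 0 /\
    (`|E kappa y - a| <= e -> exists2 v, `|v| <= 1 & e < dlevel kappa y v).
Proof.
move=> k0 cD DM hcrit; have [d d0 hd] := unit_away; apply: contrapT => hn.
(* At most half the distance of M_s from 0, so the perturbed points stay nonzero. *)
pose e j : R := d / 2 * harmonic j.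
have e_gt0 j : 0 < e j by apply: mulr_gt0; [exact: divr_gt0|exact: harmonic_gt0].
have e_le j : e j <= d / 2.
  by rewrite /e ler_piMr ?divr_ge0 ?(ltW d0) //= invf_le1 // ler1n.
have y0 j u y : D u -> `|y - u| <= e j -> y != 0.
  move=> /DM /hd du yu; apply: contraTneq yu => ->; rewrite sub0r normrN -ltNge.
  have := e_le j; lra.
have /choice[uy huy] : forall j, exists uy : W * W, [/\ D uy.1, `|uy.2 - uy.1| <= e j,
    `|E kappa uy.2 - a| <= e j & forall v, `|v| <= 1 -> dlevel kappa uy.2 v <= e j].
  move=> j; apply: contrapT => hj; apply: hn; exists (e j) => // u y Du yu.
  split; first exact: (y0 j u).
  move=> Ey; apply: contrapT => hv; apply: hj; exists (u, y); split => //= v v1.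
  by rewrite leNgt; apply/negP => h; apply: hv; exists v.
have e_cvg : e @ \oo --> (0 : R).
  rewrite -(mulr0 (d / 2)); apply: cvgM; first exact: cvg_cst.
  exact: cvg_harmonic.
have [||||||n [l [nlt ul El cl]]] := @level_palais_smale kappa a (fun j => (uy j).2) (fun j => (uy j).1) e k0.
- by move=> j; apply: DM; have [] := huy j.
- exact: e_cvg.
- by move=> j; have [] := huy j.
- by move=> j; have [Du yu _ _] := huy j; exact: (y0 j (uy j).1).
- by move=> j; have [] := huy j.
- move=> j v; have [_ _ _ h] := huy j.
  have [Z [_ _ Nd d00]] := linear_real (dlevel_linear kappa (uy j).2).
  have [->|v0] := eqVneq v 0; first by rewrite d00 !normr0 mulr0.
  have nv : 0 < `|v| by rewrite normr_gt0.
  have h1 (t : R) : `|t| = `|v|^-1 -> t * dlevel kappa (uy j).2 v <= e j.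
    by move=> ht; rewrite -Z; apply: h; rewrite normrZ ht mulVf ?gt_eqF.
  have h2 := h1 `|v|^-1; have h3 := h1 (- `|v|^-1).
  rewrite ?normrN gtr0_norm ?invr_gt0 // in h2 h3.
  have := h2 erefl; have := h3 erefl; rewrite mulNr lerNl ![_^-1 * _]mulrC.
  by rewrite ler_pdivrMr // ler_pdivlMr // mulNr ler_norml => -> ->.
- have Dl : D l by apply: (closed_cvg D cD _ _ ul); near=> j; have [] := huy (n j).
  exact: (hcrit l).
Unshelve. all: by end_near.
Qed.

(** Points of M just above level a are deformed below it and brought back to M_s by [unit_scale] at
    the same level; the image lies in a classifiable sublevel. *)
Lemma level_gap kappa a (D : set W) : 0 <= kappa -> closed D ->
  D `<=` unit_level A -> (forall u, D u -> E kappa u = a -> ~ critical_level kappa u) ->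
  exists2 e, 0 < e & forall M k, (1 <= k)%N -> symmetric_set M -> M `<=` D ->
    (forall u, M u -> E kappa u < a + e) -> index_ge k M -> (mlevel kappa k <= (a - e)%:E)%E.
Proof.
move=> k0 cD DM hcrit; have [e0 e00 he] := level_noncritical k0 cD DM hcrit.
(* The window from a - e2 to a + e2 has height at most e0 e0 / 2, so at rate e0 the displacement
   stays within e0. *)
pose e2 := Num.min e0 (e0 * e0 / 4); have e20 : 0 < e2 by rewrite lt_min e00 !mulr_gt0.
have e2a : e2 <= e0 by rewrite ge_min lexx.
have e2b : e2 <= e0 * e0 / 4 by rewrite ge_min lexx orbT.
exists (e2 / 2); first by rewrite divr_gt0.
move=> M k k1 sM MD ME iM.
have ee : 0 < e0 * e0 by rewrite mulr_gt0.
have [||||eta heta] := @deformation R W (E kappa) e0 (a - e2) (a - e2 / 2) (a + e2) e0 e00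
  (level_even kappa) _ _ _ M.
- lra.
- lra.
- exact: ltW.
- move=> u Mu; split; first by have := ME u Mu; lra.
  move=> y yu; have [y0 hy] := he u y (MD _ Mu) yu; split; first exact: level_continuous.
  move=> /andP[Ey1 Ey2]; have [|v v1 hv] := hy.
    by rewrite ler_norml; apply/andP; split; lra.
  by exists v; apply: level_descent.
have eta0 u : M u -> eta u != 0.
  move=> Mu; have [_ _ _ h] := heta u Mu.
  by have [] := he u (eta u) (MD _ Mu) h.
pose N := [set u | unit_level A u /\ E kappa u <= a - e2 / 2].
apply: (@minimax_le _ _ _ _ _ N) => //.
- by move=> u [].
- by move=> u [Mu Eu]; split; [exact: unit_symmetric|rewrite level_even].
- apply: (@index_ge_map R W W M N (unit_scale \o eta)) iM => //.
  + exact: opp_continuous.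
  + apply: continuous_in_subspaceT => u; rewrite inE => Mu.
    have [ce _ _ _] := heta u Mu; have [_ _ cs] := unit_scaleP (eta0 u Mu).
    by apply: (@continuous_comp _ _ _ eta unit_scale).
  + move=> u Mu; have [_ _ Eu _] := heta u Mu; have [? _ _] := unit_scaleP (eta0 u Mu).
    by split => //=; rewrite level_unit_scale ?eta0 // ltW.
  + move=> u Mu /=; have [_ -> _ _] := heta u Mu.
    by have [] := unit_scaleP (eta0 u Mu).
  + have [ae|ae] := leP (a - e2 / 2) 0.
      apply: (@unit_classifiable 1) => // u [Mu Eu].
      by have [] := level_le_J k0 Mu Eu; rewrite ltNge ae.
    apply: (@unit_classifiable (a - e2 / 2)^-1); first by rewrite invr_gt0.
    by move=> u [Mu Eu]; split => //; have [] := level_le_J k0 Mu Eu.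
- by move=> u [_ Eu]; rewrite lee_fin.
Qed.

Lemma unit_closed : closed (unit_level A).
Proof.
have -> : unit_level A = I @^-1` [set 1] by [].
by apply: closed_comp; [move=> u _; exact: I_cont|exact: closed_eq].
Qed.

Lemma mlevel_critical kappa k a : 0 <= kappa -> (1 <= k)%N -> mlevel kappa k = a%:E ->
  exists u, [/\ unit_level A u, E kappa u = a & critical_level kappa u].
Proof.
move=> k0 k1 ma; apply: contrapT => hn.
have [|e e0 he] := @level_gap kappa a (unit_level A) k0 unit_closed (fun=> id).
  by move=> u Mu Eu cu; apply: hn; exists u.
have : (mlevel kappa k < (a + e)%:E)%E by rewrite ma lte_fin ltrDl.
move=> /(minimax_lt k1)[M [y [MN sM iM yx hy]]].
have : (mlevel kappa k <= (a - e)%:E)%E.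
  apply: (he M) => // u Mu; rewrite -lte_fin; exact: le_lt_trans (hy u Mu) yx.
rewrite ma lee_fin; lra.
Qed.

(** By induction on the list: the odd function |u + y| - |u - y| is nonzero at y, and a small
    multiple of it does not destroy the values already nonzero. *)
Lemma odd_separation (l : seq W) : (forall x, x \in l -> x != 0) ->
  exists zeta : W -> R, [/\ continuous zeta, forall u, zeta (- u) = - zeta u &
    forall x, x \in l -> zeta x != 0].
Proof.
elim: l => [|y l IH] hl.
  by exists (fun=> 0); split=> [u|u|x] //; [exact: cvg_cst|rewrite oppr0].
have [x xl|zeta [cz oz hz]] := IH; first by apply: hl; rewrite inE xl orbT.
have [zy|zy] := boolP (zeta y != 0).
  by exists zeta; split => // x; rewrite inE => /orP[/eqP ->//|/hz].
have zy0 : zeta y = 0 by apply/eqP; rewrite negbK in zy.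
pose xi u := `|u + y| - `|u - y|.
have cxi : continuous xi.
  move=> u; apply: cvgB; apply: cvg_norm.
    by apply: cvgD; [exact: cvg_id|exact: cvg_cst].
  by apply: cvgB; [exact: cvg_id|exact: cvg_cst].
have oxi u : xi (- u) = - xi u.
  by rewrite /xi opprB -[- u - y]opprD normrN; congr (_ - _); rewrite -normrN opprD opprK.
have [e e0 he] : exists2 e, 0 < e & forall x, x \in l -> e * `|xi x| < `|zeta x|.
  elim: l hz {IH hl} => [_|x l IH hz]; first by exists 1.
  have [z zl|e e0 he] := IH; first by apply: hz; rewrite inE zl orbT.
  have zx : 0 < `|zeta x| by rewrite normr_gt0; apply: hz; rewrite inE eqxx.
  pose e1 := `|zeta x| / (`|xi x| + 1).
  have x1 : 0 < `|xi x| + 1 by rewrite ltr_wpDl.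
  exists (Num.min e e1); first by rewrite lt_min e0 divr_gt0.
  move=> z; rewrite inE => /orP[/eqP ->|/he].
    apply: (@le_lt_trans _ _ (e1 * `|xi x|)); first by rewrite ler_wpM2r // ge_min lexx orbT.
    by rewrite /e1 mulrAC ltr_pdivrMr // ltr_pM2l // ltrDl.
  by apply: le_lt_trans; rewrite ler_wpM2r // ge_min lexx.
exists (fun u => zeta u + e * xi u); split.
- move=> u; apply: cvgD; first exact: cz.
  by apply: cvgM; [exact: cvg_cst|exact: cxi].
- by move=> u; rewrite oz oxi mulrN opprD.
- move=> x; rewrite inE => /orP[/eqP ->|/he h].
    rewrite zy0 add0r mulf_neq0 ?gt_eqF // /xi subrr normr0 subr0 -mulr2n normrMn.
    by rewrite mulrn_wgt0 // normr_gt0 hl // inE eqxx.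
  apply: contraTneq h => /eqP; rewrite addr_eq0 => /eqP ->.
  by rewrite normrN normrM gtr0_norm // ltxx.
Qed.

(** If the critical points were among finitely many pairs, an odd function zeta would satisfy |zeta|
    > r on them. Cutting off the part with large |zeta|, where the sign of zeta is a sheet function,
    costs one unit of index; the rest contains no critical point and can be pushed below a. *)
Lemma mlevel_critical_infinite kappa k a : 0 <= kappa -> (1 <= k)%N ->
  mlevel kappa k = a%:E -> mlevel kappa k.+1 = a%:E -> forall l : seq W, exists u,
  [/\ unit_level A u, E kappa u = a, critical_level kappa u &
      forall x, x \in l -> u <> x /\ u <> - x].
Proof.
move=> k0 k1 ma ma' l; apply: contrapT => hn.
have [|zeta [cz oz hz]] := @odd_separation [seq x <- l | x != 0].
  by move=> x; rewrite mem_filter => /andP[].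
have [r r0 hr] : exists2 r, 0 < r & forall u, unit_level A u -> E kappa u = a ->
    critical_level kappa u -> r < `|zeta u|.
  have [r r0 hr] : exists2 r, 0 < r & forall x, x \in l -> x != 0 -> r < `|zeta x|.
    have : forall x, x \in l -> x != 0 -> zeta x != 0.
      by move=> x xl x0; apply: hz; rewrite mem_filter x0.
    elim: (l) => [_|x l' IH h]; first by exists 1.
    have [z zl|r r0 hr] := IH; first by apply: h; rewrite inE zl orbT.
    have [->|x0] := eqVneq x 0.
      by exists r => // z; rewrite inE => /orP[/eqP -> /eqP //|]; exact: hr.
    have zx : 0 < `|zeta x| / 2 by rewrite divr_gt0 // normr_gt0; apply: h => //; rewrite inE eqxx.
    exists (Num.min r (`|zeta x| / 2)); first by rewrite lt_min r0.
    move=> z; rewrite inE => /orP[/eqP -> _|zl z0].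
      by rewrite gt_min; apply/orP; right; lra.
    by rewrite gt_min hr.
  exists r => // u Mu Eu cu; have u0 := unit_neq0 Mu.
  have [x [xl ux]] : exists x, x \in l /\ (u = x \/ u = - x).
    apply: contrapT => h; apply: hn; exists u; split => // x xl.
    by split=> ux; apply: h; exists x; split => //; [left|right].
  case: ux => ux; rewrite ux ?oz ?normrN; apply: hr => //.
    by rewrite -ux.
  by rewrite -oppr_eq0 -ux.
pose D := unit_level A `&` [set u | `|zeta u| <= r].
have cnz : continuous (fun u => `|zeta u|) by move=> u; apply: cvg_norm; exact: cz.
have cD : closed D.
  apply: closedI; first exact: unit_closed.
  have -> : [set u | `|zeta u| <= r] = (fun u => `|zeta u|) @^-1` [set x | x <= r] by [].
  by apply: closed_comp; [move=> u _; exact: cnz|exact: closed_le].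
have [||e e0 he] := @level_gap kappa a D k0 cD; first by move=> u [].
  by move=> u [Mu zr] Eu cu; have := hr u Mu Eu cu; rewrite ltNge zr.
have : (mlevel kappa k.+1 < (a + e)%:E)%E by rewrite ma' lte_fin ltrDl.
move=> /(minimax_lt (ltn0Sn k))[M [y [MN sM iM yx hy]]].
(* The two open sets overlap in r/2 < |zeta| < r, so they cover; D1 lies in the closed set D free of
   critical points at level a. *)
pose D1 := [set u | `|zeta u| < r]; pose D2 := [set u | r / 2 < `|zeta u|].
have sD1 : symmetric_set D1 by move=> u; rewrite /D1 /= oz normrN.
have oD1 : open D1.
  have -> : D1 = (fun u => `|zeta u|) @^-1` [set x | x < r] by [].
  by apply: open_comp; [move=> u _; exact: cnz|exact: open_lt].
have oD2 : open D2.
  have -> : D2 = (fun u => `|zeta u|) @^-1` [set x | r / 2 < x] by [].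
  by apply: open_comp; [move=> u _; exact: cnz|exact: open_gt].
have D12 : M `<=` D1 `|` D2.
  move=> u _; have [h|h] := ltP `|zeta u| r; [by left|right].
  by apply: lt_le_trans h; lra.
pose c u : 'F_2 := if 0 < zeta u then 0 else 1.
have z_neq0 u : D2 u -> zeta u != 0.
  by rewrite /D2 /= => h; rewrite -normr_gt0; apply: lt_trans h; rewrite divr_gt0.
have c_odd u : M u -> D2 u -> D2 (- u) /\ c (- u) = c u + 1.
  move=> _ Du; split; first by rewrite /D2 /= oz normrN.
  have := z_neq0 u Du; rewrite /c oz oppr_gt0 neq_lt => /orP[h|h].
    by rewrite h ltNge ltW //= F2_addxx.
  by rewrite ltNge ltW //= h add0r.
have c_cst u : M u -> D2 u -> exists2 U, nbhs u U & forall z, U z -> c z = c u.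
  move=> _ Du; have := z_neq0 u Du; rewrite neq_lt => /orP[h|h].
    have : \forall z \near u, zeta z < 0 by exact: (cvgr_lt _ (cz u)).
    by move=> h'; exists [set z | zeta z < 0] => // z hz'; rewrite /c !ltNge !ltW.
  have : \forall z \near u, 0 < zeta z by exact: (cvgr_gt _ (cz u)).
  by move=> h'; exists [set z | 0 < zeta z] => // z hz'; rewrite /c hz' h.
have oc : continuous (-%R : W -> W) by exact: opp_continuous.
have iM1 := index_ge_split oc sM sD1 oD1 oD2 D12 c_odd c_cst k1 iM.
have : (mlevel kappa k <= (a - e)%:E)%E.
  apply: (he (M `&` D1)) iM1 => //.
  - by move=> u [Mu Du]; split; [exact: sM|exact: sD1].
  - by move=> u [Mu Du]; split; [exact: MN|exact: ltW].
  - by move=> u [Mu _]; rewrite -lte_fin; exact: le_lt_trans (hy u Mu) yx.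
rewrite ma lee_fin; lra.
Qed.

(** * From levels on M_s back to lambda_c and Phi *)

Section Nehari.
Variable g : W -> W -> R.
Hypothesis g0 : forall u, potential g u = 0.

Lemma lambda_funE c u : lambda_fun A B f g c u = (I u + F u - c) / J u.
Proof. by rewrite /lambda_fun g0 subr0. Qed.

Lemma PhiE lambda u : Phi A B f g lambda u = I u - lambda * J u + F u.
Proof. by rewrite /Phi g0 subr0. Qed.

Lemma is_derive_lambda_fun c u (t : R) : unit_level A u -> 0 < t ->
  is_derive t 1 (fun x => lambda_fun A B f g c (sc u x))
    (t `^ (- s - 1) * (s * c - (s - q) * F (sc u t)) / J u).
Proof.
move=> Mu t0; have J0 := J_gt0 (unit_neq0 Mu).
pose psi x := (1 + F u * x `^ (q - s) - c * x `^ (- s)) * (J u)^-1.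
apply: (@near_eq_is_derive _ _ _ psi).
  have : \forall x \near t, 0 < x by exact: lt_nbhsr.
  apply: filterS => x x0; rewrite lambda_funE I_scale ?J_scale ?F_scale ?(ltW x0) //.
  have xs : x `^ s != 0 by rewrite gt_eqF // powR_gt0.
  have xqs : x `^ (q - s) = x `^ q / x `^ s by rewrite powRB // (gt_eqF x0) implybT.
  rewrite /psi xqs powRN (_ : I u = 1) // mulr1.
  by field; rewrite xs gt_eqF.
have d1 := is_derive1_powR (q - s) t0; have d2 := is_derive1_powR (- s) t0.
have := is_deriveM (is_deriveB (is_deriveD (is_derive_cst (1 : R^o) t 1)
  (is_deriveZ (F u) d1)) (is_deriveZ c d2)) (is_derive_cst ((J u)^-1 : R^o) t 1).
move=> h; refine (is_derive_eq h _).
rewrite scaler0 !add0r F_scale ?(ltW t0) //.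
have -> : t `^ (q - s - 1) = t `^ (- s - 1) * t `^ q.
  rewrite -powRD; last by rewrite (gt_eqF t0) implybT.
  by congr (_ `^ _); ring.
have sE (a b : R) : a *: (b : R^o) = a * b by [].
by rewrite !sE /=; ring.
Qed.

Lemma nehariP c w : nehari sc A B f g c w <-> w != 0 /\ (s - q) * F w = s * c.
Proof.
split=> [[u [t [Mu t0 h ->]]]|[w0 Fw]].
  split; first by apply: sc_neq0 => //; exact: unit_neq0.
  have := is_derive_lambda_fun c Mu t0 => -[_ e]; move: (h) => -[_]; rewrite {}e => /eqP.
  rewrite !mulf_eq0 invr_eq0 (gt_eqF (J_gt0 (unit_neq0 Mu))) orbF.
  by rewrite powR_eq0 (gt_eqF t0) /= subr_eq0 => /eqP <-.
have I0 := I_gt0 w0; have [Mu _ _] := unit_scaleP w0.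
have t0 : 0 < (I w `^ (- s^-1))^-1 by rewrite invr_gt0 powR_gt0.
have wE : w = sc (unit_scale w) (I w `^ (- s^-1))^-1 by rewrite scK // powR_gt0.
exists (unit_scale w), (I w `^ (- s^-1))^-1; split => //.
have := is_derive_lambda_fun c Mu t0; rewrite -wE Fw subrr mulr0 mul0r.
exact.
Qed.

(** [mu c] is the constant value of F on the Nehari set; [kap c] solves F - c = kap c F^(s/q)
    there. *)
Definition mu (c : R) := c * s / (s - q).
Definition kap (c : R) := c * q / (s - q) * mu c `^ (- (s / q)).

Lemma mu_gt0 c : 0 < c -> 0 < mu c.
Proof. by move=> c0; rewrite divr_gt0 ?mulr_gt0 ?subr_gt0. Qed.

Lemma kap_gt0 c : 0 < c -> 0 < kap c.
Proof. by move=> c0; rewrite mulr_gt0 ?powR_gt0 ?mu_gt0 // divr_gt0 ?mulr_gt0 ?subr_gt0. Qed.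

Lemma nehari_mu c w : nehari sc A B f g c w <-> w != 0 /\ F w = mu c.
Proof.
rewrite nehariP; split=> -[w0 h]; split => //.
  by rewrite /mu [c * s]mulrC -h [_ * F w]mulrC mulfK // gt_eqF // subr_gt0.
by rewrite h /mu mulrC divfK 1?mulrC // gt_eqF // subr_gt0.
Qed.

Lemma lambda_fun_level c w : 0 < c -> F w = mu c -> lambda_fun A B f g c w = E (kap c) w.
Proof.
move=> c0 Fw; rewrite lambda_funE /level; congr (_ / _).
rewrite -addrA; congr (_ + _); rewrite Fw /kap -mulrA -powRD; last first.
  by rewrite (gt_eqF (mu_gt0 c0)) implybT.
rewrite addNr powRr0 mulr1 /mu.
by field; rewrite gt_eqF // subr_gt0.
Qed.

Definition nehari_scale c u := sc u ((mu c / F u) `^ q^-1).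

Lemma nehari_scaleP c u : 0 < c -> u != 0 ->
  [/\ nehari_scale c u != 0, F (nehari_scale c u) = mu c,
      nehari_scale c (- u) = - nehari_scale c u & {for u, continuous (nehari_scale c)}].
Proof.
move=> c0 u0; have F0 := F_gt0 u0; have m0 := mu_gt0 c0.
have mF : 0 < mu c / F u by rewrite divr_gt0.
split.
- by apply: sc_neq0 => //; rewrite powR_gt0.
- rewrite F_scale ?powR_ge0 // -powRrM mulVf ?gt_eqF // powRr1 ?(ltW mF) //.
  by rewrite divfK // gt_eqF.
- by rewrite /nehari_scale F_even scN ?powR_ge0.
- apply: sc_continuous; last by rewrite powR_gt0.
  apply: (@continuous_cvg _ _ _ _ _ (fun u => mu c / F u) (fun y => powR y q^-1)).
    exact: powR_continuous.
  apply: cvgM; first exact: cvg_cst.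
  by apply: cvgV; [rewrite gt_eqF|exact: F_cont].
Qed.

Lemma nehari_unitK c u : 0 < c -> unit_level A u -> unit_scale (nehari_scale c u) = u.
Proof.
move=> c0 Mu; have F0 := F_gt0 (unit_neq0 Mu).
have t0 : 0 < (mu c / F u) `^ q^-1 by rewrite powR_gt0 // divr_gt0 ?mu_gt0.
rewrite /unit_scale I_scale ?(ltW t0) // (_ : I u = 1) // mulr1.
by rewrite -powRrM mulrN mulfV ?gt_eqF // powR_inv1 ?(ltW t0) // scK.
Qed.

Lemma lambda_cE c k : 0 < c -> (1 <= k)%N -> lambda_c sc A B f g c k = mlevel (kap c) k.
Proof.
move=> c0 k1; apply/eqP; rewrite eq_le; apply/andP; split.
- apply: (minimax_transfer (h := nehari_scale c) (g := unit_scale)) => // u Mu.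
    have u0 := unit_neq0 Mu; have [w0 Fw Nw cw] := nehari_scaleP c0 u0.
    split; [exact: cw|exact/nehari_mu|exact: Nw|exact: nehari_unitK|].
    by rewrite lambda_fun_level // level_scale // powR_gt0 // divr_gt0 ?mu_gt0 ?F_gt0.
  have [u0 _] := (nehari_mu c u).1 Mu.
  by have [? ? ?] := unit_scaleP u0.
- apply: (minimax_transfer (h := unit_scale) (g := nehari_scale c)) => // w Nw.
    have [w0 Fw] := (nehari_mu c w).1 Nw; have [Mu Nu cu] := unit_scaleP w0.
    have t0 : 0 < I w `^ (- s^-1) by rewrite powR_gt0 // I_gt0.
    split => //; last by rewrite level_unit_scale // lambda_fun_level.
    rewrite /nehari_scale F_scale ?(ltW t0) // Fw invfM mulrCA mulfV ?gt_eqF ?mu_gt0 //.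
    by rewrite mulr1 powR_inv powRVK ?(ltW t0) ?gt_eqF // scK.
  by have [] := nehari_scaleP c0 (unit_neq0 Nw).
Qed.

Lemma lambda_E k : (1 <= k)%N -> lambda_ A B k = mlevel 0 k.
Proof.
move=> k1; have EJ u : unit_level A u -> (J u)^-1 = E 0 u.
  by move=> Mu; rewrite /level mul0r addr0 (_ : I u = 1) // mul1r.
have ci u : {for u, continuous (id : W -> W)} by exact: cvg_id.
apply/eqP; rewrite eq_le; apply/andP; split.
  by apply: (minimax_transfer (h := id) (g := id)) => // u Mu; split => //; exact: EJ.
by apply: (minimax_transfer (h := id) (g := id)) => // u Mu; split => //; rewrite -EJ.
Qed.

Lemma is_diff_Phi lambda u :
  is_diff u (Phi A B f g lambda : W -> R^o) (fun v => A u v - lambda * B u v - f u v).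
Proof.
have -> : (Phi A B f g lambda : W -> R^o) =
    (I : W -> R^o) - lambda *: (J : W -> R^o) - (potential f : W -> R^o).
  by apply/funext => v; rewrite PhiE.
have dI := potential_diff A_pot u; have dJ := potential_diff B_pot u.
have df := potential_diff f_potential u.
exact: (is_diffB (is_diffB dI (is_diffZ lambda dJ)) df).
Qed.

Lemma critical_PhiP lambda u : critical_point (Phi A B f g lambda) u <->
  forall v, A u v = lambda * B u v + f u v.
Proof.
have dP := is_diff_Phi lambda u; split=> [dP0 v|h].
  have e : (fun v => A u v - lambda * B u v - f u v) = fun=> 0.
    by rewrite -(@diff_val _ _ _ _ _ _ _ dP) (@diff_val _ _ _ _ _ _ _ dP0).
  by have := congr1 (@^~ v) e => /= /eqP; rewrite -addrA -opprD subr_eq0 => /eqP.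
apply: (is_diff_eq dP); apply/funext => v.
by rewrite h -addrA -opprD subrr.
Qed.

Lemma critical_lambda_fun c a w : w != 0 -> (forall v, A w v = a * B w v + f w v) ->
  lambda_fun A B f g c w = a -> critical_point (lambda_fun A B f g c) w.
Proof.
move=> w0 h la; have J0 : J w != 0 by rewrite gt_eqF // J_gt0.
have dI := potential_diff A_pot w; have dJ := potential_diff B_pot w.
have df := potential_diff f_potential w.
have dV : is_diff w (fun y => (J y)^-1 : R^o) (- J w ^- 2 \*: (B w : W -> R^o)).
  have eJ := @ex_diff _ _ _ _ _ _ _ dJ.
  apply: DiffDef; first exact: differentiableV.
  by apply: etrans (diffV eJ J0) _; rewrite (@diff_val _ _ _ _ _ _ _ dJ).
have dM := is_diffM (is_diffB (is_diffB dI df) (is_diff_cst (c : R^o) w)) dV.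
have e : (lambda_fun A B f g c : W -> R^o) =
  (((I : W -> R^o) - (potential f : W -> R^o) - cst c) * (fun y => (J y)^-1 : R^o)).
  by apply/funext => v; rewrite lambda_funE.
rewrite /critical_point e; apply: (is_diff_eq dM); apply/funext => v.
have e2 : I w - potential f w - c = a * J w.
  by rewrite -la lambda_funE divfK.
have -> : (((I : W -> R^o) - (potential f : W -> R^o) - cst c) w *: (- J w ^- 2 \*: (B w : W -> R^o)) +
   (J w)^-1 *: ((A w : W -> R^o) - (f w : W -> R^o) - 0)) v =
   (I w - potential f w - c) * (- J w ^- 2 * B w v) + (J w)^-1 * (A w v - f w v - 0) by [].
by rewrite e2 h; field.
Qed.

(** At u criticality reads A = a B + kappa (s/q) F^(s/q - 1) f. Scaling by t multiplies A and B by
    t^s and f by t^q; with t^q = mu/F the coefficient of f becomes 1. *)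
Lemma level_critical_point c a u : 0 < c -> unit_level A u -> E (kap c) u = a ->
  critical_level (kap c) u -> let w := nehari_scale c u in
  [/\ w != 0, forall v, A w v = a * B w v + f w v, lambda_fun A B f g c w = a &
      Phi A B f g a w = c].
Proof.
move=> c0 Mu Eu cu w; have u0 := unit_neq0 Mu; have [w0 Fw _ _] := nehari_scaleP c0 u0.
have F0 := F_gt0 u0; have m0 := mu_gt0 c0.
pose t := (mu c / F u) `^ q^-1; have t0 : 0 < t by rewrite powR_gt0 // divr_gt0.
have la : lambda_fun A B f g c w = a by rewrite lambda_fun_level // level_scale.
split => //; last first.
  move: la; rewrite lambda_funE => e; have J0 : J w != 0 by rewrite gt_eqF // J_gt0.
  by rewrite PhiE -e divfK // /w; ring.
(* Scaling is invertible for t > 0, so every test vector is a scaled one. *)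
move=> z; have zE : z = sc (sc z t^-1) t.
  by rewrite (scaling_mul scs) ?invr_ge0 ?(ltW t0) // mulVf ?gt_eqF // (scaling_1 scs).
pose v := sc z t^-1; rewrite zE -/v.
have [_ _ _ sA] := A_scaled; have [_ _ _ sB] := B_scaled.
rewrite /w /nehari_scale -/t sA ?sB ?H1_f ?(ltW t0) //.
have := cu v; rewrite /dlevel => /eqP; rewrite mulf_eq0 invr_eq0 (gt_eqF (J_gt0 u0)) orbF.
rewrite Eu !subr_eq => /eqP; rewrite add0r => ->.
rewrite mulrDr mulrCA; congr (_ + _); rewrite mulrA; congr (_ * _).
have tq : t `^ q = mu c / F u.
  by rewrite -powRrM mulVf ?gt_eqF // powRr1 // ltW // divr_gt0.
have ts : t `^ s = (mu c / F u) `^ (s / q) by rewrite -tq powR_qs.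
have mm : mu c `^ (- (s / q)) = (mu c `^ (s / q))^-1 by rewrite powRN.
rewrite ts tq powRM ?invr_ge0 ?(ltW F0) ?(ltW m0) // powR_inv (powRB (x := F u)); last by rewrite (gt_eqF F0) implybT.
rewrite powRr1 ?(ltW F0) // /kap mm.
have p1 : mu c `^ (s / q) != 0 by rewrite gt_eqF // powR_gt0.
have p2 : F u `^ (s / q) != 0 by rewrite gt_eqF // powR_gt0.
have sq : s - q != 0 by rewrite gt_eqF // subr_gt0.
rewrite /mu in p1 *.
by field; rewrite ?p1 ?p2 ?sq !gt_eqF.
Qed.

Let p := s / q - 1.
Let K0 := q / (s - q) * (s / (s - q)) `^ (- (s / q)).

Let sq_gt0 : 0 < s - q. Proof. by rewrite subr_gt0. Qed.
Let p_gt0 : 0 < p. Proof. by rewrite subr_gt0 ltr_pdivlMr // mul1r. Qed.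
Let K0_gt0 : 0 < K0. Proof. by rewrite mulr_gt0 ?powR_gt0 // divr_gt0. Qed.

Lemma kapE c : 0 < c -> kap c = K0 * c^-1 `^ p.
Proof.
move=> c0; rewrite /kap /K0 (_ : mu c = c * (s / (s - q))); last by rewrite /mu mulrA.
have h : 0 <= s / (s - q) by rewrite divr_ge0 // ltW.
have cp : c `^ p = c `^ (s / q) / c.
  by rewrite /p powRB ?(gt_eqF c0) ?implybT // powRr1 // ltW.
rewrite (powRM (- (s / q)) (ltW c0) h) (powR_inv c) cp (powRN c).
have cs : c `^ (s / q) != 0 by rewrite gt_eqF // powR_gt0.
by field; rewrite cs !gt_eqF.
Qed.

Lemma kap_decr c d : 0 < c -> c < d -> kap d < kap c.
Proof.
move=> c0 cd; have d0 := lt_trans c0 cd.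
rewrite !kapE // ltr_pM2l // gt0_ltr_powR ?nnegrE ?invr_ge0 ?(ltW c0) ?(ltW d0) //.
by rewrite ltf_pV2 ?posrE.
Qed.

Lemma kap_surj k : 0 < k -> exists2 c, 0 < c & kap c = k.
Proof.
move=> k0; have h : 0 < k / K0 by rewrite divr_gt0.
exists ((k / K0) `^ p^-1)^-1; first by rewrite invr_gt0 powR_gt0.
rewrite kapE ?invr_gt0 ?powR_gt0 // invrK -powRrM mulVf ?gt_eqF // powRr1 ?(ltW h) //.
by rewrite mulrC divfK // gt_eqF.
Qed.

Lemma kap_continuous c : 0 < c -> {for c, continuous kap}.
Proof.
move=> c0; have h : {for c, continuous (fun c : R => K0 * c^-1 `^ p)}.
  apply: cvgM; first exact: cvg_cst.
  apply: (@continuous_cvg _ _ _ _ _ (fun c : R => c^-1) (fun y => powR y p)).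
    by apply: powR_continuous; rewrite invr_gt0.
  by apply: inv_continuous; rewrite gt_eqF.
have e : \forall x \near c, K0 * x^-1 `^ p = kap x.
  have : \forall x \near c, 0 < x by exact: lt_nbhsr.
  by apply: filterS => x x0; rewrite kapE.
move/near_eq_cvg: e => e; rewrite /prop_for /continuous_at kapE // => S hS.
by apply: e; exact: h.
Qed.

Section FixedIndex.
Variable k : nat.
Hypotheses (k1 : (1 <= k)%N) (m0_lt : (mlevel 0 k < +oo)%E).

Lemma mlevel_fin kappa : 0 <= kappa -> mlevel kappa k \is a fin_num.
Proof.
move=> k0; rewrite ge0_fin_numE ?mlevel_ge0 //.
have f0 : mlevel 0 k \is a fin_num by rewrite ge0_fin_numE ?mlevel_ge0.
have [C _ hC] := mlevel_upper.
apply: (@le_lt_trans _ _ ((1 + (kappa - 0) * C) * (fine (mlevel 0 k) + 1))%:E); last exact: ltry.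
apply: hC => //; first by rewrite lexx k0.
by rewrite -[X in (X < _)%E](fineK f0) lte_fin ltrDl.
Qed.

Definition rlevel kappa := fine (mlevel kappa k).

Lemma rlevelE kappa : 0 <= kappa -> mlevel kappa k = (rlevel kappa)%:E.
Proof. by move=> k0; rewrite fineK // mlevel_fin. Qed.

Lemma rlevel_ge0 kappa : 0 <= kappa -> 0 <= rlevel kappa.
Proof. by move=> k0; rewrite -lee_fin -rlevelE // mlevel_ge0. Qed.

Lemma rlevel_lt kappa kappa' : 0 <= kappa < kappa' -> rlevel kappa < rlevel kappa'.
Proof.
move=> /andP[k0 kk]; have k'0 : 0 <= kappa' := le_trans k0 (ltW kk).
have [|eta e0 he] := @mlevel_lower kappa kappa' k (rlevel kappa' + 1) _ k1; first by rewrite k0.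
(* d <= 1 stays within the range where [eta] is valid, and d <= eta/2 leaves a strict gain. *)
pose d := Num.min 1 (eta / 2); have d0 : 0 < d by rewrite lt_min ltr01 divr_gt0.
have d1 : d <= 1 by rewrite ge_min lexx.
have d2 : d <= eta / 2 by rewrite ge_min lexx orbT.
have := he (rlevel kappa' + d); rewrite lerD2l d1 !rlevelE // lte_fin ltrDl d0 lee_fin.
by move=> /(_ isT isT); lra.
Qed.

Lemma rlevel_le kappa kappa' : 0 <= kappa <= kappa' -> rlevel kappa <= rlevel kappa'.
Proof.
move=> /andP[k0]; rewrite le_eqVlt => /orP[/eqP -> //|kk].
by apply/ltW/rlevel_lt; rewrite k0.
Qed.

Lemma rlevel_dist : exists2 C, 0 < C & forall kappa kappa' K, 0 <= kappa <= K -> 0 <= kappa' <= K ->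
  `|rlevel kappa' - rlevel kappa| <= `|kappa' - kappa| * (C * rlevel K).
Proof.
have [C C0 hC] := mlevel_upper; exists C => //.
suff h kappa kappa' K : 0 <= kappa <= kappa' -> kappa' <= K ->
    `|rlevel kappa' - rlevel kappa| <= `|kappa' - kappa| * (C * rlevel K).
  move=> kappa kappa' K /andP[h1 h2] /andP[h3 h4]; have [kk|/ltW kk] := leP kappa kappa'.
    by apply: h; rewrite ?h1.
  by rewrite distrC [`|kappa' - _|]distrC; apply: h; rewrite ?h3.
move=> /andP[k0 kk] kK; have k'0 := le_trans k0 kk.
have kl : rlevel kappa <= rlevel kappa' by apply: rlevel_le; rewrite k0.
have lK : rlevel kappa <= rlevel K by apply: rlevel_le; rewrite k0 (le_trans kk).
rewrite !ger0_norm ?subr_ge0 //.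
pose D := 1 + (kappa' - kappa) * C.
have D0 : 0 < D by rewrite ltr_wpDr // mulr_ge0 ?subr_ge0 // ltW.
suff h : rlevel kappa' <= D * rlevel kappa.
  have : (kappa' - kappa) * (C * rlevel kappa) <= (kappa' - kappa) * (C * rlevel K).
    by rewrite ler_wpM2l ?subr_ge0 // ler_pM2l.
  by move: h; rewrite /D mulrDl mul1r -mulrA; lra.
(* [mlevel_upper] asks for a number strictly above the level; if the claim failed, the midpoint x
   would be one and give a contradiction. *)
rewrite leNgt; apply/negP => h.
have h1 : rlevel kappa < rlevel kappa' / D by rewrite ltr_pdivlMr // mulrC.
pose x := (rlevel kappa + rlevel kappa' / D) / 2.
have : rlevel kappa' <= D * x.
  rewrite -lee_fin -rlevelE //; apply: hC; rewrite ?k0 //.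
  by rewrite rlevelE // lte_fin /x; lra.
rewrite /x mulrA mulrDr [D * (_ / D)]mulrC divfK ?gt_eqF //; lra.
Qed.

Lemma rlevel_near kappa0 (e : R) : 0 <= kappa0 -> 0 < e -> exists2 d, 0 < d &
  forall kappa, 0 <= kappa -> `|kappa - kappa0| < d -> `|rlevel kappa - rlevel kappa0| < e.
Proof.
move=> k0 e0; have [C C0 hC] := rlevel_dist.
pose X := C * rlevel (kappa0 + 1) + 1.
have r0 : 0 <= C * rlevel (kappa0 + 1) by rewrite mulr_ge0 ?(ltW C0) // rlevel_ge0 // addr_ge0.
have X0 : 0 < X by rewrite ltr_wpDl.
exists (Num.min 1 (e / X)); first by rewrite lt_min ltr01 divr_gt0.
move=> kappa ka; rewrite lt_min => /andP[h1 h2].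
have := hC kappa0 kappa (kappa0 + 1); rewrite k0 ka lerDl ler01 /=.
have -> : kappa <= kappa0 + 1 by move: h1; rewrite ltr_norml => /andP[_]; lra.
move=> /(_ isT isT) h; apply: le_lt_trans h _.
move: h2; rewrite ltr_pdivlMr //; apply: le_lt_trans.
by rewrite ler_wpM2l // /X lerDl.
Qed.

Lemma rlevel_ivt lambda : rlevel 0 < lambda -> exists2 kappa, 0 < kappa & rlevel kappa = lambda.
Proof.
move=> l0; have [K K_gt0 hK] := mlevel_infty lambda.
have Kl : lambda <= rlevel K by rewrite -lee_fin -rlevelE ?(ltW K_gt0) //; exact: hK.
(* The absolute value extends the function continuously to negative arguments. *)
have c : continuous (fun x : R => rlevel `|x|).
  move=> x; apply/cvgrPdist_lt => e e0.
  have [d d0 hd] := rlevel_near (normr_ge0 x) e0.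
  exists d => // y /= xy.
  rewrite distrC; apply: hd => //; apply: le_lt_trans xy.
  by rewrite distrC; exact: ler_dist_dist.
have [||x] := @IVT R (fun x => rlevel `|x|) 0 K lambda (ltW K_gt0).
- exact: continuous_subspaceT.
- by rewrite normr0 (gtr0_norm K_gt0) ge_min (ltW l0) le_max Kl orbT.
rewrite in_itv /= => /andP[x0 _]; rewrite ger0_norm // => e.
exists x => //; rewrite lt_neqAle x0 andbT; apply: contraTneq l0 => x00.
by rewrite x00 e ltxx.
Qed.

End FixedIndex.

Section InfiniteDimensional.
Hypothesis W_inf : infinite_dimensional W.

Let m0_lt k : (1 <= k)%N -> (mlevel 0 k < +oo)%E.
Proof. exact: mlevel_lt_pinfty. Qed.

Lemma lambda_c_rlevel c k : 0 < c -> (1 <= k)%N ->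
  lambda_c sc A B f g c k = (rlevel k (kap c))%:E.
Proof. by move=> c0 k1; rewrite lambda_cE // rlevelE ?m0_lt // ltW // kap_gt0. Qed.

Lemma lambda_c_pinfty c : 0 < c -> lambda_c sc A B f g c k @[k --> \oo] --> +oo%E.
Proof.
move=> c0; apply/cvgeyPge => L; have [m hm] := mlevel_coercive L (ltW (kap_gt0 c0)).
exists m.+1 => // k /= mk; rewrite lambda_cE //; first exact: hm.
exact: leq_trans mk.
Qed.

Lemma lambda_c_critical c k : 0 < c -> (1 <= k)%N -> exists w : W,
  let a := fine (lambda_c sc A B f g c k) in
  [/\ w != 0, forall v, A w v = a * B w v + f w v, lambda_fun A B f g c w = a &
      Phi A B f g a w = c].
Proof.
move=> c0 k1; have k0 := ltW (kap_gt0 c0).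
have [u [Mu Eu cu]] := mlevel_critical k0 k1 (rlevelE k1 (m0_lt k1) k0).
exists (nehari_scale c u); rewrite lambda_c_rlevel //=.
exact: level_critical_point.
Qed.

Lemma lambda_c_decr c d k : 0 < c -> c < d -> (1 <= k)%N ->
  (lambda_c sc A B f g d k < lambda_c sc A B f g c k)%E.
Proof.
move=> c0 cd k1; have d0 := lt_trans c0 cd.
rewrite !lambda_c_rlevel // lte_fin rlevel_lt ?m0_lt //.
by rewrite (ltW (kap_gt0 d0)) kap_decr.
Qed.

Lemma lambda_c_continuous c k : 0 < c -> (1 <= k)%N ->
  {for c, continuous (fun c => fine (lambda_c sc A B f g c k))}.
Proof.
move=> c0 k1; apply/cvgrPdist_lt => e e0.
have [d d0 hd] := rlevel_near k1 (m0_lt k1) (ltW (kap_gt0 c0)) e0.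
have h1 : \forall x \near c, 0 < x by exact: lt_nbhsr.
have /cvgrPdist_lt /(_ _ d0) h2 := kap_continuous c0.
apply: filterS (filterI h1 h2) => x [x0 xd].
rewrite !lambda_c_rlevel //= distrC; apply: hd; first by rewrite ltW // kap_gt0.
by rewrite distrC.
Qed.

Lemma lambda_c_0 k : (1 <= k)%N -> lambda_c sc A B f g c k @[c --> 0^'+] --> +oo%E.
Proof.
move=> k1; apply/cvgeyPge => L; have [ka ka0 hka] := mlevel_infty L.
have [d d0 kd] := kap_surj ka0.
near=> c; have c0 : 0 < c by near: c; exact: nbhs_right_gt.
rewrite lambda_cE //; apply: hka => //; rewrite -kd ltW // kap_decr //.
Unshelve. all: by end_near.
Qed.

Lemma lambda_c_infty k : (1 <= k)%N -> lambda_c sc A B f g c k @[c --> +oo] --> lambda_ A B k.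
Proof.
move=> k1; rewrite lambda_E // rlevelE ?m0_lt //.
apply/fine_cvgP; split.
  near=> c; have c0 : 0 < c by near: c; exact: nbhs_pinfty_gt.
  by rewrite lambda_c_rlevel.
apply/cvgrPdist_lt => e e0; have [d d0 hd] := rlevel_near k1 (m0_lt k1) (lexx 0) e0.
have [c1 c10 kc1] := kap_surj d0.
near=> c; have c0 : 0 < c by near: c; exact: nbhs_pinfty_gt.
rewrite /= lambda_c_rlevel //= distrC; have kc0 := kap_gt0 c0.
apply: hd; first exact: ltW.
rewrite subr0 gtr0_norm // -kc1; apply: kap_decr => //.
by near: c; apply: nbhs_pinfty_gt; exact: num_real.
Unshelve. all: by end_near.
Qed.

End InfiniteDimensional.

(** * Pohozaev identity and multiplicity *)

Section CriticalPoints.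
Hypothesis pohozaev : forall lambda u, (forall v, A u v = lambda * B u v + f u v) ->
  s * potential A u = s * lambda * potential B u + q * potential f u.

(** The identity turns s Phi(u) into (s - q) F(u), which is positive. *)
Lemma critical_Phi_gt0 lambda u : u != 0 -> critical_point (Phi A B f g lambda) u ->
  0 < Phi A B f g lambda u.
Proof.
move=> u0 /critical_PhiP /pohozaev; rewrite -/(I u) -/(J u) -[potential f u]opprK -/(F u) => h.
have F0 := F_gt0 u0; rewrite PhiE.
have : 0 < (s - q) * F u by rewrite mulr_gt0.
have -> : (s - q) * F u = s * (I u - lambda * J u + F u) by move: h; lra.
by rewrite pmulr_rgt0.
Qed.

Lemma index_ge1 (M : set W) : M !=set0 -> classifiable M -> index_ge 1 M.
Proof.
move=> [u Mu] cM; split => // w c _ /= h.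
have [U nU hU] := h (proj_antipodal (exist _ u (mem_set Mu) : M)).
have := hU (fun=> proj_antipodal (exist _ u (mem_set Mu) : M)) (fun=> nbhs_singleton nU).
by move/eqP; rewrite oner_eq0.
Qed.

(** One antipodal pair already has index 1, so the first level is at most every Rayleigh quotient
    I/J. *)
Lemma mlevel1_le u : u != 0 -> (mlevel 0 1 <= (I u / J u)%:E)%E.
Proof.
move=> u0; have [Mu Nu _] := unit_scaleP u0; set v := unit_scale u in Mu.
have Ev : E 0 v = I u / J u by rewrite level_unit_scale // /level mul0r addr0.
have M'v : unit_level A (- v) by exact: unit_symmetric.
have Jv : J (- v) = J v := J_even v.
apply: (@minimax_le _ _ _ _ _ [set x | x = v \/ x = - v]) => //.
- by move=> x [->|->].
- by move=> x [->|->] /=; rewrite ?opprK; [right|left].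
- apply: index_ge1; first by exists v; left.
  apply: (@unit_classifiable (J v)); first exact/J_gt0/unit_neq0.
  by move=> x [->|->]; rewrite ?Jv.
- by move=> x [->|->]; rewrite ?level_even lee_fin Ev.
Qed.

(** A critical point satisfies s (I - lambda J) = - q F < 0, against lambda <= I/J. *)
Lemma no_critical_Phi lambda u : (lambda%:E <= lambda_ A B 1)%E -> u != 0 ->
  ~ critical_point (Phi A B f g lambda) u.
Proof.
move=> l1 u0 cu; have := critical_Phi_gt0 u0 cu; have J0 := J_gt0 u0.
have /pohozaev := (critical_PhiP lambda u).1 cu.
rewrite -/(I u) -/(J u) -[potential f u]opprK -/(F u) PhiE => h _.
have : lambda <= I u / J u by rewrite -lee_fin; apply: le_trans l1 _; rewrite lambda_E // mlevel1_le.
rewrite ler_pdivlMr // => h2; have qF : 0 < q * F u by rewrite mulr_gt0 // F_gt0.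
have := ler_wpM2l (ltW s_gt0) h2; lra.
Qed.

Lemma many_critical_Phi k lambda : (1 <= k)%N -> (lambda_ A B k < lambda%:E)%E ->
  exists u : 'I_k -> W,
    (forall i, u i != 0 /\ critical_point (Phi A B f g lambda) (u i)) /\
    (forall i j, i != j -> u i <> u j /\ u i <> - u j).
Proof.
move=> k1; rewrite lambda_E // => lk.
(* Finiteness of the levels up to k follows from the assumption that lambda lies above the k-th
   one. *)
have m0_lt j : (1 <= j <= k)%N -> (mlevel 0 j < +oo)%E.
  by move=> jk; apply: le_lt_trans (minimax_leq _ _ jk) _; apply: lt_trans lk _; exact: ltry.
have /choice[ka hka] : forall j, exists kappa, (1 <= j <= k)%N ->
    0 < kappa /\ rlevel j kappa = lambda.
  move=> j; have [jk|/negP nj] := boolP (1 <= j <= k)%N; last by exists 0.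
  have j1 : (1 <= j)%N by case/andP: jk.
  have [|kappa k0 e] := @rlevel_ivt j j1 (m0_lt j jk) lambda; last by exists kappa.
  rewrite -lte_fin -rlevelE ?m0_lt //.
  exact: le_lt_trans (minimax_leq _ _ jk) lk.
have kE j : (1 <= j <= k)%N -> mlevel (ka j) j = lambda%:E.
  move=> jk; have [k0 e] := hka j jk; have /andP[j1 _] := jk.
  by rewrite rlevelE ?m0_lt ?(ltW k0) // e.
have wlog_lt (u : 'I_k -> W) : (forall i j : 'I_k, (i < j)%N -> u j <> u i /\ u j <> - u i) ->
    forall i j, i != j -> u i <> u j /\ u i <> - u j.
  move=> h i j ij; have [l|l|e] := ltngtP i j.
  - have [h1 h2] := h i j l; split=> [/esym //|e]; apply: h2.
    by rewrite e opprK.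
  - exact: h.
  - by move/negP: ij; case; apply/eqP/val_inj.
have ucp c u : 0 < c -> unit_level A u -> E (kap c) u = lambda -> critical_level (kap c) u ->
    let w := nehari_scale c u in [/\ w != 0, critical_point (Phi A B f g lambda) w &
      Phi A B f g lambda w = c].
  move=> c0 Mu Eu cu w; have [w0 hw _ Pw] := level_critical_point c0 Mu Eu cu.
  by split => //; apply/critical_PhiP.
(* If two consecutive parameters agree, one value of c has infinitely many critical pairs, and k of
   them are picked one by one, each avoiding the earlier ones. *)
have [[j [j1 jk ej]]|ndup] := pselect (exists j, [/\ (1 <= j)%N, (j < k)%N & ka j = ka j.+1]).
  have jk' : (1 <= j <= k)%N by rewrite j1 ltnW.
  have [k0 _] := hka j jk'; have [c c0 kc] := kap_surj k0.
  have e1 : mlevel (kap c) j = lambda%:E by rewrite kc kE.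
  have e2 : mlevel (kap c) j.+1 = lambda%:E by rewrite kc ej kE // jk.
  have /choice[next hnext] := mlevel_critical_infinite (ltW (kap_gt0 c0)) j1 e1 e2.
  pose ls := fix ls i := if i is i'.+1 then next (ls i') :: ls i' else [::].
  have mls i m : (i < m)%N -> next (ls i) \in ls m.
    elim: m => // m IH; rewrite ltnS leq_eqVlt => /orP[/eqP ->|/IH h] /=.
      by rewrite inE eqxx.
    by rewrite inE h orbT.
  exists (fun i => nehari_scale c (next (ls i))); split.
    by move=> i; have [Mu Eu cu _] := hnext (ls i); have [] := ucp c _ c0 Mu Eu cu.
  apply: wlog_lt => i m im; have [Mu _ _ h] := hnext (ls m).
  have [Mv _ _ _] := hnext (ls i).
  have [h1 h2] := h _ (mls i m im).
  have [v0 _ _ _] := nehari_scaleP c0 (unit_neq0 Mv).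
  have [_ vN _] := unit_scaleP v0.
  by split=> /(congr1 unit_scale); rewrite ?vN !(nehari_unitK c0).
(* Level j + 1 is at least level j and levels increase with kappa, so it attains lambda no later
   than level j; equality was just excluded. *)
have ka_lt j : (1 <= j)%N -> (j < k)%N -> ka j.+1 < ka j.
  move=> j1 jk; rewrite lt_neqAle; apply/andP; split.
    by apply/eqP => e; apply: ndup; exists j.
  rewrite leNgt; apply/negP => h; have jk' : (1 <= j <= k)%N by rewrite j1 ltnW.
  have [k0 ek] := hka j jk'.
  have [|k0' _] := hka j.+1; first by rewrite jk.
  have := rlevel_lt j1 (m0_lt j jk') (kappa := ka j) (kappa' := ka j.+1).
  rewrite (ltW k0) h ek => /(_ isT); rewrite -lte_fin -rlevelE ?m0_lt ?(ltW k0') //.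
  apply/negP; rewrite -leNgt -(kE j.+1) ?jk //; apply: minimax_leq.
  by rewrite j1 leqnSn.
have ka_lt2 i j : (1 <= i)%N -> (i < j)%N -> (j <= k)%N -> ka j < ka i.
  move=> i1; elim: j => // j IH; rewrite ltnS leq_eqVlt => /orP[/eqP <- jk|ij jk].
    exact: ka_lt.
  apply: lt_trans (IH ij (ltnW jk)); apply: ka_lt => //.
  exact: leq_trans i1 (ltnW ij).
(* The critical value determines the parameter through [kap]; different parameters thus give
   different values of the even functional Phi, hence different pairs. *)
have /choice[w hw] : forall j, exists w : W, (j < k)%N ->
    [/\ w != 0, critical_point (Phi A B f g lambda) w & kap (Phi A B f g lambda w) = ka j.+1].
  move=> j; have [jk|_] := ltnP j k; last by exists 0.
  have [k0 _] := hka j.+1 jk; have [c c0 kc] := kap_surj k0.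
  have [u [Mu Eu cu]] := mlevel_critical (ltW k0) (ltn0Sn j) (kE j.+1 jk).
  rewrite -kc in Eu cu; have [w0 cw Pw] := ucp c u c0 Mu Eu cu.
  by exists (nehari_scale c u) => _; split => //; rewrite Pw.
exists (fun i => w i); split.
  by move=> i; have [] := hw i (ltn_ord i).
apply: wlog_lt => i j ij; have [_ _ ei] := hw i (ltn_ord i); have [_ _ ej] := hw j (ltn_ord j).
have lt_ij : ka j.+1 < ka i.+1 by exact: ka_lt2.
have PN u : Phi A B f g lambda (- u) = Phi A B f g lambda u.
  by rewrite !PhiE I_even J_even F_even.
by split=> e; move: lt_ij; rewrite -ei -ej e ?PN ltxx.
Qed.

End CriticalPoints.
End Nehari.
End ScaledFunctionals.

Theorem theorem2p20 (R : realType) (W : completeNormedModType R)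
  (sc : W -> R -> W) (q s r : R) (A B f g : W -> W -> R)
  (W_reflexive : reflexive_space W)
  (q_gt0 : 0 < q) (q_lt_s : q < s) (s_lt_r : s < r)
  (A1_A5 : is_scaling sc s)
  (A_scaled : scaled_operator sc s A)
  (B_scaled : scaled_operator sc s B)
  (f_potential : potential_operator f) (f_odd : odd_operator f)
  (g_potential : potential_operator g) (g_odd : odd_operator g)
  (A6 : forall u, u != 0 -> 0 < A u u)
  (A7 : forall (u : nat -> W) (l : W), weakly_cvg u l ->
     A (u j) (u j - l) @[j --> \oo] --> (0 : R) ->
     exists2 n : nat -> nat, {homo n : i j / (i < j)%N} & (u \o n) @ \oo --> l)
  (A8 : forall u, u != 0 -> 0 < B u u)
  (A9 : weak_to_strong B)
  (A10 : forall C : R, exists N : R, forall u, N <= `|u| -> C <= potential A u)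
  (A11 : forall (lambda : R) (u : W), (forall v, A u v = lambda * B u v) ->
     potential A u = lambda * potential B u)
  (H1_f : scales_with sc q f) (H1_g : scales_with sc r g)
  (H2_f : weak_to_strong f) (H2_g : weak_to_strong g)
  (H3 : forall (alpha beta gamma delta : R) (u : W),
     (forall v, alpha * A u v = beta * B u v + gamma * f u v + delta * g u v) ->
     s * alpha * potential A u =
       s * beta * potential B u + q * gamma * potential f u
       + r * delta * potential g u)
  (F_lt0 : forall u, u != 0 -> potential f u < 0)
  (G_eq0 : forall u, u != 0 -> potential g u = 0)
  (h_neq0 : forall (c : R) (u : W), nehari sc A B f g c u ->
     exists v, (s - q) * f u v - (r - s) * g u v != 0) :
  [/\ (* (i) *)
      infinite_dimensional W -> forall c : R, 0 < c ->
      [/\ forall k, (1 <= k)%N -> lambda_c sc A B f g c k \is a fin_num,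
          forall k l, (1 <= k <= l)%N ->
            (lambda_c sc A B f g c k <= lambda_c sc A B f g c l)%E,
          lambda_c sc A B f g c k @[k --> \oo] --> +oo%E,
          forall k, (1 <= k)%N -> exists u : W,
            [/\ u != 0, critical_point (lambda_fun A B f g c) u &
                (lambda_fun A B f g c u)%:E = lambda_c sc A B f g c k] &
          forall k, (1 <= k)%N -> exists u : W,
            [/\ u != 0,
                critical_point (Phi A B f g (fine (lambda_c sc A B f g c k))) u
              & Phi A B f g (fine (lambda_c sc A B f g c k)) u = c]],
      (* (ii) *)
      infinite_dimensional W -> forall k : nat, (1 <= k)%N ->
      [/\ forall c : R, 0 < c ->
            {for c, continuous (fun c => fine (lambda_c sc A B f g c k))},
          forall c d : R, 0 < c -> c < d ->
            (lambda_c sc A B f g d k < lambda_c sc A B f g c k)%E,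
          lambda_c sc A B f g c k @[c --> 0^'+] --> +oo%E &
          lambda_c sc A B f g c k @[c --> +oo] --> lambda_ A B k]
    & (* (iii) *)
      [/\ forall lambda : R, (lambda%:E <= lambda_ A B 1)%E ->
            ~ exists u : W, u != 0 /\ critical_point (Phi A B f g lambda) u,
          forall (k : nat) (lambda : R), (1 <= k)%N ->
            (lambda_ A B k < lambda%:E)%E ->
            exists u : 'I_k -> W,
              (forall i, u i != 0 /\ critical_point (Phi A B f g lambda) (u i))
              /\ (forall i j, i != j -> u i <> u j /\ u i <> - u j) &
          forall lambda : R,
            ~ exists u : W, [/\ u != 0, critical_point (Phi A B f g lambda) u &
                                ~ 0 < Phi A B f g lambda u]]].
Proof.
have g0 u : potential g u = 0.
  by have [->|] := eqVneq u 0; [exact: potential0|exact: G_eq0].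
(* G vanishes identically, so g does not enter the equation of critical points of Phi, and [H3] is
   taken with delta = 0. *)
have pohozaev lambda u : (forall v, A u v = lambda * B u v + f u v) ->
    s * potential A u = s * lambda * potential B u + q * potential f u.
  move=> h; have := H3 1 lambda 1 0 u; rewrite !mulr1 mulr0 mul0r addr0; apply.
  by move=> v; rewrite !mul1r mul0r addr0.
have lambdaE := lambda_c_rlevel W_reflexive q_gt0 q_lt_s A1_A5 A_scaled B_scaled f_potential
  f_odd A6 A8 A9 A10 H1_f H2_f F_lt0 g0.
have critical := lambda_c_critical W_reflexive q_gt0 q_lt_s A1_A5 A_scaled B_scaled f_potential
  f_odd A6 A7 A8 A9 A10 H1_f H2_f F_lt0 g0.
split.
- move=> W_inf c c0; split.
  + by move=> k k1; rewrite lambdaE.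
  + by move=> k l; exact: minimax_leq.
  + exact: (lambda_c_pinfty W_reflexive q_gt0 q_lt_s A1_A5 A_scaled B_scaled f_potential
      f_odd A6 A8 A9 A10 H1_f F_lt0 g0 c0).
  + move=> k k1; have [w [w0 hw la _]] := critical W_inf c k c0 k1.
    exists w; split => //; last by rewrite la lambdaE.
    exact: (critical_lambda_fun A_scaled B_scaled f_potential A8 g0 w0 hw la).
  + move=> k k1; have [w [w0 hw _ Pw]] := critical W_inf c k c0 k1.
    by exists w; split => //; apply/(critical_PhiP A_scaled B_scaled f_potential g0).
- move=> W_inf k k1; split.
  + move=> c c0; exact: (lambda_c_continuous W_reflexive q_gt0 q_lt_s A1_A5 A_scaled B_scaled
      f_potential f_odd A6 A8 A9 A10 H1_f H2_f F_lt0 g0 W_inf c0 k1).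
  + move=> c d c0 cd; exact: (lambda_c_decr W_reflexive q_gt0 q_lt_s A1_A5 A_scaled B_scaled
      f_potential f_odd A6 A8 A9 A10 H1_f H2_f F_lt0 g0 W_inf c0 cd k1).
  + exact: (lambda_c_0 W_reflexive q_gt0 q_lt_s A1_A5 A_scaled B_scaled f_potential
      f_odd A6 A8 A9 A10 H1_f H2_f F_lt0 g0 k1).
  + exact: (lambda_c_infty W_reflexive q_gt0 q_lt_s A1_A5 A_scaled B_scaled f_potential
      f_odd A6 A8 A9 A10 H1_f H2_f F_lt0 g0 W_inf k1).
- split.
  + move=> lambda l1 [u [u0 cu]].
    exact: (no_critical_Phi W_reflexive q_gt0 q_lt_s A1_A5 A_scaled B_scaled f_potential
      f_odd A6 A8 A9 A10 H1_f F_lt0 g0 pohozaev l1 u0 cu).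
  + move=> k lambda k1 lk.
    exact: (many_critical_Phi W_reflexive q_gt0 q_lt_s A1_A5 A_scaled B_scaled f_potential
      f_odd A6 A7 A8 A9 A10 H1_f H2_f F_lt0 g0 k1 lk).
  + move=> lambda [u [u0 cu]]; apply.
    exact: (critical_Phi_gt0 q_gt0 q_lt_s A_scaled B_scaled f_potential F_lt0 g0 pohozaev u0 cu).
Qed.
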